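(* Let $k$ be a field with $\operatorname{char}(k)\neq2,3$, let $c\in k^*$ and $\Delta=-c/27$. Let $\mathcal E$ be the elliptic curve $Y^2=X^3+c$ over $k$, let $\mathcal T=\{\mathcal O,(0,\sqrt c),(0,-\sqrt c)\}\subseteq\mathcal E(k_s)$, and let $\Psi:H^1(k,\mathcal T)\to H^1(k,\mathcal E)$ be the map induced by the inclusion $\mathcal T\hookrightarrow\mathcal E(k_s)$. Then the curves in the image of $\Psi$ are, up to $k$-isomorphism, exactly all the curves $$\mathcal C_f:\ Z^3=f(X,Y),\qquad f(X,Y)=AX^3+3BX^2Y+3CXY^2+DY^3,\quad A,B,C,D\in k,$$ whose discriminant $\Delta_f$ is nonzero and satisfies $\Delta_f\equiv\Delta \pmod{k^{*6}}$. That is, the curve underlying any element of $\operatorname{im}(\Psi)$ is $k$-isomorphic to some such $\mathcal C_f$, and every such $\mathcal C_f$ is $k$-isomorphic to the curve underlying some element of $\operatorname{im}(\Psi)$.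
   Context: $k_s$ is a separable closure of $k$ and $G_k=\operatorname{Gal}(k_s/k)$. $\mathcal E$ is the projective elliptic curve with point at infinity $\mathcal O$ as identity; $\mathcal T$ is a $G_k$-stable subgroup of order 3. $H^1(k,\mathcal E)=H^1(G_k,\mathcal E(k_s))$ is the Weil–Châtelet group, which classifies principal homogeneous spaces of $\mathcal E$ over $k$; the curve corresponding to an element is the underlying smooth projective curve of the principal homogeneous space. For $f$ as in the claim, set $R=AC-B^2$, $2S=AD-BC$, $T=BD-C^2$; the discriminant of $f$ is $\Delta_f=S^2-RT=\frac14(A^2D^2-3B^2C^2+4AC^3+4B^3D-6ABCD)$. The curve $\mathcal C_f$ is the projective plane curve with the given equation. $\Delta_f\equiv\Delta\pmod{k^{*6}}$ means $\Delta_f/\Delta\in k^{*6}$. *)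

(* Defs.v *)
From HB Require Import structures.
From mathcomp Require Import all_boot all_order all_algebra all_field.
From mathcomp Require Import mpoly.
From Stdlib Require Import ClassicalEpsilon.

Set Implicit Arguments.
Unset Strict Implicit.
Unset Printing Implicit Defensive.

Import GRing.Theory.
Local Open Scope ring_scope.

(** * Separable and algebraic closures *)

Definition rcomp (F G H : fieldType) (g : {rmorphism G -> H})
  (f : {rmorphism F -> G}) : {rmorphism F -> H} := (g \o f)%FUN.

Definition separable_closure (k ks : fieldType) (i : {rmorphism k -> ks}) : Prop :=
  (forall x : ks,
     exists2 p : {poly k}, separable_poly p & root (map_poly i p) x) /\
  (forall p : {poly ks}, separable_poly p -> (1 < size p)%N ->
     exists x, root p x).

Definition algebraic_closure (k K : fieldType) (i : {rmorphism k -> K}) : Prop :=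
  (forall x : K, algebraicOver i x) /\ GRing.closed_field_axiom K.

(** * The group of the curve [Y^2 = X^3 + c] *)

Variant ecpoint (F : Type) : Type := Infty | Affine of F & F.
Arguments Infty {F}.

Definition ec_map (F G : Type) (h : F -> G) (P : ecpoint F) : ecpoint G :=
  if P is Affine x y then Affine (h x) (h y) else Infty.

Definition on_ec (F : fieldType) (c : F) (P : ecpoint F) : Prop :=
  if P is Affine x y then y ^+ 2 = x ^+ 3 + c else True.

Definition ec_opp (F : fieldType) (P : ecpoint F) : ecpoint F :=
  if P is Affine x y then Affine x (- y) else Infty.

(* The chord-tangent law does not involve the constant [c]. *)
Definition ec_add (F : fieldType) (P Q : ecpoint F) : ecpoint F :=
  match P, Q with
  | Infty, _ => Q
  | _, Infty => P
  | Affine x1 y1, Affine x2 y2 =>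
      if (x1 == x2) && (y1 == - y2) then Infty
      else
        let l := if x1 == x2 then (3%:R * x1 ^+ 2) / (2%:R * y1)
                 else (y2 - y1) / (x2 - x1) in
        let x3 := l ^+ 2 - x1 - x2 in
        Affine x3 (l * (x1 - x3) - y1)
  end.

(* The subset [{O, (0, s), (0, -s)}], to be used with [s ^+ 2 = c]. *)
Definition ec_T (F : fieldType) (s : F) (P : ecpoint F) : Prop :=
  [\/ P = Infty, P = Affine 0 s | P = Affine 0 (- s)].

Lemma ec_T_on_ec (F : fieldType) (c s : F) :
  s ^+ 2 = c -> forall P, ec_T s P -> on_ec c P.
Proof. by move=> hs P [] -> //=; rewrite ?sqrrN hs expr0n add0r. Qed.

(** * Galois cohomology with coefficients in subgroups of the curve *)

Section Cohomology.

Variables (k ks : fieldType) (i : {rmorphism k -> ks}).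

Record gal : Type := Gal {
  gal_fun :> {rmorphism ks -> ks};
  gal_bij : bijective gal_fun;
  gal_fix : forall a : k, gal_fun (i a) = i a
}.

Lemma gal_mul_fix (s t : gal) (a : k) : s (t (i a)) = i a.
Proof. by rewrite !gal_fix. Qed.

Definition gal_mul (s t : gal) : gal :=
  @Gal (rcomp s t) (bij_comp (gal_bij s) (gal_bij t)) (gal_mul_fix s t).

(* Continuity for the Krull topology on [gal] and the discrete topology on
   the values: the automorphisms that agree with [s] on a given finite set
   form a basis of neighbourhoods of [s]. *)
Definition gal_continuous (V : Type) (a : gal -> V) : Prop :=
  forall s : gal, exists r : seq ks,
    forall t : gal, {in r, s =1 t} -> a t = a s.

(* In what follows [S] is (the membership predicate of) a [gal]-stable
   subgroup of the group of points over [ks]. *)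
Record cocycle (S : ecpoint ks -> Prop) : Type := Cocycle {
  cochain :> gal -> ecpoint ks;
  cocycle_in : forall s, S (cochain s);
  cocycleM : forall s t,
    cochain (gal_mul s t) = ec_add (cochain s) (ec_map s (cochain t));
  cocycle_cont : gal_continuous cochain
}.

Definition cohomologous (S : ecpoint ks -> Prop) (a b : cocycle S) : Prop :=
  exists2 P, S P &
    forall s, b s = ec_add (a s) (ec_add (ec_map s P) (ec_opp P)).

(* Elements of [H^1] are the cohomology classes, as sets of cocycles. *)
Definition H1 (S : ecpoint ks -> Prop) : Type :=
  {xi : cocycle S -> Prop | exists a, xi = cohomologous a}.

Definition H1_class (S : ecpoint ks -> Prop) (a : cocycle S) : H1 S :=
  exist _ (cohomologous a) (ex_intro _ a erefl).

Definition H1_repr (S : ecpoint ks -> Prop) (xi : H1 S) : cocycle S :=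
  sval (constructive_indefinite_description _ (svalP xi)).

Definition H1_mem (S : ecpoint ks -> Prop) (xi : H1 S) (a : cocycle S) : Prop :=
  sval xi a.

Definition cocycle_incl (S S' : ecpoint ks -> Prop)
    (sub : forall P, S P -> S' P) (a : cocycle S) : cocycle S' :=
  @Cocycle S' a (fun s => sub _ (cocycle_in a s)) (cocycleM a) (cocycle_cont a).

(* The map induced on [H^1] by an inclusion; as usual for maps between
   quotients it is computed on a representative. *)
Definition H1_incl (S S' : ecpoint ks -> Prop)
    (sub : forall P, S P -> S' P) (xi : H1 S) : H1 S' :=
  H1_class (cocycle_incl sub (H1_repr xi)).

End Cohomology.

(** * Projective varieties over [k], through their points over [K] *)

(* A point of projective [n]-space is a nonzero vector of homogeneous
   coordinates; equality of points is [proj_eq]. *)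
Definition proj_nz (K : fieldType) (n : nat) (x : 'I_n.+1 -> K) : Prop :=
  exists a, x a != 0.

Definition proj_eq (K : fieldType) (n : nat) (x y : 'I_n.+1 -> K) : Prop :=
  exists2 l : K, l != 0 & forall a, y a = l * x a.

Record pvar (k : fieldType) : Type := PVar {
  pdim : nat;
  peqs : seq {mpoly k[pdim.+1]}
}.
Arguments PVar {k} pdim peqs.

Definition pcoords (k : fieldType) (V : pvar k) (K : fieldType) : Type :=
  'I_(pdim V).+1 -> K.

(* bihomogeneous of bidegree [(d, e)] in the first [m] and last [n] variables *)
Definition bihomog (k : fieldType) (m n d e : nat)
    (F : {mpoly k[m + n]}) : Prop :=
  forall u, u \in msupp F ->
    (\sum_(a < m) u (lshift n a))%N = d /\ (\sum_(a < n) u (rshift m a))%N = e.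

Definition cat_coords (K : Type) (m n : nat) (x : 'I_m -> K) (y : 'I_n -> K)
    (a : 'I_(m + n)) : K :=
  match split a with inl b => x b | inr b => y b end.

Section Varieties.

Variables (k K : fieldType) (i : {rmorphism k -> K}).

Definition on_pvar (V : pvar k) (x : pcoords V K) : Prop :=
  proj_nz x /\ forall F, F \in peqs V -> mmap i x F = 0.

(* Smooth, geometrically integral projective curve: the defining equations
   have a Jacobian matrix of rank [n - 1] at every geometric point, where
   [n = pdim V], and the set of geometric points is irreducible and
   infinite, hence of dimension 1. *)
Definition smooth_projective_curve (V : pvar k) : Prop :=
  [/\ forall F, F \in peqs V -> exists d, F \is d.-homog,
      forall x : pcoords V K, on_pvar x ->
        (\rank (\matrix_(a < size (peqs V), b < (pdim V).+1)
                  mmap i x (mderiv b (peqs V)`_a))).+1 = pdim V,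
      forall (G H : {mpoly K[(pdim V).+1]}) (d e : nat),
        G \is d.-homog -> H \is e.-homog ->
        (forall x : pcoords V K, on_pvar x -> G.@[x] * H.@[x] = 0) ->
        (forall x : pcoords V K, on_pvar x -> G.@[x] = 0) \/
        (forall x : pcoords V K, on_pvar x -> H.@[x] = 0)
    & forall (N : nat) (r : 'I_N -> pcoords V K),
        exists2 x : pcoords V K, on_pvar x & forall a, ~ proj_eq (r a) x].

(* Maps act on homogeneous coordinate vectors and only matter up to
   [proj_eq].  A morphism over [k] is given, around each geometric point, by
   forms of the same degree with coefficients in [k]. *)
Definition morphism (V W : pvar k) (phi : pcoords V K -> pcoords W K) : Prop :=
  forall p, on_pvar p -> on_pvar (phi p) /\
    exists (d : nat) (F : 'I_(pdim W).+1 -> {mpoly k[(pdim V).+1]}),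
      [/\ forall b, F b \is d.-homog,
          proj_nz (fun b => mmap i p (F b))
        & forall q, on_pvar q -> proj_nz (fun b => mmap i q (F b)) ->
            proj_eq (fun b => mmap i q (F b)) (phi q)].

Definition morphism2 (U V W : pvar k)
    (mu : pcoords U K -> pcoords V K -> pcoords W K) : Prop :=
  forall p q, on_pvar p -> on_pvar q -> on_pvar (mu p q) /\
    exists (d e : nat)
      (F : 'I_(pdim W).+1 -> {mpoly k[(pdim U).+1 + (pdim V).+1]}),
      [/\ forall b, bihomog d e (F b),
          proj_nz (fun b => mmap i (cat_coords p q) (F b))
        & forall p' q', on_pvar p' -> on_pvar q' ->
            proj_nz (fun b => mmap i (cat_coords p' q') (F b)) ->
            proj_eq (fun b => mmap i (cat_coords p' q') (F b)) (mu p' q')].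

Definition isomorphic (V W : pvar k) : Prop :=
  exists (phi : pcoords V K -> pcoords W K) (psi : pcoords W K -> pcoords V K),
    [/\ morphism phi, morphism psi,
        forall p, on_pvar p -> proj_eq (psi (phi p)) p
      & forall q, on_pvar q -> proj_eq (phi (psi q)) q].

End Varieties.

(** * Plane cubics *)

Section Cubics.

Variable k : fieldType.

Let X : {mpoly k[3]} := 'X_0.
Let Y : {mpoly k[3]} := 'X_1.
Let Z : {mpoly k[3]} := 'X_2.

Definition ec_curve (c : k) : pvar k :=
  PVar 2 [:: Y ^+ 2 * Z - X ^+ 3 - c *: Z ^+ 3].

Definition Cf_curve (A B C D : k) : pvar k :=
  PVar 2 [:: Z ^+ 3 - (A *: X ^+ 3 + (3%:R * B) *: (X ^+ 2 * Y)
                       + (3%:R * C) *: (X * Y ^+ 2) + D *: Y ^+ 3)].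

Definition disc_f (A B C D : k) : k :=
  let R := A * C - B ^+ 2 in
  let S := (A * D - B * C) / 2%:R in
  let T := B * D - C ^+ 2 in
  S ^+ 2 - R * T.

Definition eq_mod_sixth_powers (a b : k) : Prop :=
  exists2 u : k, u != 0 & a / b = u ^+ 6.

End Cubics.

Definition ec_coords (K : fieldType) (P : ecpoint K) : 'I_3 -> K :=
  match P with
  | Infty => fun a => [:: 0; 1; 0]`_a
  | Affine x y => fun a => [:: x; y; 1]`_a
  end.

(** * Principal homogeneous spaces of the curve and their classes *)

Section PrincipalHomogeneousSpaces.

Variables (k ks K : fieldType).
Variables (i : {rmorphism k -> ks}) (j : {rmorphism ks -> K}).
Variable c : k.

Let ji : {rmorphism k -> K} := rcomp j i.

(* A simply transitive action of the elliptic curve, defined over [k], such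
   that the difference map [(p, q) |-> q - p] is a morphism over [k] too.
   The last condition is not automatic in positive characteristic: the
   action through the Frobenius isogeny on the Frobenius twist is simply
   transitive on geometric points. *)
Definition is_phs (V : pvar k)
    (mu : pcoords V K -> pcoords (ec_curve c) K -> pcoords V K) : Prop :=
  [/\ smooth_projective_curve ji V /\ morphism2 ji mu,
      forall p, on_pvar ji p -> proj_eq (mu p (ec_coords Infty)) p,
      forall p P Q, on_pvar ji p -> on_ec (ji c) P -> on_ec (ji c) Q ->
        proj_eq (mu (mu p (ec_coords P)) (ec_coords Q))
                (mu p (ec_coords (ec_add P Q))),
      forall p q, on_pvar ji p -> on_pvar ji q ->
        exists! P, on_ec (ji c) P /\ proj_eq (mu p (ec_coords P)) q
    & exists2 nu : pcoords V K -> pcoords V K -> pcoords (ec_curve c) K,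
        morphism2 ji nu &
        forall p q, on_pvar ji p -> on_pvar ji q ->
          proj_eq (mu p (nu p q)) q].

(* The class of a principal homogeneous space is that of the cocycle
   [s |-> p^s - p], where [p] is any point over [ks]. *)
Definition phs_class (V : pvar k)
    (mu : pcoords V K -> pcoords (ec_curve c) K -> pcoords V K)
    (xi : H1 i (on_ec (i c))) : Prop :=
  exists p : pcoords V ks, on_pvar i p /\
  exists a : cocycle i (on_ec (i c)), H1_mem xi a /\
    forall s : gal i,
      proj_eq (mu (fun b => j (p b)) (ec_coords (ec_map j (a s))))
              (fun b => j (s (p b))).

Definition underlying_curve (xi : H1 i (on_ec (i c))) (V : pvar k) : Prop :=
  exists2 mu, @is_phs V mu & phs_class mu xi.

End PrincipalHomogeneousSpaces.

Definition Psi (k ks : fieldType) (i : {rmorphism k -> ks}) (c : k) (sqrtc : ks)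
    (h : sqrtc ^+ 2 = i c) : H1 i (ec_T sqrtc) -> H1 i (on_ec (i c)) :=
  H1_incl (ec_T_on_ec h).

(* Main.v *)
(** Write [E] as [x^3 = f0(y, z)] with [f0(y, z) = y^2 z - c z^3]; then [f0] has discriminant
    [Delta], and translation by a point [t] of [T] is a linear map [M_t] in [SL_2] acting on
    [(y, z)] and fixing [f0].  A matrix [N] in [GL_2(ks)] with [f o N = f0] is an isomorphism
    from [E] to [C_f] over [ks], and [C_f] becomes a principal homogeneous space over [k], of
    class the image of [t], as soon as [s(N) = N M_(t_s)] for all [s] in the Galois group.
    Given a cocycle [t] such an [N] exists by Hilbert 90, and [f = f0 o N^-1] is rational,
    with [disc f = Delta (det N)^-6] and [det N] in [k].  Conversely, moving a root of [f] to
    infinity and completing the square gives [N] with [det N] in [k] whenever [disc f / Delta]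
    is a sixth power; then [N^-1 s(N)] lies in the stabilizer of [f0] in [SL_2], which is
    [T].  Finally two principal homogeneous spaces of the same class are isomorphic.

    Maps built over [ks] are descended to [k] on the level of forms: the span of the Galois
    conjugates of a tuple of forms representing a map consists of forms representing it and
    is generated by its rational elements.  Associativity on [E] is checked for generic
    points only, and extended by addition laws of bidegree (2, 2) and irreducibility. *)

Require Import Defs.
From HB Require Import structures.
From mathcomp Require Import all_boot all_order all_algebra all_field.
From mathcomp Require Import mpoly.
From mathcomp Require boolp classical_sets.
From mathcomp Require Import ring zify.

Set Implicit Arguments.
Unset Strict Implicit.
Unset Printing Implicit Defensive.

Import GRing.Theory.
Local Open Scope ring_scope.

(* [galois.v] has homonyms. *)
Local Notation gal := Defs.gal.
Local Notation gal_mul := Defs.gal_mul.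

(** * Galois theory of the separable closure *)

(** The matrices [M_t] have a geometric origin. The line [x = 0] meets the curve exactly in [T],
    whose three points are flexes with tangents through [(1 : 0 : 0)]. Points of [T] have order
    dividing 3, so translation by one of them is a projectivity of the plane; it preserves this line
    and this point, so after scaling it keeps [x] and acts on [(y, z)] alone. The sixth powers come
    from the discriminant being an invariant of weight 6. Two obstacles shape the proof. The
    separable closure may be infinite over [k] and is known only through its two defining
    properties, so homomorphisms are extended by Zorn's lemma, as graphs inside [ks * ks], before
    any descent is available. And a principal homogeneous space asks for both the action and the
    difference map to be given by forms over [k] around every pair of geometric points, so a formula
    that is valid generically does not suffice: each pair must be covered by some law whose
    conjugates all represent the same map, up to a factor that may vanish. *)

Section MakeMorphism.
Variables (R S : nzRingType) (f : R -> S).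
Hypotheses (fB : {morph f : x y / x - y}) (fM : {morph f : x y / x * y}) (f1 : f 1 = 1).
(* The hypotheses are arguments of [hom_fun], so that the instances below are not
   triggered by an arbitrary function. *)
Definition hom_fun (_ : {morph f : x y / x - y}) (_ : {morph f : x y / x * y})
  (_ : f 1 = 1) := f.
HB.instance Definition _ := GRing.isZmodMorphism.Build R S (hom_fun fB fM f1) fB.
HB.instance Definition _ := GRing.isMonoidMorphism.Build R S (hom_fun fB fM f1) (f1, fM).
Definition mk_rmorphism : {rmorphism R -> S} := hom_fun fB fM f1.
End MakeMorphism.

Lemma poly_roots (F : fieldType) (p : {poly F}) : p != 0 ->
  exists s, [/\ all (root p) s, uniq s & forall x, root p x -> x \in s].
Proof.
have [m] := ubnP (size p); elim: m p => // m IH r sr r0.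
case: (boolp.pselect (exists x, root r x)) => [[x rx]|nr]; last first.
  by exists [::]; split=> // x rx; case: nr; exists x.
have [r1 rE] := factor_theorem _ _ rx.
have r10 : r1 != 0 by apply: contraNneq r0 => e; rewrite rE e mul0r.
have [|s [rs us ms]] := IH r1 _ r10.
  by move: sr; rewrite rE size_mul ?polyXsubC_eq0 // size_XsubC addn2.
exists (if x \in s then s else x :: s); split.
- have h : all (root r) s by apply: sub_all rs => t; rewrite rE rootM => ->.
  by case: ifP => //= _; rewrite rx.
- by case: ifP => //= ->.
- move=> t; rewrite rE rootM root_XsubC => /orP[/ms h|/eqP ->].
    by case: ifP => //; rewrite inE h orbT.
  by case: ifP => //; rewrite inE eqxx.
Qed.

Section SeparableClosure.
Variables (k ks : fieldType) (i : {rmorphism k -> ks}).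
Hypothesis hks : separable_closure i.

(* A ring homomorphism over [k] from a subring of [ks] to [ks], as a graph. *)
Record conj_graph (G : ks * ks -> Prop) : Prop := ConjGraph {
  cg_base : forall a, G (i a, i a);
  cg_sub : forall v w, G v -> G w -> G (v - w);
  cg_mul : forall v w, G v -> G w -> G (v * w);
  cg_fun : forall w, G w -> w.1 = 0 -> w.2 = 0
}.

(** A polynomial over the product ring [ks * ks] carries a polynomial over a subring together with
    its conjugate, as its two projections; the base field sits on the diagonal. *)
Definition diag (a : k) : ks * ks := (i a, i a).

Lemma diagB : {morph diag : a b / a - b}.
Proof. by move=> a b; rewrite /diag rmorphB. Qed.
Lemma diagM : {morph diag : a b / a * b}.
Proof. by move=> a b; rewrite /diag rmorphM. Qed.
Lemma diag1 : diag 1 = 1.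
Proof. by rewrite /diag rmorph1. Qed.
Definition diagr := mk_rmorphism diagB diagM diag1.

Lemma map_fst_diag (p : {poly k}) : map_poly fst (map_poly diagr p) = map_poly i p.
Proof. by apply/polyP => u; rewrite !coef_map. Qed.
Lemma map_snd_diag (p : {poly k}) : map_poly snd (map_poly diagr p) = map_poly i p.
Proof. by apply/polyP => u; rewrite !coef_map. Qed.

Lemma horner_fst (Q : {poly (ks * ks)%type}) w : Q.[w].1 = (map_poly fst Q).[w.1].
Proof. by rewrite -(horner_map fst). Qed.
Lemma horner_snd (Q : {poly (ks * ks)%type}) w : Q.[w].2 = (map_poly snd Q).[w.2].
Proof. by rewrite -(horner_map snd). Qed.

Section Graph.
Variable G : ks * ks -> Prop.
Hypothesis hG : conj_graph G.

Let G0 : G 0.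
Proof. have := cg_base hG 0; by rewrite rmorph0. Qed.
Let G1 : G 1.
Proof. have := cg_base hG 1; by rewrite rmorph1. Qed.
Let GN w : G w -> G (- w).
Proof. by move=> h; rewrite -sub0r; apply: cg_sub. Qed.
Let GD v w : G v -> G w -> G (v + w).
Proof. by move=> hv hw; rewrite -[w]opprK; apply: cg_sub => //; apply: GN. Qed.
Let Gsum (I : Type) (r : seq I) (F : I -> ks * ks) :
  (forall u, G (F u)) -> G (\sum_(u <- r) F u).
Proof. by move=> h; elim/big_ind: _ => //; apply: GD. Qed.
Let GX w n : G w -> G (w ^+ n).
Proof. by move=> h; elim: n => [|n IH]; rewrite ?expr0 // exprS; apply: cg_mul. Qed.

Definition coefs_in (Q : {poly (ks * ks)%type}) := forall u, G Q`_u.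

Lemma coefs_in_diag p : coefs_in (map_poly diagr p).
Proof. by move=> u; rewrite coef_map; apply: (cg_base hG). Qed.
Lemma coefs_inC w : G w -> coefs_in w%:P.
Proof. by move=> h u; rewrite coefC; case: ifP. Qed.
Lemma coefs_inX n : coefs_in 'X^n.
Proof. by move=> u; rewrite coefXn; case: (_ == _). Qed.
Lemma coefs_inB P Q : coefs_in P -> coefs_in Q -> coefs_in (P - Q).
Proof. by move=> hP hQ u; rewrite coefB; apply: cg_sub. Qed.
Lemma coefs_inM P Q : coefs_in P -> coefs_in Q -> coefs_in (P * Q).
Proof. by move=> hP hQ u; rewrite coefM; apply: Gsum => v; apply: cg_mul. Qed.

Lemma horner_in Q w : coefs_in Q -> G w -> G Q.[w].
Proof.
by move=> hQ hw; rewrite horner_coef; apply: Gsum => u; apply: cg_mul => //; apply: GX.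
Qed.

Lemma graph_inj v w : G v -> G w -> v.1 = w.1 -> v = w.
Proof.
move=> hv hw e.
have := cg_fun hG (cg_sub hG hv hw); rewrite /= e subrr => /(_ erefl) /eqP.
by rewrite subr_eq0 => /eqP e2; case: v w e e2 {hv hw} => [? ?] [? ?] /= -> ->.
Qed.

(** The inverse of a nonzero algebraic element is a polynomial in that element: divide a vanishing
    polynomial with nonzero constant term by this term. Hence the subring in a graph is a field. *)
Lemma graph_inv w : G w -> w.1 != 0 -> exists2 w', G w' & w * w' = 1.
Proof.
move=> hw nz; have [p sp rp] := hks.1 w.1.
have p0 : p != 0 by apply: separable_poly_neq0.
(* Powers of [X] are split off so that the remaining factor [q] has a nonzero constant term. *)
have [n [q]] := multiplicity_XsubC p 0.
rewrite p0 /= => rq pE.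
have {rp} rq1 : root (map_poly i q) w.1.
  move: rp; rewrite pE rmorphM rmorphXn /= map_polyXsubC rmorph0 subr0 rootM.
  by case/orP => //; rewrite /root hornerXn expf_eq0 (negbTE nz) andbF.
elim/poly_ind: q rq rq1 {pE} => [|q c _]; first by rewrite root0.
rewrite /root !hornerE /= => c0.
rewrite rmorphD rmorphM /= map_polyX map_polyC !hornerE /= => /eqP e.
pose w' := - diagr c^-1 * (map_poly diagr q).[w].
have hw' : G w'.
  apply: cg_mul => //; first by apply: GN; apply: (cg_base hG).
  by apply: horner_in => //; apply: coefs_in_diag.
exists w' => //; apply: graph_inj => //; first exact: cg_mul.
rewrite /w' /= horner_fst map_fst_diag.
have ic0 : i c != 0 by rewrite fmorph_eq0.
have -> : (map_poly i q).[w.1] = - i c / w.1.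
  by apply: (mulIf nz); rewrite mulfVK //; apply/eqP; rewrite -addr_eq0 e.
by rewrite fmorphV; field; rewrite ic0 nz.
Qed.

(** A polynomial of least size among those with coefficients in [G] that vanish at [z] on the first
    component can be made monic by [graph_inv]; division by it then stays inside [G]. *)
Lemma min_poly_in z : exists P0,
  [/\ coefs_in P0, P0 \is monic, root (map_poly fst P0) z
    & forall Q, coefs_in Q -> root (map_poly fst Q) z -> exists T, Q = T * P0].
Proof.
have [p sp rp] := hks.1 z.
pose ok n := exists2 Q, coefs_in Q /\ Q != 0 & size Q = n /\ root (map_poly fst Q) z.
have okp : ok (size (map_poly diagr p)).
  exists (map_poly diagr p).
    split; first exact: coefs_in_diag.
    apply/eqP => e; have := map_fst_diag p; rewrite e rmorph0 => /esym /eqP.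
    by rewrite map_poly_eq0; apply/negP; apply: separable_poly_neq0.
  by split=> //; rewrite map_fst_diag.
pose okb n := boolp.asbool (ok n).
have ex : exists n, okb n by exists (size (map_poly diagr p)); apply/boolp.asboolP.
case: (ex_minnP ex) => n /boolp.asboolP [Q [hQ Q0] [sQ rQ]] nmin.
have lc : G (lead_coef Q) by apply: hQ.
have lc0 : (lead_coef Q).1 != 0.
  apply/eqP => e; move: Q0; rewrite -lead_coef_eq0; apply/negP/negPn/eqP.
  exact: graph_inj.
have [w hw lw] := graph_inv lc lc0.
pose P0 := w%:P * Q.
have hP0 : coefs_in P0 by apply: coefs_inM => //; apply: coefs_inC.
have sP0 : (size P0 <= n)%N by rewrite -sQ /P0 mul_polyC size_scale_leq.
have n0 : (0 < n)%N by rewrite -sQ lt0n size_poly_eq0.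
have cP0 : P0`_n.-1 = 1.
  by rewrite /P0 coefCM -sQ mulrC.
have szP0 : size P0 = n.
  apply/eqP; rewrite eqn_leq sP0 /=; rewrite -(prednK n0).
  rewrite ltnNge; apply/negP => /leq_sizeP /(_ _ (leqnn _)); rewrite cP0.
  by apply/eqP; apply: oner_neq0.
have mP0 : P0 \is monic by rewrite monicE lead_coefE szP0 cP0.
have rP0 : root (map_poly fst P0) z.
  by rewrite /root rmorphM hornerM (eqP rQ) mulr0.
exists P0; split=> //.
move=> R; have [m] := ubnP (size R); elim: m R => // m IH R sR hR rR.
case: (eqVneq R 0) => [->|R0]; first by exists 0; rewrite mul0r.
have nR : (n <= size R)%N.
  by apply: nmin; apply/boolp.asboolP; exists R.
pose M := (lead_coef R)%:P * 'X^(size R - n).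
have hM : coefs_in M.
  by apply: coefs_inM; [apply: coefs_inC; apply: hR | apply: coefs_inX].
have [T TE] : exists T, R - M * P0 = T * P0.
  apply: IH.
  - apply: leq_trans (_ : size R <= m)%N => //.
    have R1 : (0 < size R)%N by rewrite lt0n size_poly_eq0.
    have sMP : (size (M * P0)%R <= size R)%N.
      rewrite /M -mulrA mul_polyC; apply: leq_trans (size_scale_leq _ _) _.
      rewrite -commr_polyXn size_mulXn ?monic_neq0 // szP0 subnK //.
    rewrite -(prednK R1) ltnS; apply/leq_sizeP => u; rewrite leq_eqVlt.
    case/predU1P => [<-|].
      have h1 : ((size R).-1 < size R - n)%N = false by lia.
      have h2 : ((size R).-1 - (size R - n) = n.-1)%N by lia.
      rewrite coefB /M -mulrA coefCM -commr_polyXn coefMXn h1 h2 -lead_coefE.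
      by rewrite cP0 mulr1 subrr.
    rewrite (prednK R1) => hu.
    by rewrite coefB !nth_default ?subr0 //; apply: leq_trans sMP _.
  - by apply: coefs_inB => //; apply: coefs_inM.
  - have eM : (map_poly fst (M * P0)).[z] = 0 by rewrite rmorphM hornerM (eqP rP0) mulr0.
    by rewrite /root rmorphB hornerD hornerN eM (eqP rR) subr0.
by exists (T + M); rewrite mulrDl -TE subrK.
Qed.

(** The new graph consists of the values at [(z, y)]. It is functional because a polynomial
    vanishing at [z] is a multiple of [P0], whose conjugate vanishes at [y]. *)
Lemma graph_extend z y P0 : coefs_in P0 ->
  (forall Q, coefs_in Q -> root (map_poly fst Q) z -> exists T, Q = T * P0) ->
  root (map_poly snd P0) y ->
  exists G', [/\ conj_graph G', forall w, G w -> G' w & G' (z, y)].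
Proof.
move=> hP0 dP0 rP0.
exists (fun w => exists2 Q, coefs_in Q & w = Q.[(z, y)]); split.
- split.
  + by move=> a; exists (diagr a)%:P; rewrite ?hornerC //; apply: coefs_inC; apply: (cg_base hG).
  + by move=> _ _ [P hP ->] [Q hQ ->]; exists (P - Q); rewrite ?hornerE //; apply: coefs_inB.
  + by move=> _ _ [P hP ->] [Q hQ ->]; exists (P * Q); rewrite ?hornerM //; apply: coefs_inM.
  + move=> _ [Q hQ ->]; rewrite horner_fst horner_snd => /eqP /(dP0 _ hQ) [T ->].
    by rewrite rmorphM hornerM (eqP rP0) mulr0.
- by move=> w hw; exists w%:P; rewrite ?hornerC //; apply: coefs_inC.
- by exists 'X; rewrite ?hornerX // -['X]expr1; apply: coefs_inX.
Qed.

End Graph.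
End SeparableClosure.

(** * The fixed field of the Galois group *)

Section FixedField.
Variables (k ks : fieldType) (i : {rmorphism k -> ks}).
Hypothesis hks : separable_closure i.

(** Both projections of [P0] divide the image of one separable polynomial over [k], since this image
    is the same on both components. *)
Lemma min_poly_sep G z P0 : conj_graph i G -> P0 \is monic ->
  (forall Q, coefs_in G Q -> root (map_poly fst Q) z -> exists T, Q = T * P0) ->
  separable_poly (map_poly fst P0) /\ separable_poly (map_poly snd P0).
Proof.
move=> hG mP0 dP0; have [p sp rp] := hks.1 z.
have [||T TE] := dP0 (map_poly (diagr i) p); first exact: coefs_in_diag.
  by rewrite map_fst_diag.
have sip : separable_poly (map_poly i p) by rewrite separable_map.
have := map_fst_diag i p; have := map_snd_diag i p.
rewrite TE !rmorphM => e2 e1.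
have := sip; rewrite -e1 separable_mul => /and3P[_ -> _].
by have := sip; rewrite -e2 separable_mul => /and3P[_ -> _].
Qed.

Lemma monic_size_fst (P0 : {poly (ks * ks)%type}) :
  P0 \is monic -> (size (map_poly fst P0) = size P0)%N.
Proof.
move=> m; rewrite size_map_poly_id0 // (monicP m).
exact: oner_neq0.
Qed.

Lemma monic_size_snd (P0 : {poly (ks * ks)%type}) :
  P0 \is monic -> (size (map_poly snd P0) = size P0)%N.
Proof.
move=> m; rewrite size_map_poly_id0 // (monicP m).
exact: oner_neq0.
Qed.

Lemma size_gt1_of_root (F : fieldType) (p : {poly F}) x : p != 0 -> root p x -> (1 < size p)%N.
Proof.
by move=> p0 r; rewrite ltnNge; apply/negP => /size1_polyC e; move: r p0;
  rewrite e rootC => /eqP ->; rewrite polyC0 eqxx.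
Qed.

Lemma graph_extend_to G z : conj_graph i G ->
  exists G', [/\ conj_graph i G', forall w, G w -> G' w & exists y, G' (z, y)].
Proof.
move=> hG; have [P0 [hP0 mP0 rP0 dP0]] := min_poly_in hks hG z.
have [s1 s2] := min_poly_sep hG mP0 dP0.
have sz : (1 < size (map_poly snd P0))%N.
  rewrite monic_size_snd // -monic_size_fst //; apply: size_gt1_of_root rP0.
  exact: separable_poly_neq0.
have [y ry] := hks.2 _ s2 sz.
have [G' [h1 h2 h3]] := graph_extend hG hP0 dP0 ry.
by exists G'; split=> //; exists y.
Qed.

(** An injective endomorphism over [k] maps the finite set of roots of a polynomial over [k] into
    itself, hence permutes it. *)
Lemma algebraic_endo_surj (f : {rmorphism ks -> ks}) :
  (forall a, f (i a) = i a) -> forall y, exists x, f x = y.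
Proof.
move=> fi y; have [p sp rp] := hks.1 y.
pose q := map_poly i p.
have q0 : q != 0 by rewrite map_poly_eq0; apply: separable_poly_neq0.
have fq : map_poly f q = q by apply/polyP => u; rewrite !coef_map /= fi.
have [s [rs us ms]] := poly_roots q0.
have sub : {subset map f s <= s}.
  move=> _ /mapP [x hx ->]; apply: ms; rewrite -fq rmorph_root //.
  by move/allP: rs; apply.
have us' : uniq (map f s) by rewrite map_inj_uniq //; apply: fmorph_inj.
have [_ e] : (size (map f s) = size s) * (map f s =i s).
  by apply: uniq_min_size; rewrite // size_map.
have : y \in map f s by rewrite e; apply: ms.
by case/mapP => x _ ->; exists x.
Qed.

Lemma gal_of_endo (f : {rmorphism ks -> ks}) :
  (forall a, f (i a) = i a) -> exists s : gal i, s =1 f.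
Proof.
move=> fi; have surj := algebraic_endo_surj fi.
have h y := boolp.cid (surj y).
have bij : bijective f.
  exists (fun y => projT1 (h y)) => x; last exact: (projT2 (h x)).
  by apply: (fmorph_inj f); exact: (projT2 (h (f x))).
by exists (Defs.Gal bij fi).
Qed.

Lemma graph_gal G : conj_graph i G -> exists s : gal i, forall w, G w -> s w.1 = w.2.
Proof.
move=> hG.
(* The premise makes the empty set admissible, as the union of the empty chain requires; it is
   excluded afterwards, since [G] itself is larger. *)
pose P (A : ks * ks -> Prop) :=
  (exists w, A w) -> conj_graph i A /\ forall w, G w -> A w.
have [|A [PA Amax]] := @classical_sets.Zorn_bigcup _ P.
  move=> F FP tot [w0 [X0 FX0 Xw0]].
  have good X w : F X -> X w -> conj_graph i X /\ forall w, G w -> X w.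
    by move=> FX Xw; apply: (FP X FX); exists w.
  have join v w : classical_sets.bigcup F id v -> classical_sets.bigcup F id w ->
      exists X, [/\ F X, X v, X w & conj_graph i X].
    move=> [X FX Xv] [Y FY Yw]; case: (tot X Y FX FY) => le.
      by exists Y; split=> //; [apply: le | case: (good Y w FY Yw)].
    by exists X; split=> //; [apply: le | case: (good X v FX Xv)].
  have [gX0 sX0] := good _ _ FX0 Xw0.
  split; last by move=> w Gw; exists X0 => //; apply: sX0.
  split.
  - by move=> a; exists X0 => //; apply: (cg_base gX0).
  - by move=> v w hv hw; have [X [FX Xv Xw gX]] := join v w hv hw;
      exists X => //; apply: (cg_sub gX).
  - by move=> v w hv hw; have [X [FX Xv Xw gX]] := join v w hv hw;
      exists X => //; apply: (cg_mul gX).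
  - by move=> w [X FX Xw]; have [gX _] := good _ _ FX Xw; apply: (cg_fun gX).
have Gone : G (i 1, i 1) by apply: (cg_base hG).
have [w Aw] : exists w, A w.
  apply: boolp.contrapT => nA; apply: (Amax G) => //.
  split; first by move=> w Aw; case: nA; exists w.
  by move=> /(_ _ Gone) h; case: nA; exists (i 1, i 1).
have [gA sA] := PA (ex_intro _ w Aw).
have tot z : exists y, A (z, y).
  have [G' [g' s' [y hy]]] := graph_extend_to z gA.
  apply: boolp.contrapT => nz; apply: (Amax G').
    by split=> // /(_ _ hy) h; case: nz; exists y.
  by move=> _; split=> // v Gv; apply: s'; apply: sA.
have h z := boolp.cid (tot z).
pose f z := projT1 (h z).
have fA z : A (z, f z) := projT2 (h z).
have fE z y : A (z, y) -> f z = y.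
  by move=> Az; case: (graph_inj gA (fA z) Az erefl).
have fB : {morph f : x y / x - y}.
  by move=> x y; apply: fE; apply: (cg_sub gA (fA x) (fA y)).
have fM : {morph f : x y / x * y}.
  by move=> x y; apply: fE; apply: (cg_mul gA (fA x) (fA y)).
have fi a : f (i a) = i a by apply: fE; apply: (cg_base gA).
have f1 : f 1 = 1 by rewrite -(rmorph1 i) fi.
have [s sE] := @gal_of_endo (mk_rmorphism fB fM f1) fi.
exists s => -[x y] Gxy /=; rewrite sE /=; apply: fE.
exact: sA.
Qed.

Lemma base_graph : conj_graph i (fun w => exists a, w = diag i a).
Proof.
split.
- by move=> a; exists a.
- by move=> _ _ [a ->] [b ->]; exists (a - b); rewrite diagB.
- by move=> _ _ [a ->] [b ->]; exists (a * b); rewrite diagM.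
- by move=> _ [a ->].
Qed.

(** If [x] is not rational, its minimal polynomial over [k] has a second root [y], and [x |-> y]
    extends to an element of the Galois group that moves [x]. *)
Theorem fixed_field x : (forall s : gal i, s x = x) -> exists a, x = i a.
Proof.
move=> fx; apply: boolp.contrapT => nx.
pose G := fun w => exists a, w = diag i a.
have hG : conj_graph i G := base_graph.
have [P0 [hP0 mP0 rP0 dP0]] := min_poly_in hks hG x.
have [s1 s2] := min_poly_sep hG mP0 dP0.
have eP : map_poly fst P0 = map_poly snd P0.
  by apply/polyP => u; rewrite !coef_map; have [a ->] := hP0 u.
have [g gE] := factor_theorem _ _ rP0.
have := s1; rewrite gE separable_root => /andP[sg nr].
have g0 : g != 0 by apply: separable_poly_neq0.
(* If [g] is constant, then [P0] is monic of degree 1 over [k] and its root [x] is rational. *)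
have szg : (1 < size g)%N.
  rewrite ltnNge; apply/negP => sg1.
  have sP : (size P0 <= 2)%N.
    by rewrite -monic_size_fst // gE size_mul ?polyXsubC_eq0 // size_XsubC addn2.
  have P1 : P0`_1 = 1.
    have sP2 : size P0 = 2%N.
      apply/eqP; rewrite eqn_leq sP -monic_size_fst //.
      by apply: size_gt1_of_root rP0; apply: separable_poly_neq0.
    by move/monicP: mP0; rewrite lead_coefE sP2.
  have [b bE] := hP0 0%N.
  move/eqP: rP0; rewrite (@horner_coef_wide _ 2) ?monic_size_fst //.
  rewrite big_ord_recl big_ord1 /= !coef_map /= P1 bE expr0 mulr1 mul1r expr1 => e.
  by apply: nx; exists (- b); rewrite rmorphN; apply/eqP; rewrite -addr_eq0 addrC; apply/eqP.
have [y ry] := hks.2 _ sg szg.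
have yx : y != x by apply: contraNneq nr => <-.
have ryP : root (map_poly snd P0) y by rewrite -eP gE rootM ry.
have [G' [g1 g2 g3]] := graph_extend hG hP0 dP0 ryP.
have [s sE] := graph_gal g1.
by move/eqP: yx; apply; rewrite -[LHS](sE _ g3) /= fx.
Qed.

End FixedField.

(** * Galois descent *)

Section Descent.
Variables (k ks : fieldType) (i : {rmorphism k -> ks}).
Hypothesis hks : separable_closure i.
Variables m n : nat.

Definition map_tup (R S : nzRingType) (f : R -> S) (F : 'I_m -> {mpoly R[n]}) :
  'I_m -> {mpoly S[n]} := fun b => map_mpoly f (F b).

Definition linear_pred (P : ('I_m -> {mpoly ks[n]}) -> Prop) : Prop :=
  P (fun=> 0) /\ forall c F G, P F -> P G -> P (fun b => c *: F b + G b).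

Definition supp_size (F : 'I_m -> {mpoly ks[n]}) := (\sum_b size (msupp (F b)))%N.

Lemma supp_size_lt F G b0 m0 :
  (forall b u, (G b)@_u != 0 -> (F b)@_u != 0) ->
  (F b0)@_m0 != 0 -> (G b0)@_m0 = 0 -> (supp_size G < supp_size F)%N.
Proof.
move=> sub F0 G0; rewrite /supp_size (bigD1 b0) //= [X in (_ < X)%N](bigD1 b0) //=.
rewrite -addSn; apply: leq_add.
  rewrite -[X in (X <= _)%N]/(size (m0 :: msupp (G b0))); apply: uniq_leq_size.
    by rewrite /= msupp_uniq mcoeff_msupp G0 eqxx.
  move=> u; rewrite inE => /predU1P[->|]; first by rewrite mcoeff_msupp.
  by rewrite !mcoeff_msupp; apply: sub.
apply: leq_sum => b _; apply: uniq_leq_size; first exact: msupp_uniq.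
by move=> u; rewrite !mcoeff_msupp; apply: sub.
Qed.

Lemma mpoly_rational (p : {mpoly ks[n]}) :
  (forall u, exists a, p@_u = i a) -> exists q, p = map_mpoly i q.
Proof.
move=> h; pose a u := projT1 (boolp.cid (h u)).
have aE u : p@_u = i (a u) := projT2 (boolp.cid (h u)).
exists (\sum_(u <- msupp p) a u *: 'X_[u]).
rewrite {1}[p]mpolyE rmorph_sum; apply: eq_bigr => u _ /=.
by rewrite map_mpolyZ map_mpolyX aE.
Qed.

(* A vector of a [gal]-stable subspace is either rational up to a scalar or the sum of
   two vectors of the subspace with smaller support, obtained from [s F - F]. *)
Lemma descent_ind (W Q : ('I_m -> {mpoly ks[n]}) -> Prop) :
  linear_pred W -> linear_pred Q ->
  (forall (s : gal i) F, W F -> W (map_tup s F)) ->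
  (forall G : 'I_m -> {mpoly k[n]}, W (map_tup i G) -> Q (map_tup i G)) ->
  forall F, W F -> Q F.
Proof.
move=> [W0 WL] [Q0 QL] Wg WQ F.
have scal P c G : linear_pred P -> P G -> P (fun b => c *: G b).
  move=> [P0 PL] PG; have := PL c _ _ PG P0; congr P.
  by apply: boolp.funext => b; rewrite addr0.
have [N] := ubnP (supp_size F); elim: N F => // N IH F sF WF.
case: (boolp.pselect (exists b u, (F b)@_u != 0)) => [[b [u Fbu]]|nz]; last first.
  have -> : F = fun=> 0.
    apply: boolp.funext => b; apply/mpolyP => u; rewrite mcoeff0.
    by case: (eqVneq (F b)@_u 0) => // h; case: nz; exists b, u.
  exact: Q0.
(* A coefficient scaled to 1 is fixed by every [s], so it drops out of [s F1 - F1]. *)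
pose c := (F b)@_u; pose F1 b := c^-1 *: F b.
have FE : F = fun b => c *: F1 b.
  by apply: boolp.funext => b'; rewrite /F1 scalerA divff // scale1r.
have WF1 : W F1 by apply: scal.
have sF1 b' u' : (F1 b')@_u' != 0 -> (F b')@_u' != 0.
  by rewrite /F1 mcoeffZ mulf_eq0 negb_or => /andP[].
suff QF1 : Q F1 by rewrite FE; apply: scal.
case: (boolp.pselect (forall s : gal i, map_tup s F1 = F1)) => [fix1|nfix].
  have rat b' : exists q, F1 b' = map_mpoly i q.
    apply: mpoly_rational => u'; apply: (fixed_field hks) => s.
    by rewrite -[in RHS](fix1 s) /map_tup mcoeff_map_mpoly.
  pose G b' := projT1 (boolp.cid (rat b')).
  have GE : F1 = map_tup i G.
    by apply: boolp.funext => b'; exact: (projT2 (boolp.cid (rat b'))).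
  by rewrite GE; apply: WQ; rewrite -GE.
have [s ns] : exists s : gal i, map_tup s F1 <> F1.
  by apply: boolp.contrapT => h; apply: nfix => s; apply: boolp.contrapT => h'; case: h; exists s.
pose D b' := (-1) *: F1 b' + map_tup s F1 b'.
have WD : W D by apply: WL => //; apply: Wg.
have Dc b' u' : (D b')@_u' = s (F1 b')@_u' - (F1 b')@_u'.
  by rewrite /D mcoeffD mcoeffZ mulN1r /map_tup mcoeff_map_mpoly addrC.
have sD b' u' : (D b')@_u' != 0 -> (F b')@_u' != 0.
  rewrite Dc => h; apply: sF1; apply: contraNneq h => ->.
  by rewrite rmorph0 subrr.
have D0 : (D b)@_u = 0.
  by rewrite Dc /F1 mcoeffZ /c mulVf // rmorph1 subrr.
have [b' [u' nD]] : exists b' u', (D b')@_u' != 0.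
  apply: boolp.contrapT => h; apply: ns; apply: boolp.funext => b'; apply/mpolyP => u'.
  apply/eqP; rewrite -subr_eq0 /map_tup mcoeff_map_mpoly -Dc.
  by case: eqVneq => // nD; case: h; exists b', u'.
have QD : Q D.
  apply: IH => //; rewrite -ltnS; apply: leq_trans sF; rewrite ltnS.
  exact: (supp_size_lt (b0 := b) (m0 := u)).
(* [D] has lost the coefficient scaled to 1; [e] is chosen so that [F1 - e D] loses another
   coefficient. Both have smaller support, and together they generate [F1]. *)
pose e := (F1 b')@_u' / (D b')@_u'.
pose F2 a := (- e) *: D a + F1 a.
have WF2 : W F2 by apply: WL.
have QF2 : Q F2.
  apply: IH => //; rewrite -ltnS; apply: leq_trans sF; rewrite ltnS.
  apply: (supp_size_lt (b0 := b') (m0 := u')); last 1 first.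
  - by rewrite /F2 mcoeffD mcoeffZ mulNr /e divfK // addNr.
  - move=> a v; rewrite /F2 mcoeffD mcoeffZ => h; apply: contraNneq h => h.
    have /eqP -> : (D a)@_v == 0 by apply: contraT => /sD; rewrite h eqxx.
    have /eqP -> : (F1 a)@_v == 0 by apply: contraT => /sF1; rewrite h eqxx.
    by rewrite mulr0 addr0.
  - exact: sD.
have -> : F1 = fun a => e *: D a + F2 a.
  by apply: boolp.funext => a; rewrite /F2 addrA scaleNr subrr add0r.
exact: QL.
Qed.

Lemma galois_descent (S Q : ('I_m -> {mpoly ks[n]}) -> Prop) F0 :
  linear_pred S -> linear_pred Q ->
  (forall s : gal i, S (map_tup s F0)) -> ~ Q F0 ->
  exists G : 'I_m -> {mpoly k[n]}, S (map_tup i G) /\ ~ Q (map_tup i G).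
Proof.
move=> linS linQ hS nQ.
(* The span of the conjugates of [F0], written as the intersection of all linear predicates that
   contain them. *)
pose W F := forall P, linear_pred P -> (forall s : gal i, P (map_tup s F0)) -> P F.
apply: boolp.contrapT => nG; apply: nQ.
apply: (@descent_ind W Q) => //.
- split; first by move=> P [].
  by move=> c F G WF WG P linP hP; apply: linP.2; [apply: WF | apply: WG].
- move=> s F WF P [P0 PL] hP; apply: (WF (fun F => P (map_tup s F))).
    split.
      have -> : map_tup s (fun=> 0) = fun=> 0 by move=> *; apply: boolp.funext => b; rewrite /map_tup rmorph0.
      exact: P0.
    move=> c F1 F2 h1 h2; have := PL (s c) _ _ h1 h2; congr P.
    by apply: boolp.funext => b; rewrite /map_tup rmorphD /= map_mpolyZ.
  move=> t; have := hP (gal_mul s t); congr P.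
  by apply: boolp.funext => b; apply/mpolyP => u; rewrite /map_tup !mcoeff_map_mpoly.
- move=> G WG; apply: boolp.contrapT => nQ; apply: nG; exists G; split=> //.
  exact: WG.
- move=> P linP hP; have id_bij : bijective (idfun : {rmorphism ks -> ks}) by exists idfun.
  have := hP (@Defs.Gal k ks i idfun id_bij (fun a => erefl)); congr P.
  by apply: boolp.funext => b; apply/mpolyP => u; rewrite /map_tup !mcoeff_map_mpoly.
Qed.

End Descent.

Lemma rmorph_mmap n (R S S' : comNzRingType) (g : {rmorphism R -> S}) (f : {rmorphism S -> S'})
    (h : 'I_n -> S) (p : {mpoly R[n]}) :
  f (mmap g h p) = mmap (f \o g) (fun u => f (h u)) p.
Proof.
rewrite /mmap rmorph_sum; apply: eq_bigr => u _; rewrite rmorphM /mmap1 rmorph_prod.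
by congr (_ * _); apply: eq_bigr => v _; rewrite rmorphXn.
Qed.

Lemma mmap_map n (R S S' : comNzRingType) (g : {rmorphism R -> S}) (f : {rmorphism S -> S'})
    (h : 'I_n -> S') (p : {mpoly R[n]}) :
  mmap f h (map_mpoly g p) = mmap (f \o g) h p.
Proof.
rewrite /map_mpoly (rmorph_mmap _ (mmap f h)) /mmap; apply: eq_bigr => u _.
rewrite /= mmapC /mmap1; congr (_ * _); apply: eq_bigr => v _.
by rewrite mmapX mmap1U.
Qed.

Lemma mmap_eq n (R S : nzRingType) (f : R -> S) (h h' : 'I_n -> S) (p : {mpoly R[n]}) :
  h =1 h' -> mmap f h p = mmap f h' p.
Proof. by move=> e; have -> : h = h' by apply: boolp.funext. Qed.

Lemma mmap_wscale n (R S : comNzRingType) (f : {rmorphism R -> S}) (p : {mpoly R[n]}) h w a :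
  (forall u, u \in msupp p -> \prod_v w v ^+ u v = a) ->
  mmap f (fun v => w v * h v) p = a * mmap f h p.
Proof.
move=> hp; rewrite /mmap mulr_sumr; apply: eq_big_seq => u hu.
rewrite mulrCA; congr (_ * _); rewrite /mmap1 -(hp _ hu) -big_split /=.
by apply: eq_bigr => v _; rewrite exprMn.
Qed.

Lemma mmap_scale n (R S : comNzRingType) (f : {rmorphism R -> S}) d (p : {mpoly R[n]}) h a :
  p \is d.-homog -> mmap f (fun u => a * h u) p = a ^+ d * mmap f h p.
Proof.
move/dhomogP => hp; apply: (mmap_wscale f h (w := fun=> a)) => u /hp <-.
by rewrite prodrXr /= mdegE.
Qed.

Lemma cat_lshift (T : Type) m n (x : 'I_m -> T) (y : 'I_n -> T) u :
  cat_coords x y (lshift n u) = x u.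
Proof. by rewrite /cat_coords (unsplitK (inl u)). Qed.
Lemma cat_rshift (T : Type) m n (x : 'I_m -> T) (y : 'I_n -> T) u :
  cat_coords x y (rshift m u) = y u.
Proof. by rewrite /cat_coords (unsplitK (inr u)). Qed.

Lemma mmap_biscale (k S : fieldType) (f : {rmorphism k -> S}) m n d e (p : {mpoly k[m + n]}) x y a b :
  bihomog d e p ->
  mmap f (cat_coords (fun u => a * x u) (fun u => b * y u)) p
    = a ^+ d * b ^+ e * mmap f (cat_coords x y) p.
Proof.
move=> hp; rewrite -(mmap_wscale f (cat_coords x y)
  (w := cat_coords (fun _ : 'I_m => a) (fun _ : 'I_n => b))).
  by apply: mmap_eq => v; rewrite /cat_coords; case: split.
move=> u /hp [<- <-]; rewrite big_split_ord /= -!prodrXr.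
by congr (_ * _); apply: eq_bigr => v _; rewrite ?cat_lshift ?cat_rshift.
Qed.

Section FormsDescent.
Variables (k ks K : fieldType) (i : {rmorphism k -> ks}) (j : {rmorphism ks -> K}).
Hypothesis hks : separable_closure i.
Variables (m n : nat) (Hm : 'X_{1..n} -> Prop) (on : ('I_n -> K) -> Prop).
Variable phi : ('I_n -> K) -> 'I_m -> K.

(** The multiplier [a] is allowed to vanish, so that the tuples representing [phi] form a linear
    space. Being defined at [v0] means lying outside the linear space of tuples vanishing there. The
    predicate [Hm] on monomials serves both homogeneous and bihomogeneous forms. *)
Lemma forms_descent (F0 : 'I_m -> {mpoly ks[n]}) v0 :
  (forall b u, u \in msupp (F0 b) -> Hm u) ->
  (forall (s : gal i) v, on v ->
    exists a, forall b, mmap j v (map_mpoly s (F0 b)) = a * phi v b) ->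
  (exists b, mmap j v0 (F0 b) != 0) ->
  exists F : 'I_m -> {mpoly k[n]},
    [/\ forall b u, u \in msupp (F b) -> Hm u,
        exists b, mmap (rcomp j i) v0 (F b) != 0
      & forall v, on v -> exists a, forall b, mmap (rcomp j i) v (F b) = a * phi v b].
Proof.
move=> hm hphi [b0 nz].
pose S (F : 'I_m -> {mpoly ks[n]}) := (forall b u, u \in msupp (F b) -> Hm u) /\
  forall v, on v -> exists a, forall b, mmap j v (F b) = a * phi v b.
pose Q (F : 'I_m -> {mpoly ks[n]}) := forall b, mmap j v0 (F b) = 0.
have [||||G [[G1 G2] G3]] := @galois_descent _ _ i hks m n S Q F0.
- split; first by split=> [b u|v _]; [rewrite msupp0 | exists 0 => b; rewrite mmap0 mul0r].
  move=> c F G [F1 F2] [G1 G2]; split.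
    move=> b u /msuppD_le; rewrite mem_cat => /orP[/msuppZ_le|]; [exact: F1 | exact: G1].
  move=> v hv; have [a ha] := F2 v hv; have [a' ha'] := G2 v hv.
  by exists (j c * a + a') => b; rewrite mmapD mmapZ ha ha' mulrDl mulrA.
- split; first by move=> b; rewrite mmap0.
  by move=> c F G hF hG b; rewrite mmapD mmapZ hF hG mulr0 addr0.
- move=> s; split; last exact: hphi.
  move=> b u; rewrite /map_tup mcoeff_msupp mcoeff_map_mpoly fmorph_eq0 -mcoeff_msupp.
  exact: hm.
- by move=> /(_ b0) e; rewrite e eqxx in nz.
exists G; split.
- move=> b u hu; apply: (G1 b); move: hu; rewrite /map_tup !mcoeff_msupp mcoeff_map_mpoly.
  by rewrite fmorph_eq0.
- apply: boolp.contrapT => h; apply: G3 => b; apply/eqP; apply: contraT => nb.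
  by case: h; exists b; rewrite -[X in X != 0](mmap_map i j).
- move=> v hv; have [a ha] := G2 v hv; exists a => b.
  by rewrite -ha /map_tup mmap_map.
Qed.

End FormsDescent.

(** * The group law *)

Definition vec3 (R : nzRingType) (x y z : R) : 'I_3 -> R := fun a => [:: x; y; z]`_a.

Lemma ord3_ind (P : 'I_3 -> Prop) : P 0 -> P 1 -> P 2%:R -> forall a, P a.
Proof.
move=> p0 p1 p2 a.
have : [\/ a = 0, a = 1 | a = 2%:R].
  by case: a => -[|[|[|//]]] h; [constructor 1 | constructor 2 | constructor 3]; apply: val_inj.
by case=> ->.
Qed.

Lemma vec3E (R : nzRingType) (p : 'I_3 -> R) : p = vec3 (p 0) (p 1) (p 2%:R).
Proof. by apply: boolp.funext; apply: ord3_ind. Qed.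

Section AdditionLaws.
Variable R : comNzRingType.
Variable c : R.

(* Two addition laws of bidegree (2, 2): the first one vanishes only on the diagonal and
   the second one only when the difference of the two points has order 2. *)
Definition ec_law (l : bool) (p q : 'I_3 -> R) : 'I_3 -> R :=
  let x1 := p 0 in let y1 := p 1 in let z1 := p 2%:R in
  let x2 := q 0 in let y2 := q 1 in let z2 := q 2%:R in
  if l then
    vec3 ((x1 * y2 - x2 * y1) * (y1 * z2 + y2 * z1) + (x1 * z2 - x2 * z1) * (y1 * y2)
            - 3%:R * c * (x1 * z2 - x2 * z1) * (z1 * z2))
         (- (3%:R * (x1 * x2) * (x1 * y2 - x2 * y1)) - (y1 * y2) * (y1 * z2 - y2 * z1)
            + 3%:R * c * (y1 * z2 - y2 * z1) * (z1 * z2))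
         (3%:R * (x1 * x2) * (x1 * z2 - x2 * z1) - (y1 * z2 + y2 * z1) * (y1 * z2 - y2 * z1))
  else
    vec3 ((x1 * y2 + x2 * y1) * (y1 * y2 - 3%:R * c * (z1 * z2))
            - 3%:R * c * (y1 * z2 + y2 * z1) * (x1 * z2 + x2 * z1))
         ((y1 * y2 + 3%:R * c * (z1 * z2)) * (y1 * y2 - 3%:R * c * (z1 * z2))
            + 9%:R * c * (x1 * x2) * (x1 * z2 + x2 * z1))
         ((y1 * z2 + y2 * z1) * (y1 * y2 + 3%:R * c * (z1 * z2))
            + 3%:R * (x1 * x2) * (x1 * y2 + x2 * y1)).

Lemma ec_law_scale l p q a b u :
  ec_law l (fun v => a * p v) (fun v => b * q v) u = (a * b) ^+ 2 * ec_law l p q u.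
Proof. by case: l; move: u; apply: ord3_ind; rewrite /ec_law /vec3 /=; ring. Qed.

End AdditionLaws.

Lemma ec_law_morph (R S : comNzRingType) (f : {rmorphism R -> S}) c l p q u :
  f (ec_law c l p q u) = ec_law (f c) l (f \o p) (f \o q) u.
Proof.
by case: l; move: u; apply: ord3_ind; rewrite /ec_law /vec3 /=;
  rewrite !(rmorph_nat, rmorphM, rmorphB, rmorphD, rmorphN).
Qed.

Lemma ec_coordsE (K : fieldType) (P : ecpoint K) :
  ec_coords P = if P is Affine x y then vec3 x y 1 else vec3 0 1 0.
Proof. by case: P. Qed.

Section Points.
Variables (K : fieldType) (c : K).
Hypotheses (n2 : 2%:R != 0 :> K) (n3 : 3%:R != 0 :> K) (c0 : c != 0).

Definition ec_line (x1 y1 x2 l : K) : ecpoint K :=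
  let x3 := l ^+ 2 - x1 - x2 in Affine x3 (l * (x1 - x3) - y1).

Variant ec_add_spec (x1 y1 x2 y2 : K) : ecpoint K -> Prop :=
| EcAddOpp : x2 = x1 -> y2 = - y1 -> ec_add_spec x1 y1 x2 y2 Infty
| EcAddDouble : x2 = x1 -> y2 = y1 -> y1 != 0 ->
    ec_add_spec x1 y1 x2 y2 (ec_line x1 y1 x1 ((3%:R * x1 ^+ 2) / (2%:R * y1)))
| EcAddChord : x1 != x2 ->
    ec_add_spec x1 y1 x2 y2 (ec_line x1 y1 x2 ((y2 - y1) / (x2 - x1))).

Lemma ec_addP x1 y1 x2 y2 : y1 ^+ 2 = x1 ^+ 3 + c -> y2 ^+ 2 = x2 ^+ 3 + c ->
  ec_add_spec x1 y1 x2 y2 (ec_add (Affine x1 y1) (Affine x2 y2)).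
Proof.
move=> h1 h2; rewrite /ec_add; case: (eqVneq x1 x2) => [e|nx] /=; last exact: EcAddChord.
subst x2; case: (eqVneq y1 (- y2)) => [e|ny]; first by apply: EcAddOpp; rewrite // e opprK.
have /orP[/eqP e|/eqP e] : (y1 == y2) || (y1 == - y2) by rewrite -eqf_sqr h1 h2.
  subst y2; apply: EcAddDouble => //; apply: contraNneq ny => ->.
  by rewrite oppr0.
by rewrite e eqxx in ny.
Qed.

Lemma on_ec_add P Q : on_ec c P -> on_ec c Q -> on_ec c (ec_add P Q).
Proof.
case: P => [//|x1 y1]; case: Q => [//|x2 y2] h1 h2.
case: (ec_addP h1 h2) => [//|_ _ y0|nx] /=; rewrite /= in h1 h2.
  by field: h1; rewrite ?n2 ?y0.
by field: h1 h2; rewrite subr_eq0 eq_sym.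
Qed.

Lemma on_ec_opp P : on_ec c P -> on_ec c (ec_opp P).
Proof. by case: P => //= x y; rewrite sqrrN. Qed.

Lemma ec_addC P Q : on_ec c P -> on_ec c Q -> ec_add P Q = ec_add Q P.
Proof.
case: P => [|x1 y1]; case: Q => [|x2 y2] // h1 h2.
case: (ec_addP h1 h2) => [-> ->|-> -> y0|nx].
- by rewrite /= opprK !eqxx.
- case: (ec_addP h1 h1) => [_ e|//|]; last by rewrite eqxx.
  by case/eqP: y0; apply: (mulfI n2); rewrite mulr0 mulr_natl mulr2n {1}e addNr.
- rewrite /ec_add eq_sym (negbTE nx) /= /ec_line.
  by congr Affine; field; rewrite ?subr_eq0 // ?(eq_sym x2) nx.
Qed.

Lemma ec_law_ok P Q : on_ec c P -> on_ec c Q ->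
  exists lam : bool -> K, (forall l u, ec_law c l (ec_coords P) (ec_coords Q) u
    = lam l * ec_coords (ec_add P Q) u) /\ exists l, lam l != 0.
Proof.
(* The factor is read off at the coordinate where [ec_coords] of the sum equals 1. *)
move=> hP hQ; exists (fun l => ec_law c l (ec_coords P) (ec_coords Q)
  (if ec_add P Q is Infty then 1 else 2%:R)).
case: P hP => [|x1 y1] h1; case: Q hQ => [|x2 y2] h2.
- split; first by case; apply: ord3_ind; rewrite /ec_law /vec3 /=; ring.
  exists false; rewrite [X in X != 0](_ : _ = 1) ?oner_neq0 //.
  by rewrite /ec_law /vec3 /=; ring.
- split; first by case; apply: ord3_ind; rewrite /ec_law /vec3 /=; ring.
  exists true; rewrite [X in X != 0](_ : _ = - 1) ?oppr_eq0 ?oner_neq0 //.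
  by rewrite /ec_law /vec3 /=; ring.
- split; first by case; apply: ord3_ind; rewrite /ec_law /vec3 /=; ring.
  exists true; rewrite [X in X != 0](_ : _ = 1) ?oner_neq0 //.
  by rewrite /ec_law /vec3 /=; ring.
rewrite /on_ec in h1 h2.
have nat_neq0 : [/\ 8%:R != 0 :> K & 27%:R != 0 :> K].
  have -> : 8%:R = 2%:R ^+ 3 :> K by ring.
  have -> : 27%:R = 3%:R ^+ 3 :> K by ring.
  by split; rewrite expf_neq0.
case: nat_neq0 => n8 n27.
case: (ec_addP h1 h2) => [e1 e2|e1 e2 y0|nx].
- subst x2 y2; split.
    by case; apply: ord3_ind; rewrite /ec_law /vec3 /=; ring: h1.
  (* For [y1 = 0] the two opposite points coincide; the law [true] vanishes on the diagonal, so the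
     law [false] is the one to use. *)
  case: (eqVneq y1 0) => [y0|y0].
    have {}h1 : x1 ^+ 3 = - c by apply/eqP; rewrite -addr_eq0 -h1 y0 expr0n.
    exists false; rewrite [X in X != 0](_ : _ = - (27%:R * c ^+ 2)).
      by rewrite oppr_eq0 mulf_neq0 ?expf_neq0.
    by rewrite /ec_law /vec3 /= y0; ring: h1.
  exists true; rewrite [X in X != 0](_ : _ = 8%:R * y1 ^+ 3); first by rewrite mulf_neq0 ?expf_neq0.
  by rewrite /ec_law /vec3 /=; ring: h1.
- subst x2 y2; split.
    by case; apply: ord3_ind; rewrite /ec_law /vec3 /=; field: h1; rewrite ?n2 ?y0.
  exists false; rewrite [X in X != 0](_ : _ = 8%:R * y1 ^+ 3); first by rewrite mulf_neq0 ?expf_neq0.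
  by rewrite /ec_law /vec3 /=; ring: h1.
- have d0 : x2 - x1 != 0 by rewrite subr_eq0 eq_sym.
  split; first by case; apply: ord3_ind; rewrite /ec_law /vec3 /=; field: h1 h2; rewrite ?d0.
  exists true; rewrite [X in X != 0](_ : _ = (x2 - x1) ^+ 3) ?expf_neq0 //.
  by rewrite /ec_law /vec3 /=; ring: h1 h2.
Qed.
End Points.

(** * Functions on the affine curve over an algebraically closed field *)

Section ClosedField.
Variable K : fieldType.
Hypothesis hK : GRing.closed_field_axiom K.

Lemma closed_root (p : {poly K}) : (1 < size p)%N -> exists x, root p x.
Proof.
move=> sp; have sp1 : (0 < (size p).-1)%N by lia.
have lc : lead_coef p != 0 by rewrite lead_coef_eq0 -size_poly_gt0; lia.
have [x hx] := hK (fun j => - p`_j / lead_coef p) sp1.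
exists x; rewrite /root horner_coef.
have -> : size p = (size p).-1.+1 by lia.
rewrite big_ord_recr /= hx -lead_coefE mulr_sumr -big_split /=.
by rewrite big1 // => j _; field.
Qed.

Lemma closed_sqrt (a : K) : exists y, y ^+ 2 = a.
Proof.
have [y] := hK (fun j => if j is 0 then a else 0) (isT : 0 < 2)%N.
by rewrite big_ord_recl big_ord1 /= mul0r addr0 expr0 mulr1 => <-; exists y.
Qed.

(** This shows that a nonconstant polynomial is not identically zero as a function, without counting
    roots. *)
Lemma closed_value_N1 (p : {poly K}) : (1 < size p)%N -> exists x, p.[x] = - 1.
Proof.
move=> sp; have [|x /eqP] := @closed_root (p + 1).
  by rewrite size_polyDl // size_poly1.
by rewrite hornerD hornerC => /eqP; rewrite addr_eq0 => /eqP; exists x.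
Qed.

Lemma closed_poly_eq0 (p : {poly K}) : (forall x, p.[x] = 0) -> p = 0.
Proof.
move=> h; have [sp|sp] := ltnP 1 (size p).
  have [x] := closed_value_N1 sp; rewrite h => /eqP.
  by rewrite eq_sym oppr_eq0 oner_eq0.
by have := h 0; rewrite (size1_polyC sp) hornerC => ->.
Qed.

Definition poly_of_roots (s : seq K) := \prod_(a <- s) ('X - a%:P).

Lemma poly_of_roots_neq0 s : poly_of_roots s != 0.
Proof. by rewrite -lead_coef_eq0 (monicP (monic_prod_XsubC _ _ _)) oner_neq0. Qed.

Lemma poly_of_roots_eq0 s x : (poly_of_roots s).[x] == 0 = (x \in s).
Proof. exact: root_prod_XsubC. Qed.

Lemma closed_infinite (s : seq K) : exists x, x \notin s.
Proof.
apply: boolp.contrapT => h.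
have /eqP := poly_of_roots_neq0 s; apply; apply: closed_poly_eq0 => x.
by apply/eqP; rewrite poly_of_roots_eq0; apply: contraT => nx; case: h; exists x.
Qed.

Variable c : K.

(** The coordinate ring of the affine curve is free over [K[x]] with basis [1, y]; [a] and [b] are
    the coordinates of the function [g]. *)
Definition affine_fun (g : K -> K -> K) (a b : {poly K}) :=
  forall x y, y ^+ 2 = x ^+ 3 + c -> g x y = a.[x] + b.[x] * y.

Lemma affine_fun_mpoly (G : {mpoly K[3]}) :
  exists a b, affine_fun (fun x y => G.@[vec3 x y 1]) a b.
Proof.
pose C g := exists a b, affine_fun g a b.
have CD g h : C g -> C h -> C (fun x y => g x y + h x y).
  move=> [a [b e]] [a' [b' e']]; exists (a + a'), (b + b') => x y hy.
  by rewrite (e _ _ hy) (e' _ _ hy) !(hornerD, hornerN, hornerM, horner_exp, hornerC, hornerX); ring.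
have CM g h : C g -> C h -> C (fun x y => g x y * h x y).
  move=> [a [b e]] [a' [b' e']].
  exists (a * a' + b * b' * ('X^3 + c%:P)), (a * b' + a' * b) => x y hy.
  by rewrite (e _ _ hy) (e' _ _ hy) !(hornerD, hornerN, hornerM, horner_exp, hornerC, hornerX); ring: hy.
have CC u : C (fun _ _ => u).
  by exists u%:P, 0 => x y _; rewrite !(hornerD, hornerN, hornerM, horner_exp, hornerC, hornerX) /=; ring.
have CX a : C (fun x y => vec3 x y 1 a).
  move: a; apply: ord3_ind; rewrite /vec3 /=.
  - by exists 'X, 0 => x y _; rewrite !(hornerD, hornerN, hornerM, horner_exp, hornerC, hornerX) /=; ring.
  - by exists 0, 1 => x y _; rewrite !(hornerD, hornerN, hornerM, horner_exp, hornerC, hornerX) /=; ring.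
  - exact: CC.
have Cext g h : (forall x y, g x y = h x y) -> C g -> C h.
  by move=> gh [a [b e]]; exists a, b => x y hy; rewrite -gh e.
have CE g n : C g -> C (fun x y => g x y ^+ n).
  move=> hg; elim: n => [|n IH]; first by apply: Cext (CC 1) => x y; rewrite expr0.
  by apply: Cext (CM _ _ hg IH) => x y; rewrite exprS.
have CS (r : seq 'X_{1..3}) F : (forall u, C (F u)) -> C (fun x y => \sum_(u <- r) F u x y).
  move=> hF; elim: r => [|u r IH]; first by apply: Cext (CC 0) => x y; rewrite big_nil.
  by apply: Cext (CD _ _ (hF u) IH) => x y; rewrite big_cons.
have CP (r : seq 'I_3) F : (forall u, C (F u)) -> C (fun x y => \prod_(u <- r) F u x y).
  move=> hF; elim: r => [|u r IH]; first by apply: Cext (CC 1) => x y; rewrite big_nil.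
  by apply: Cext (CM _ _ (hF u) IH) => x y; rewrite big_cons.
apply: (@Cext (fun x y => \sum_(u <- msupp G) G@_u * \prod_(v <- index_enum 'I_3) vec3 x y 1 v ^+ u v)).
  by move=> x y; rewrite mevalE.
by apply: CS => u; apply: CM => //; apply: CP => v; apply: CE.
Qed.

(** Parity of degrees: a nonzero [a ^+ 2] has even degree, a nonzero multiple of a cubic by a square
    has odd degree. *)
Lemma norm_eq0 (a b : {poly K}) : a ^+ 2 = b ^+ 2 * ('X^3 + c%:P) -> a = 0 /\ b = 0.
Proof.
have sc : size ('X^3 + c%:P) = 4%N.
  by rewrite size_polyDl ?size_polyXn // (leq_ltn_trans (size_polyC_leq1 _)).
case: (eqVneq b 0) => [->|b0] e.
  by split=> //; apply/eqP; move/eqP: e; rewrite expr0n mul0r expf_eq0.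
have c0 : 'X^3 + c%:P != 0 by rewrite -size_poly_gt0 sc.
have a0 : a != 0.
  by apply: contraNneq b0 => a0; move/esym/eqP: e; rewrite a0 expr0n mulf_eq0 (negbTE c0) orbF expf_eq0.
have /(congr1 (fun p : {poly K} => size p)) := e.
rewrite !expr2 !size_mul ?mulf_neq0 // sc.
move: a0 b0; rewrite -!size_poly_gt0.
by case: (size a) (size b) => [//|m] [//|n] _ _; rewrite !addnS !addSn /= => -[]; lia.
Qed.

(** The affine coordinate ring is a domain: the norm [a ^+ 2 - b ^+ 2 * ('X^3 + c)] to [K[x]] is
    multiplicative and vanishes only at 0. *)
Lemma ec_prime a b a' b' :
  (forall x y, y ^+ 2 = x ^+ 3 + c -> (a.[x] + b.[x] * y) * (a'.[x] + b'.[x] * y) = 0) ->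
  (a = 0 /\ b = 0) \/ (a' = 0 /\ b' = 0).
Proof.
move=> h; pose N (p q : {poly K}) := p ^+ 2 - q ^+ 2 * ('X^3 + c%:P).
have /eqP : N a b * N a' b' = 0.
  apply: closed_poly_eq0 => x; have [y hy] := closed_sqrt (x ^+ 3 + c).
  have h1 := h x y hy; have h2 := h x (- y); rewrite sqrrN in h2.
  have {h2} := h2 hy; move: h1; rewrite /N !(hornerD, hornerN, hornerM, horner_exp, hornerC, hornerX) => h1 h2.
  have -> : (a.[x] ^+ 2 - b.[x] ^+ 2 * (x ^+ 3 + c)) * (a'.[x] ^+ 2 - b'.[x] ^+ 2 * (x ^+ 3 + c))
    = (a.[x] + b.[x] * y) * (a'.[x] + b'.[x] * y)
      * ((a.[x] + b.[x] * - y) * (a'.[x] + b'.[x] * - y)) by rewrite -hy; ring.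
  by rewrite h1 mul0r.
rewrite mulf_eq0 !subr_eq0 => /orP[] /eqP /norm_eq0; by [left | right].
Qed.

(** The product of [G] with the polynomial whose roots are the exceptional abscissas vanishes on the
    whole affine curve, and [ec_prime] cancels the second factor. *)
Lemma ec_finite_exceptions (G : {mpoly K[3]}) (s : seq K) :
  (forall x y, y ^+ 2 = x ^+ 3 + c -> x \notin s -> G.@[vec3 x y 1] = 0) ->
  forall x y, y ^+ 2 = x ^+ 3 + c -> G.@[vec3 x y 1] = 0.
Proof.
move=> h; have [a [b e]] := affine_fun_mpoly G.
have [x y hy|[a0 b0] x y hy|[/eqP]] := @ec_prime a b (poly_of_roots s) 0.
- rewrite -e // hornerC mul0r addr0; case: (boolP (x \in s)) => hx.
    by rewrite -poly_of_roots_eq0 in hx; rewrite (eqP hx) mulr0.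
  by rewrite h ?mul0r.
- by rewrite e // a0 b0 !hornerC mul0r addr0.
- by rewrite (negbTE (poly_of_roots_neq0 s)).
Qed.

End ClosedField.

Lemma ec_law_meval (K : fieldType) n (c : K) l (p q : 'I_3 -> {mpoly K[n]}) v u :
  (ec_law c%:MP l p q u).@[v] =
  ec_law c l (fun w => (p w).@[v]) (fun w => (q w).@[v]) u.
Proof. by rewrite -[in RHS](mevalC v c); exact: (ec_law_morph (meval v)). Qed.

Lemma ec_coords_cross (K : fieldType) (A B : ecpoint K) :
  (forall a b, ec_coords A a * ec_coords B b = ec_coords A b * ec_coords B a) -> A = B.
Proof.
move=> h; have h0 := h 0 2%:R; have h1 := h 1 2%:R.
case: A B h0 h1 {h} => [|x y] [|x' y']; rewrite !ec_coordsE /vec3 //=.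
- by move=> _ /eqP; rewrite mul1r mul0r oner_eq0.
- by move=> _ /esym /eqP; rewrite mul1r mulr0 oner_eq0.
- by rewrite !mulr1 !mul1r => -> ->.
Qed.

Lemma ec_coords_neq0 (K : fieldType) (A : ecpoint K) : proj_nz (ec_coords A).
Proof.
by case: A => [|x y]; [exists 1 | exists 2%:R]; rewrite ec_coordsE /vec3 /= oner_neq0.
Qed.

Lemma ec_addN (K : fieldType) (P : ecpoint K) : ec_add P (ec_opp P) = Infty.
Proof. by case: P => //= x y; rewrite opprK !eqxx. Qed.

Lemma ec_add0 (K : fieldType) (P : ecpoint K) : ec_add P Infty = P.
Proof. by case: P. Qed.

(** * Associativity of the chord-tangent law *)

Section Associativity.
Variables (K : fieldType) (c : K).
Hypotheses (hK : GRing.closed_field_axiom K).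
Hypotheses (n2 : 2%:R != 0 :> K) (n3 : 3%:R != 0 :> K) (c0 : c != 0).

Lemma ec_addA_generic x1 y1 x2 y2 x3 y3 :
  y1 ^+ 2 = x1 ^+ 3 + c -> y2 ^+ 2 = x2 ^+ 3 + c -> y3 ^+ 2 = x3 ^+ 3 + c ->
  x1 != x2 -> x2 != x3 ->
  ((y2 - y1) / (x2 - x1)) ^+ 2 - x1 - x2 != x3 ->
  ((y3 - y2) / (x3 - x2)) ^+ 2 - x2 - x3 != x1 ->
  ec_add (ec_add (Affine x1 y1) (Affine x2 y2)) (Affine x3 y3) =
  ec_add (Affine x1 y1) (ec_add (Affine x2 y2) (Affine x3 y3)).
Proof.
move=> h1 h2 h3 e12 e23 eA eB.
have d12 : x2 - x1 != 0 by rewrite subr_eq0 eq_sym.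
have d23 : x3 - x2 != 0 by rewrite subr_eq0 eq_sym.
have dA : x3 - (((y2 - y1) / (x2 - x1)) ^+ 2 - x1 - x2) != 0 by rewrite subr_eq0 eq_sym.
have dB : ((y3 - y2) / (x3 - x2)) ^+ 2 - x2 - x3 - x1 != 0 by rewrite subr_eq0.
(* The nonvanishing conditions are brought, with denominators cleared, into the shape of the side
   conditions produced by [field]. *)
have {}dA : x3 * (x2 - x1) ^+ 2 -
    ((y2 - y1) ^+ 2 + - x1 * (x2 - x1) ^+ 2 + - x2 * (x2 - x1) ^+ 2) != 0.
  apply: contraNneq dA => e; apply/eqP; apply: (mulIf (expf_neq0 2 d12)); rewrite mul0r -e.
  by field; rewrite d12.
have {}dB : (y3 - y2) ^+ 2 + - x2 * (x3 - x2) ^+ 2 + - x3 * (x3 - x2) ^+ 2 +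
    - x1 * (x3 - x2) ^+ 2 != 0.
  apply: contraNneq dB => e; apply/eqP; apply: (mulIf (expf_neq0 2 d23)); rewrite mul0r -e.
  by field; rewrite d23.
rewrite /= (negbTE e12) (negbTE e23) /= (negbTE eA) [x1 == _]eq_sym (negbTE eB) /=.
by congr Affine; field: h1 h2 h3; rewrite d12 d23 dA dB.
Qed.

(** Addition laws that do not vanish at the point under consideration express both sides by
    polynomials in the third point. The 2 by 2 minors of the two coordinate vectors vanish off
    finitely many abscissas, hence everywhere, and at the chosen point this forces equality. *)
Lemma ec_addA_close P1 P2 (s : seq K) : on_ec c P1 -> on_ec c P2 ->
  (forall x y, on_ec c (Affine x y) -> x \notin s ->
    ec_add (ec_add P1 P2) (Affine x y) = ec_add P1 (ec_add P2 (Affine x y))) ->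
  forall x y, on_ec c (Affine x y) ->
    ec_add (ec_add P1 P2) (Affine x y) = ec_add P1 (ec_add P2 (Affine x y)).
Proof.
move=> h1 h2 h x0 y0 h0.
have hS := on_ec_add n2 h1 h2; have hB := on_ec_add n2 h2 h0.
have [lam [e [l nl]]] := ec_law_ok n2 n3 c0 hS h0.
have [lam2 [e2 [l2 nl2]]] := ec_law_ok n2 n3 c0 h2 h0.
have [lam1 [e1 [l1 nl1]]] := ec_law_ok n2 n3 c0 h1 hB.
pose mp (v : 'I_3 -> K) : 'I_3 -> {mpoly K[3]} := fun u => (v u)%:MP.
pose X : 'I_3 -> {mpoly K[3]} := fun u => 'X_u.
pose V1 := ec_law c%:MP l (mp (ec_coords (ec_add P1 P2))) X.
pose V2 := ec_law c%:MP l1 (mp (ec_coords P1)) (ec_law c%:MP l2 (mp (ec_coords P2)) X).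
have mpE v w : (fun u => (mp v u).@[w]) = v by apply: boolp.funext => u; rewrite /mp mevalC.
have XE w : (fun u => (X u).@[w]) = w by apply: boolp.funext => u; rewrite /X mevalXU.
have V1E v u : (V1 u).@[v] = ec_law c l (ec_coords (ec_add P1 P2)) v u.
  by rewrite /V1 ec_law_meval mpE XE.
have V2E v u : (V2 u).@[v] = ec_law c l1 (ec_coords P1) (ec_law c l2 (ec_coords P2) v) u.
  rewrite /V2 ec_law_meval mpE; congr (ec_law _ _ _ _ _).
  by apply: boolp.funext => w; rewrite ec_law_meval mpE XE.
(* At other points the laws fixed above may vanish; the multipliers need to be nonzero only at
   [(x0, y0)]. *)
have V12 x y : on_ec c (Affine x y) -> exists m1 m2 m3 : K,
    [/\ forall u, (V1 u).@[vec3 x y 1] = m1 * ec_coords (ec_add (ec_add P1 P2) (Affine x y)) u,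
     forall u, (V2 u).@[vec3 x y 1] = m2 * m3 ^+ 2 * ec_coords (ec_add P1 (ec_add P2 (Affine x y))) u
     & x = x0 -> y = y0 -> m1 * (m2 * m3 ^+ 2) != 0].
  move=> hxy.
  have [mu [f _]] := ec_law_ok n2 n3 c0 hS hxy.
  have [mu2 [f2 _]] := ec_law_ok n2 n3 c0 h2 hxy.
  have [mu1 [f1 _]] := ec_law_ok n2 n3 c0 h1 (on_ec_add n2 h2 hxy).
  exists (mu l), (mu1 l1), (mu2 l2); split.
  - by move=> u; rewrite V1E f.
  - move=> u; rewrite V2E (boolp.funext (f2 l2)).
    have := ec_law_scale c l1 (ec_coords P1) (ec_coords (ec_add P2 (Affine x y))) 1 (mu2 l2) u.
    rewrite mul1r (_ : (fun v => 1 * _) = ec_coords P1) => [->|].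
      by rewrite f1 mulrA [mu1 l1 * _]mulrC.
    by apply: boolp.funext => v; rewrite mul1r.
  - move=> ex ey; subst x y.
    have nz (a b : bool -> K) (k : bool) P : (forall u, a k * ec_coords P u = b k * ec_coords P u) ->
        a k != 0 -> b k != 0.
      move=> E na; have [u nu] := ec_coords_neq0 P; apply: contraNneq na => bk.
      by have := E u; rewrite bk mul0r => /eqP; rewrite mulf_eq0 (negbTE nu) orbF.
    apply: mulf_neq0; [|apply: mulf_neq0; [|apply: expf_neq0]].
    + by apply: (nz _ _ _ _ _ nl) => u; exact: etrans (esym (e _ u)) (f _ u).
    + by apply: (nz _ _ _ _ _ nl1) => u; exact: etrans (esym (e1 _ u)) (f1 _ u).
    + by apply: (nz _ _ _ _ _ nl2) => u; exact: etrans (esym (e2 _ u)) (f2 _ u).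
apply: ec_coords_cross => a b.
have [m1 [m2 [m3 [E1 E2 /(_ erefl erefl) nz]]]] := V12 _ _ h0.
pose G := V1 a * V2 b - V1 b * V2 a.
have G0 : G.@[vec3 x0 y0 1] = 0.
  apply: (ec_finite_exceptions hK (s := s)) h0 => x y hxy xs.
  have [p1 [p2 [p3 [F1 F2 _]]]] := V12 _ _ hxy.
  by rewrite /G mevalB !mevalM !F1 !F2 h //; ring.
apply/eqP; rewrite -subr_eq0 -(mulrI_eq0 _ (mulfI nz)); apply/eqP; rewrite -[RHS]G0.
by rewrite /G mevalB !mevalM !E1 !E2; ring.
Qed.

Lemma ec_addA_chord x1 y1 x2 y2 P3 :
  on_ec c (Affine x1 y1) -> on_ec c (Affine x2 y2) -> on_ec c P3 -> x1 != x2 ->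
  ec_add (ec_add (Affine x1 y1) (Affine x2 y2)) P3 =
  ec_add (Affine x1 y1) (ec_add (Affine x2 y2) P3).
Proof.
move=> h1 h2; case: P3 => [|x3 y3] h3 n12; first by rewrite !ec_add0.
(* [x3] is a root of [q] when the abscissa of [P2 + P3] is [x1]. *)
pose e : {poly K} := (x2 - x1) *: 'X^2 + (2%:R * x2 * (x1 + x2) - x2 ^+ 2) *: 'X
  + (c + y2 ^+ 2 - (x1 + x2) * x2 ^+ 2)%:P.
pose q := e ^+ 2 - (2%:R * y2)%:P ^+ 2 * ('X^3 + c%:P).
(* The chord condition reads [e = 2 y y2], where [e] is [y ^+ 2 + y2 ^+ 2 - (x1 + x2 + x) * (x - x2)
   ^+ 2] reduced by [y ^+ 2 = x ^+ 3 + c]; squaring it gives [q]. The coefficient [x2 - x1] of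
   ['X^2] in [e] keeps [q] from vanishing. *)
have q0 : q != 0.
  apply/eqP => /eqP; rewrite subr_eq0 => /eqP /norm_eq0 [e0 _].
  have : e`_2 = x2 - x1.
    by rewrite /e !coefD !coefZ coefXn coefX coefC /= mulr0 mulr1 !addr0.
  by rewrite e0 coef0 => /esym /eqP; rewrite subr_eq0 eq_sym (negbTE n12).
have [s [_ _ hs]] := poly_roots q0.
apply: (ec_addA_close (s := x2 :: (((y2 - y1) / (x2 - x1)) ^+ 2 - x1 - x2) :: s)) h3 => //.
move=> x y hxy; rewrite !inE !negb_or => /and3P[nx2 nxA nxs].
apply: ec_addA_generic => //; try by rewrite eq_sym.
apply: contraNneq nxs => eB; apply: hs; apply/eqP.
have d : x - x2 != 0 by rewrite subr_eq0.
have {}eB : (x1 + x2 + x) * (x - x2) ^+ 2 = (y - y2) ^+ 2 by rewrite -eB; field.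
have -> : q.[x] = (y ^+ 2 + y2 ^+ 2 - (x1 + x2 + x) * (x - x2) ^+ 2) ^+ 2
    - (2%:R * y2) ^+ 2 * y ^+ 2.
  by rewrite /q /e !(hornerD, hornerN, hornerZ, hornerM, horner_exp, hornerC, hornerX); ring: hxy.
by rewrite eB; ring.
Qed.

(** [ec_addA_chord] still asks the first two points to have distinct abscissas. By commutativity the
    first point can be moved to the third place, where [ec_addA_close] removes the single
    exceptional abscissa. *)
Theorem ec_addA P1 P2 P3 : on_ec c P1 -> on_ec c P2 -> on_ec c P3 ->
  ec_add (ec_add P1 P2) P3 = ec_add P1 (ec_add P2 P3).
Proof.
case: P1 => [//|x1 y1] h1; case: P2 => [|x2 y2] h2 h3; first by rewrite ec_add0.
case: P3 h3 => [|x3 y3] h3; first by rewrite !ec_add0.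
have := @ec_addA_close (Affine x3 y3) (Affine x2 y2) [:: x2] h3 h2.
have C P Q : on_ec c P -> on_ec c Q -> ec_add P Q = ec_add Q P by apply: ec_addC.
have D P Q : on_ec c P -> on_ec c Q -> on_ec c (ec_add P Q) by apply: on_ec_add.
have flip P Q R : on_ec c P -> on_ec c Q -> on_ec c R ->
    ec_add (ec_add P Q) R = ec_add R (ec_add Q P).
  by move=> hP hQ hR; rewrite (C _ R) ?(C P) //; apply: D.
move=> /(_ _ x1 y1 h1) h.
rewrite flip // -h.
  by rewrite (C (Affine x3 y3)) // C //; apply: D.
move=> x y hxy; rewrite inE => nx.
have := ec_addA_chord hxy h2 h3 nx; rewrite flip // => ->.
by rewrite C ?(C (Affine x2 y2)) //; apply: D.
Qed.

End Associativity.

(** * The principal homogeneous space [C_f] *)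

(** A record of four entries, so that matrix identities become identities for [ring] and [field]. *)
Record mat2 (R : Type) := Mat2 { m11 : R; m12 : R; m21 : R; m22 : R }.

Definition mat2_map (R S : Type) (f : R -> S) (M : mat2 R) :=
  Mat2 (f (m11 M)) (f (m12 M)) (f (m21 M)) (f (m22 M)).

Section Mat2.
Variable R : comNzRingType.
Implicit Types (M N : mat2 R) (v : 'I_3 -> R).

Definition mat2_one := @Mat2 R 1 0 0 1.
Definition mat2_mul M N :=
  Mat2 (m11 M * m11 N + m12 M * m21 N) (m11 M * m12 N + m12 M * m22 N)
       (m21 M * m11 N + m22 M * m21 N) (m21 M * m12 N + m22 M * m22 N).
Definition mat2_det M := m11 M * m22 M - m12 M * m21 M.

Lemma mat2_mulA M N P : mat2_mul (mat2_mul M N) P = mat2_mul M (mat2_mul N P).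
Proof. by rewrite /mat2_mul /=; congr Mat2; ring. Qed.
Lemma mat2_mul1 M : mat2_mul M mat2_one = M.
Proof. by case: M => *; rewrite /mat2_mul /=; congr Mat2; ring. Qed.
Lemma mat2_1mul M : mat2_mul mat2_one M = M.
Proof. by case: M => *; rewrite /mat2_mul /=; congr Mat2; ring. Qed.

(* On the curve [x^3 = f0(y, z)] with [f0(y, z) = y^2 z - c z^3], [theta N] is the
   isomorphism onto [z^3 = (f0 o N^-1)(x, y)], with inverse [theta_inv N^-1]; [mat2_act M]
   is the automorphism of the former curve given by [M] if [f0 o M = f0]. *)
Definition theta M v := vec3 (m11 M * v 1 + m12 M * v 2%:R) (m21 M * v 1 + m22 M * v 2%:R) (v 0).
Definition theta_inv M v :=
  vec3 (v 2%:R) (m11 M * v 0 + m12 M * v 1) (m21 M * v 0 + m22 M * v 1).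
Definition mat2_act M v :=
  vec3 (v 0) (m11 M * v 1 + m12 M * v 2%:R) (m21 M * v 1 + m22 M * v 2%:R).

Lemma theta_mul M N v : theta (mat2_mul M N) v = theta M (mat2_act N v).
Proof. by rewrite /theta /mat2_act /vec3 /=; congr vec3; ring. Qed.
Lemma theta_inv_mul M N v : theta_inv (mat2_mul M N) v = mat2_act M (theta_inv N v).
Proof. by rewrite /theta_inv /mat2_act /vec3 /=; congr vec3; ring. Qed.
Lemma thetaK M N : mat2_mul N M = mat2_one -> cancel (theta M) (theta_inv N).
Proof.
case: M N => a b c d [a' b' c' d'] [e1 e2 e3 e4] v; apply: boolp.funext; apply: ord3_ind;
  rewrite /theta_inv /theta /vec3 //= !mulrDr !mulrA addrACA -!mulrDl.
- by rewrite e1 e2; ring.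
- by rewrite e3 e4; ring.
Qed.
Lemma theta_invK M N : mat2_mul M N = mat2_one -> cancel (theta_inv N) (theta M).
Proof.
case: M N => a b c d [a' b' c' d'] [e1 e2 e3 e4] v; apply: boolp.funext; apply: ord3_ind;
  rewrite /theta_inv /theta /vec3 //= !mulrDr !mulrA addrACA -!mulrDl.
- by rewrite e1 e2; ring.
- by rewrite e3 e4; ring.
Qed.

Lemma thetaZ M a v : theta M (fun u => a * v u) = fun u => a * theta M v u.
Proof. by apply: boolp.funext; apply: ord3_ind; rewrite /theta /vec3 /=; ring. Qed.
Lemma theta_invZ M a v : theta_inv M (fun u => a * v u) = fun u => a * theta_inv M v u.
Proof. by apply: boolp.funext; apply: ord3_ind; rewrite /theta_inv /vec3 /=; ring. Qed.
Lemma mat2_actZ M a v : mat2_act M (fun u => a * v u) = fun u => a * mat2_act M v u.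
Proof. by apply: boolp.funext; apply: ord3_ind; rewrite /mat2_act /vec3 /=; ring. Qed.

Definition cubic A B C D x y : R :=
  A * x ^+ 3 + 3%:R * B * (x ^+ 2 * y) + 3%:R * C * (x * y ^+ 2) + D * y ^+ 3.

(* The coefficients of [cubic A B C D] composed with [M] are those of [Y^2 Z - c Z^3]. *)
Definition cubic_trivial c A B C D M :=
  let p := m11 M in let q := m12 M in let r := m21 M in let s := m22 M in
  [/\ cubic A B C D p r = 0,
      3%:R * (A * p ^+ 2 * q + B * (p ^+ 2 * s + 2%:R * p * q * r)
              + C * (2%:R * p * r * s + q * r ^+ 2) + D * r ^+ 2 * s) = 1,
      3%:R * (A * p * q ^+ 2 + B * (q ^+ 2 * r + 2%:R * p * q * s)
              + C * (2%:R * q * r * s + p * s ^+ 2) + D * r * s ^+ 2) = 0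
    & cubic A B C D q s = - c].

Lemma cubic_trivialE c A B C D M y z : cubic_trivial c A B C D M ->
  cubic A B C D (m11 M * y + m12 M * z) (m21 M * y + m22 M * z) = y ^+ 2 * z - c * z ^+ 3.
Proof.
case: M => p q r s [/= e1 e2 e3 e4].
transitivity (cubic A B C D p r * y ^+ 3
  + 3%:R * (A * p ^+ 2 * q + B * (p ^+ 2 * s + 2%:R * p * q * r)
              + C * (2%:R * p * r * s + q * r ^+ 2) + D * r ^+ 2 * s) * (y ^+ 2 * z)
  + 3%:R * (A * p * q ^+ 2 + B * (q ^+ 2 * r + 2%:R * p * q * s)
              + C * (2%:R * q * r * s + p * s ^+ 2) + D * r * s ^+ 2) * (y * z ^+ 2)
  + cubic A B C D q s * z ^+ 3); first by rewrite /cubic; ring.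
by rewrite e1 e2 e3 e4; ring.
Qed.

End Mat2.

Section Mat2Morph.
Variables (R S : comNzRingType) (f : {rmorphism R -> S}).

Lemma mat2_map_mul M N : mat2_map f (mat2_mul M N) = mat2_mul (mat2_map f M) (mat2_map f N).
Proof. by rewrite /mat2_map /=; congr Mat2; rewrite rmorphD !rmorphM. Qed.
Lemma mat2_map_one : mat2_map f (mat2_one R) = mat2_one S.
Proof. by rewrite /mat2_map /= rmorph0 rmorph1. Qed.
Lemma theta_morph M v u : f (theta M v u) = theta (mat2_map f M) (fun w => f (v w)) u.
Proof. by move: u; apply: ord3_ind; rewrite /theta /vec3 //= rmorphD !rmorphM. Qed.
Lemma cubic_morph A B C D x y :
  f (cubic A B C D x y) = cubic (f A) (f B) (f C) (f D) (f x) (f y).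
Proof. by rewrite /cubic !(rmorph_nat, rmorphXn, rmorphM, rmorphD). Qed.
Lemma cubic_trivial_morph c A B C D M : cubic_trivial c A B C D M ->
  cubic_trivial (f c) (f A) (f B) (f C) (f D) (mat2_map f M).
Proof.
case=> e1 e2 e3 e4; split => /=; rewrite -?cubic_morph ?e1 ?e4 ?rmorph0 ?rmorphN //.
- by have /(congr1 f) := e2; rewrite !(rmorph1, rmorph_nat, rmorphXn, rmorphM, rmorphD).
- by have /(congr1 f) := e3; rewrite !(rmorph0, rmorph_nat, rmorphXn, rmorphM, rmorphD).
Qed.
End Mat2Morph.

(** For [t = (0, r)] the first column is proportional to [(r, 1)], since the point at infinity
    [(y, z) = (1, 0)] goes to [t]. Trace [-1] and determinant 1 make the matrix of order 3. Points
    of [T] have abscissa 0, so only the ordinate enters. *)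
Definition transl (F : fieldType) (t : ecpoint F) : mat2 F :=
  if t is Affine _ y then Mat2 (- 2%:R^-1) (3%:R * y / 2%:R) (- (2%:R * y)^-1) (- 2%:R^-1)
  else mat2_one F.

Section Translation.
Variables (F : fieldType) (c s : F).
Hypotheses (n2 : 2%:R != 0 :> F) (c0 : c != 0) (hs : s ^+ 2 = c).

Lemma ec_TP t : ec_T s t -> t = Infty \/ exists2 r, t = Affine 0 r & r ^+ 2 = c /\ r != 0.
Proof.
have s0 : s != 0 by apply: contraNneq c0 => e; rewrite -hs e expr0n.
by case=> ->; [left | right; exists s | right; exists (- s); rewrite ?sqrrN ?oppr_eq0].
Qed.

Lemma ec_T_opp t : ec_T s t -> ec_T s (ec_opp t).
Proof. by case=> -> /=; rewrite ?opprK; [constructor 1 | constructor 3 | constructor 2]. Qed.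

Lemma transl_opp t : ec_T s t -> mat2_mul (transl t) (transl (ec_opp t)) = mat2_one F.
Proof.
case/ec_TP => [->|[r -> [_ r0]]] /=; first by rewrite mat2_mul1.
by rewrite /mat2_mul /=; congr Mat2; field; rewrite ?oppr_eq0 ?n2 ?r0 //.
Qed.

Lemma transl_opp' t : ec_T s t -> mat2_mul (transl (ec_opp t)) (transl t) = mat2_one F.
Proof.
move=> ht; have := transl_opp (ec_T_opp ht).
by case: t ht => //= x y _; rewrite opprK.
Qed.

Lemma transl_det t : ec_T s t -> mat2_det (transl t) = 1.
Proof.
case/ec_TP => [->|[r -> [_ r0]]]; rewrite /mat2_det /=; first by ring.
by field; rewrite ?oppr_eq0 ?n2 ?r0 //.
Qed.

Lemma transl_act t P : ec_T s t -> on_ec c P ->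
  exists2 a, a != 0 & mat2_act (transl t) (ec_coords P) = fun u => a * ec_coords (ec_add P t) u.
Proof.
case/ec_TP => [->|[r -> [hr r0]]] hP.
  exists 1; rewrite ?oner_neq0 // ec_add0; apply: boolp.funext; apply: ord3_ind;
  by rewrite /mat2_act /vec3 /=; ring.
case: P hP => [|x y] hP.
  exists (- (2%:R * r)^-1); first by rewrite oppr_eq0 invr_eq0 mulf_neq0.
  by apply: boolp.funext; apply: ord3_ind; rewrite /mat2_act /vec3 /=; field; rewrite ?oppr_eq0 ?n2 ?r0 //.
rewrite /on_ec in hP.
have hr' : r ^+ 2 = 0 ^+ 3 + c by rewrite expr0n add0r.
case: (ec_addP hP hr') => [e1 e2|e1 e2 y0|nx].
- subst x r; rewrite oppr_eq0 in r0.
  exists (- (2%:R * y)); first by rewrite oppr_eq0 mulf_neq0.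
  by apply: boolp.funext; apply: ord3_ind; rewrite /mat2_act /vec3 /=; field; rewrite ?n2 ?oppr_eq0 ?r0.
- subst x r; exists (- 1); first by rewrite oppr_eq0 oner_neq0.
  apply: boolp.funext; apply: ord3_ind; rewrite /mat2_act /vec3 /=; field;
  by rewrite ?oppr_eq0 ?n2 ?r0.
- have yr : y + r != 0.
    apply: contraNneq nx => e; have e' : y = - r by apply/eqP; rewrite -addr_eq0 e.
    have /eqP : x ^+ 3 = 0 by apply: (addIr c); rewrite -hP e' sqrrN hr add0r.
    by rewrite expf_eq0.
  (* The last coordinate of the image, to be compared with the last coordinate 1 of an affine
     sum. *)
  exists (- (y + r) / (2%:R * r)).
    by rewrite mulf_neq0 ?oppr_eq0 // invr_eq0 mulf_neq0.
  apply: boolp.funext; apply: ord3_ind; rewrite /mat2_act /vec3 /=;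
  field: hP hr; rewrite ?oppr_eq0 ?n2 ?r0 ?sub0r ?oppr_eq0 ?nx //.
Qed.

End Translation.

Definition ec_point (K : fieldType) (v : 'I_3 -> K) : ecpoint K :=
  if v 2%:R == 0 then Infty else Affine (v 0 / v 2%:R) (v 1 / v 2%:R).

Lemma ec_point_coords (K : fieldType) (P : ecpoint K) : ec_point (ec_coords P) = P.
Proof.
by case: P => [|x y]; rewrite ec_coordsE /ec_point /vec3 /= ?eqxx // oner_eq0 !divr1.
Qed.

Lemma ec_pointZ (K : fieldType) a (v : 'I_3 -> K) : a != 0 ->
  ec_point (fun u => a * v u) = ec_point v.
Proof.
move=> a0; rewrite /ec_point mulf_eq0 (negbTE a0) /=; case: ifP => // /negbT z0.
by congr Affine; field; rewrite a0 z0.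
Qed.

Section ProjEq.
Variables (K : fieldType) (n : nat).
Implicit Types x y z : 'I_n.+1 -> K.

Lemma proj_eq_refl x : proj_eq x x.
Proof. by exists 1; rewrite ?oner_neq0 // => a; rewrite mul1r. Qed.
Lemma proj_eq_sym x y : proj_eq x y -> proj_eq y x.
Proof.
case=> l l0 e; exists l^-1; first by rewrite invr_eq0.
by move=> a; rewrite e mulKf.
Qed.
Lemma proj_eq_trans y x z : proj_eq x y -> proj_eq y z -> proj_eq x z.
Proof.
case=> l l0 e [l' l0' e']; exists (l' * l); first by rewrite mulf_neq0.
by move=> a; rewrite e' e mulrA.
Qed.
Lemma proj_nz_eq x y : proj_eq x y -> proj_nz x -> proj_nz y.
Proof. by case=> l l0 e [a xa]; exists a; rewrite e mulf_neq0. Qed.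
Lemma proj_eq_scale a x : a != 0 -> proj_eq x (fun u => a * x u).
Proof. by move=> a0; exists a. Qed.
Lemma proj_eq_multiple x y : (exists a, forall u, x u = a * y u) -> proj_nz x -> proj_eq x y.
Proof.
move=> [a e] [u xu]; apply: proj_eq_sym; exists a => //.
by apply: contraNneq xu => a0; rewrite e a0 mul0r.
Qed.
Lemma proj_eqE x y : proj_eq x y -> exists2 l, l != 0 & y = fun u => l * x u.
Proof. by case=> l l0 e; exists l => //; apply: boolp.funext. Qed.

End ProjEq.

Section CurvePoints.
Variables (k K : fieldType) (i : {rmorphism k -> K}) (c : k).

Lemma on_ec_curveP (v : 'I_3 -> K) : on_pvar i (V := ec_curve c) v <->
  proj_nz v /\ v 1 ^+ 2 * v 2%:R = v 0 ^+ 3 + i c * v 2%:R ^+ 3.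
Proof.
have e : mmap i v ('X_1 ^+ 2 * 'X_2%:R - 'X_0 ^+ 3 - c *: 'X_2%:R ^+ 3) =
    v 1 ^+ 2 * v 2%:R - v 0 ^+ 3 - i c * v 2%:R ^+ 3.
  by rewrite !(rmorphB, rmorphM, rmorphXn) /= mmapZ !rmorphXn /= !mmapX !mmap1U.
split=> [[nz h]|[nz h]]; split=> //.
  have := h _ (mem_head _ _); rewrite e => /eqP.
  by rewrite -addrA -opprD subr_eq0 => /eqP.
move=> F; rewrite inE => /eqP ->; rewrite e h; ring.
Qed.

Lemma on_Cf_curveP A B C D (v : 'I_3 -> K) : on_pvar i (V := Cf_curve A B C D) v <->
  proj_nz v /\ v 2%:R ^+ 3 = cubic (i A) (i B) (i C) (i D) (v 0) (v 1).
Proof.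
pose F : {mpoly k[3]} := 'X_2%:R ^+ 3 - (A *: 'X_0 ^+ 3 + (3%:R * B) *: ('X_0 ^+ 2 * 'X_1)
  + (3%:R * C) *: ('X_0 * 'X_1 ^+ 2) + D *: 'X_1 ^+ 3).
have e : mmap i v F = v 2%:R ^+ 3 - cubic (i A) (i B) (i C) (i D) (v 0) (v 1).
  by rewrite !(rmorphB, rmorphD) /= !mmapZ !(rmorphM, rmorphXn) /= !mmapX !mmap1U !rmorph_nat.
split=> [[nz h]|[nz h]]; split=> //.
  by have := h F (mem_head _ _); rewrite e => /eqP; rewrite subr_eq0 => /eqP.
by move=> F'; rewrite inE => /eqP ->; rewrite -/F e h subrr.
Qed.

Lemma ec_coords_on P : on_ec (i c) P -> on_pvar i (V := ec_curve c) (ec_coords P).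
Proof.
move=> hP; apply/on_ec_curveP; split; first exact: ec_coords_neq0.
case: P hP => [|x y] /= h; rewrite /= ?h; ring.
Qed.

Lemma ec_pointP v : on_pvar i (V := ec_curve c) v ->
  on_ec (i c) (ec_point v) /\ exists2 a, a != 0 & v = fun u => a * ec_coords (ec_point v) u.
Proof.
move=> /on_ec_curveP [nz h]; rewrite /ec_point; case: (eqVneq (v 2%:R) 0) => [z0|z0].
  split=> //; have x0 : v 0 = 0.
    move/esym/eqP: h; rewrite z0 mulr0 expr0n mulr0 addr0 expf_eq0 /=.
    by move/eqP.
  have y0 : v 1 != 0.
    apply/eqP => y0; case: nz => a; rewrite [v]vec3E x0 y0 z0 /vec3.
    by case: a => -[|[|[|//]]] /= _; rewrite eqxx.
  exists (v 1) => //; apply: boolp.funext; apply: ord3_ind; rewrite ec_coordsE /vec3 /=.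
  - by rewrite x0 mulr0.
  - by rewrite mulr1.
  - by rewrite z0 mulr0.
split.
  apply: (mulIf (expf_neq0 3 z0)); rewrite mulrDl -[in RHS](mulfVK z0 (v 0)).
  transitivity (v 1 ^+ 2 * v 2%:R); first by field.
  by rewrite h; field.
exists (v 2%:R) => //; apply: boolp.funext; apply: ord3_ind; rewrite ec_coordsE /vec3 /=.
- by field.
- by field.
- by ring.
Qed.

End CurvePoints.

Lemma theta_mmap (k K : fieldType) n (i : {rmorphism k -> K}) (v : 'I_n -> K) (M : mat2 k)
    (F : 'I_3 -> {mpoly k[n]}) u :
  mmap i v (theta (mat2_map (@mpolyC n k) M) F u)
    = theta (mat2_map i M) (fun w => mmap i v (F w)) u.
Proof.
by move: u; apply: ord3_ind; rewrite /theta /vec3 //= rmorphD !rmorphM /= !mmapC.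
Qed.

Lemma theta_inv_mmap (k K : fieldType) n (i : {rmorphism k -> K}) (v : 'I_n -> K) (M : mat2 k)
    (F : 'I_3 -> {mpoly k[n]}) u :
  mmap i v (theta_inv (mat2_map (@mpolyC n k) M) F u)
    = theta_inv (mat2_map i M) (fun w => mmap i v (F w)) u.
Proof.
by move: u; apply: ord3_ind; rewrite /theta_inv /vec3 //= rmorphD !rmorphM /= !mmapC.
Qed.

Lemma ec_law_mmap (k K : fieldType) n (i : {rmorphism k -> K}) (v : 'I_n -> K) c l
    (F G : 'I_3 -> {mpoly k[n]}) u :
  mmap i v (ec_law c%:MP l F G u)
    = ec_law (i c) l (fun w => mmap i v (F w)) (fun w => mmap i v (G w)) u.
Proof. by rewrite (ec_law_morph (mmap i v)) /= mmapC. Qed.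

Section Bihomogeneous.
Variables (k : fieldType) (m n : nat).
Implicit Types F G : {mpoly k[m + n]}.

Lemma bihomogD d e F G : bihomog d e F -> bihomog d e G -> bihomog d e (F + G).
Proof. by move=> hF hG u /msuppD_le; rewrite mem_cat => /orP[/hF|/hG]. Qed.
Lemma bihomogN d e F : bihomog d e F -> bihomog d e (- F).
Proof. by move=> hF u; rewrite (perm_mem (msuppN F)); apply: hF. Qed.
Lemma bihomogM d e d' e' F G :
  bihomog d e F -> bihomog d' e' G -> bihomog (d + d') (e + e') (F * G).
Proof.
move=> hF hG u /msuppM_le /allpairsP [[u1 u2] /= [/hF [<- <-] /hG [<- <-] ->]].
by split; rewrite -big_split /=; apply: eq_bigr => v _; rewrite mnmDE.
Qed.
Lemma bihomogC c : bihomog 0 0 (c%:MP : {mpoly k[m + n]}).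
Proof.
move=> u; rewrite msuppC; case: ifP => // _; rewrite inE => /eqP ->.
by split; apply: big1 => v _; rewrite mnm0E.
Qed.
Lemma bihomog_nat r : bihomog 0 0 (r%:R : {mpoly k[m + n]}).
Proof. by rewrite -(rmorph_nat (@mpolyC _ _)); apply: bihomogC. Qed.
Lemma bihomogXl a : bihomog 1 0 ('X_(lshift n a) : {mpoly k[m + n]}).
Proof.
move=> u /mem_msuppXP <-; split.
  rewrite (bigD1 a) //= mnm1E eqxx big1 // => b nb.
  by rewrite mnm1E (inj_eq (@lshift_inj _ _)) eq_sym (negbTE nb).
by apply: big1 => b _; rewrite mnm1E eq_lrshift.
Qed.
Lemma bihomogXr a : bihomog 0 1 ('X_(rshift m a) : {mpoly k[m + n]}).
Proof.
move=> u /mem_msuppXP <-; split.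
  by apply: big1 => b _; rewrite mnm1E eq_rlshift.
rewrite (bigD1 a) //= mnm1E eqxx big1 // => b nb.
by rewrite mnm1E (inj_eq (@rshift_inj _ _)) eq_sym (negbTE nb).
Qed.
Lemma bihomogCM c d e F : bihomog d e F -> bihomog d e (c%:MP * F).
Proof. by apply: (bihomogM (@bihomogC c)). Qed.

Lemma theta_bihomog M d e (F : 'I_3 -> {mpoly k[m + n]}) u :
  (forall v, bihomog d e (F v)) -> bihomog d e (theta (mat2_map (@mpolyC _ k) M) F u).
Proof.
move=> hF; move: u; apply: ord3_ind; rewrite /theta /vec3 /=;
  by [apply: bihomogD; apply: bihomogCM | apply: hF].
Qed.
Lemma theta_inv_bihomog M d e (F : 'I_3 -> {mpoly k[m + n]}) u :
  (forall v, bihomog d e (F v)) -> bihomog d e (theta_inv (mat2_map (@mpolyC _ k) M) F u).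
Proof.
move=> hF; move: u; apply: ord3_ind; rewrite /theta_inv /vec3 /=;
  by [apply: bihomogD; apply: bihomogCM | apply: hF].
Qed.

Lemma ec_law_bihomog c l d e d' e' (F G : 'I_3 -> {mpoly k[m + n]}) u :
  (forall v, bihomog d e (F v)) -> (forall v, bihomog d' e' (G v)) ->
  bihomog ((d + d') + (d + d')) ((e + e') + (e + e')) (ec_law c%:MP l F G u).
Proof.
move=> hF hG.
have hFG a b : bihomog (d + d') (e + e') (F a * G b) by apply: bihomogM.
have hGF a b : bihomog (d + d') (e + e') (G a * F b).
  by rewrite mulrC; apply: bihomogM.
have hr r (x : {mpoly k[m + n]}) : bihomog (d + d') (e + e') x -> bihomog (d + d') (e + e') (r%:R * x).
  by move=> hx; have := bihomogM (@bihomog_nat r) hx; rewrite !add0n.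
have hrc r (x : {mpoly k[m + n]}) : bihomog (d + d') (e + e') x -> bihomog (d + d') (e + e') (r%:R * c%:MP * x).
  by move=> hx; rewrite -mulrA; apply: hr; apply: bihomogCM.
have hD := @bihomogD (d + d') (e + e'); have hN := @bihomogN (d + d') (e + e').
have hM x y := @bihomogM (d + d') (e + e') (d + d') (e + e') x y.
have hD' := @bihomogD ((d + d') + (d + d')) ((e + e') + (e + e')).
have hN' := @bihomogN ((d + d') + (d + d')) ((e + e') + (e + e')).
(* The two bidegrees are abstracted to [B2] and [B4], so that the loop below recognizes from the
   goal whether a product is to be split into factors of half the bidegree. *)
move: (@bihomog k m n (d + d') (e + e')) hFG hGF hr hrc hD hN hM hD' hN' => B2.
move: (@bihomog k m n ((d + d') + (d + d')) ((e + e') + (e + e'))) => B4.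
move=> hFG hGF hr hrc hD hN hM hD' hN'.
move: u; apply: ord3_ind; case: l; rewrite /ec_law /vec3 /=;
repeat match goal with
| |- B4 (_ + _) => apply hD'
| |- B4 (- _) => apply hN'
| |- B4 (_ * _) => apply hM
| |- B2 (_ + _) => apply hD
| |- B2 (- _) => apply hN
| |- B2 (F _ * G _) => apply hFG
| |- B2 (G _ * F _) => apply hGF
| |- B2 (_%:R * c%:MP * _) => apply hrc
| |- B2 (_%:R * _) => apply hr
end.
Qed.

End Bihomogeneous.

(** * Descent of morphisms given by forms over the separable closure *)

Section MorphismDescent.
Variables (k ks K : fieldType) (i : {rmorphism k -> ks}) (j : {rmorphism ks -> K}).
Hypothesis hks : separable_closure i.

(** One tuple over [ks] per point is enough when all its conjugates represent [phi]: some rational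
    combination of the conjugates is still nonzero at that point. *)
Lemma morphism_descent (V W : pvar k) (phi : pcoords V K -> pcoords W K) :
  (forall p, on_pvar (rcomp j i) p -> on_pvar (rcomp j i) (phi p)) ->
  (forall p, on_pvar (rcomp j i) p ->
    exists d (F : 'I_(pdim W).+1 -> {mpoly ks[(pdim V).+1]}),
    [/\ forall b, F b \is d.-homog, proj_nz (fun b => mmap j p (F b))
      & forall (s : gal i) q, on_pvar (rcomp j i) q ->
        exists a, forall b, mmap j q (map_mpoly s (F b)) = a * phi q b]) ->
  morphism (rcomp j i) phi.
Proof.
move=> hon h p hp; split; first exact: hon.
have [d [F [Fh Fp Fs]]] := h p hp.
have [|G [G1 G2 G3]] := @forms_descent _ _ _ i j hks _ _ (fun u => mdeg u = d)
  (fun v => on_pvar (rcomp j i) v) phi F p _ Fs Fp.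
  by move=> b u; move/dhomogP: (Fh b) => /[apply].
exists d, G; split=> //.
  by move=> b; apply/dhomogP => u; apply: G1.
by move=> q hq; apply: proj_eq_multiple; apply: G3.
Qed.

Lemma morphism2_descent (U V W : pvar k) (mu : pcoords U K -> pcoords V K -> pcoords W K) :
  (forall p q, on_pvar (rcomp j i) p -> on_pvar (rcomp j i) q -> on_pvar (rcomp j i) (mu p q)) ->
  (forall p q, on_pvar (rcomp j i) p -> on_pvar (rcomp j i) q ->
    exists d e (F : 'I_(pdim W).+1 -> {mpoly ks[(pdim U).+1 + (pdim V).+1]}),
    [/\ forall b, bihomog d e (F b), proj_nz (fun b => mmap j (cat_coords p q) (F b))
      & forall (s : gal i) p' q', on_pvar (rcomp j i) p' -> on_pvar (rcomp j i) q' ->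
        exists a, forall b, mmap j (cat_coords p' q') (map_mpoly s (F b)) = a * mu p' q' b]) ->
  morphism2 (rcomp j i) mu.
Proof.
move=> hon h p q hp hq; split; first exact: hon.
have [d [e [F [Fh Fp Fs]]]] := h p q hp hq.
pose l (v : 'I_((pdim U).+1 + (pdim V).+1) -> K) a := v (lshift (pdim V).+1 a).
pose r (v : 'I_((pdim U).+1 + (pdim V).+1) -> K) a := v (rshift (pdim U).+1 a).
have lE p' q' : l (cat_coords p' q') = p'.
  by apply: boolp.funext => a; rewrite /l cat_lshift.
have rE p' q' : r (cat_coords p' q') = q'.
  by apply: boolp.funext => a; rewrite /r cat_rshift.
have lrE v : cat_coords (l v) (r v) = v.
  by apply: boolp.funext => a; rewrite /cat_coords -[in RHS](splitK a); case: split.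
have [|G [G1 G2 G3]] := @forms_descent _ _ _ i j hks _ _
  (fun u => (\sum_(a < (pdim U).+1) u (lshift _ a))%N = d /\ (\sum_(a < (pdim V).+1) u (rshift _ a))%N = e)
  (fun v => on_pvar (rcomp j i) (V := U) (l v) /\ on_pvar (rcomp j i) (V := V) (r v))
  (fun v => mu (l v) (r v)) F (cat_coords p q) Fh _ Fp.
  by move=> s v [hl hr]; have [a ha] := Fs s _ _ hl hr; exists a; rewrite -[X in mmap _ X](lrE v).
exists d, e, G; split=> // p' q' hp' hq'; apply: proj_eq_multiple.
by have := G3 (cat_coords p' q'); rewrite lE rE; apply.
Qed.

End MorphismDescent.

Section ECGroup.
Variables (K : fieldType) (c : K).
Hypotheses (hK : GRing.closed_field_axiom K).
Hypotheses (n2 : 2%:R != 0 :> K) (n3 : 3%:R != 0 :> K) (c0 : c != 0).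
Implicit Types P Q t : ecpoint K.

Let A P1 P2 P3 : on_ec c P1 -> on_ec c P2 -> on_ec c P3 ->
  ec_add (ec_add P1 P2) P3 = ec_add P1 (ec_add P2 P3).
Proof. exact: ec_addA. Qed.
Let C P Q : on_ec c P -> on_ec c Q -> ec_add P Q = ec_add Q P.
Proof. exact: ec_addC. Qed.
Let S P Q : on_ec c P -> on_ec c Q -> on_ec c (ec_add P Q).
Proof. exact: on_ec_add. Qed.
Let O P : on_ec c P -> on_ec c (ec_opp P).
Proof. exact: on_ec_opp. Qed.

Lemma ec_oppK P : ec_opp (ec_opp P) = P.
Proof. by case: P => //= x y; rewrite opprK. Qed.

Lemma ec_addK P Q : on_ec c P -> on_ec c Q -> ec_add (ec_add P Q) (ec_opp Q) = P.
Proof. by move=> hP hQ; rewrite A ?ec_addN ?ec_add0 //; apply: O. Qed.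
Lemma ec_subK P Q : on_ec c P -> on_ec c Q -> ec_add (ec_add P (ec_opp Q)) Q = P.
Proof. by move=> hP hQ; rewrite -{2}[Q]ec_oppK ec_addK //; apply: O. Qed.
Lemma ec_addsubK P Q : on_ec c P -> on_ec c Q -> ec_add P (ec_add Q (ec_opp P)) = Q.
Proof. by move=> hP hQ; rewrite C ?ec_subK //; apply: S => //; apply: O. Qed.
Lemma ec_addI P Q R : on_ec c P -> on_ec c Q -> on_ec c R -> ec_add P Q = ec_add P R -> Q = R.
Proof.
move=> hP hQ hR e; rewrite -[Q](ec_addK hQ hP) -[R](ec_addK hR hP).
by rewrite (C hQ) // (C hR) // e.
Qed.
Lemma ec_opp_add P Q : on_ec c P -> on_ec c Q -> ec_opp (ec_add P Q) = ec_add (ec_opp P) (ec_opp Q).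
Proof.
move=> hP hQ; have hPQ := S hP hQ; have hP' := O hP; have hQ' := O hQ.
apply: (ec_addI hPQ); [exact: O | exact: S |].
by rewrite ec_addN (C hP') // -A // ec_addK // ec_addN.
Qed.

(** Conjugation changes the identification of the twisted curve with [E] by a translation; this
    identity and the next say that the action and the difference map do not notice it. *)
Lemma ec_translate t P Q : on_ec c t -> on_ec c P -> on_ec c Q ->
  ec_add (ec_add (ec_add P (ec_opp t)) Q) t = ec_add P Q.
Proof.
move=> ht hP hQ; have ht' := O ht.
by rewrite A ?(C hQ) // -1?A ?ec_subK //; do ?apply: S.
Qed.

Lemma ec_sub_translate t P Q : on_ec c t -> on_ec c P -> on_ec c Q ->
  ec_add (ec_add Q (ec_opp t)) (ec_opp (ec_add P (ec_opp t))) = ec_add Q (ec_opp P).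
Proof.
move=> ht hP hQ; have ht' := O ht; have hP' := O hP.
by rewrite ec_opp_add // ec_oppK (C hP') // -A ?ec_subK //; do ?apply: S.
Qed.

End ECGroup.

(** * Irreducibility of the curve and smoothness of the cubics *)

Lemma meval_comp (K : fieldType) m n (G : {mpoly K[m]}) (q : 'I_m -> {mpoly K[n]}) v :
  (mmap (@mpolyC n K) q G).@[v] = G.@[fun u => (q u).@[v]].
Proof.
rewrite (rmorph_mmap _ (meval v)) /meval /mmap; apply: eq_bigr => u _.
by rewrite /= -/(meval v _) mevalC.
Qed.

Lemma mderivXU (R : comNzRingType) n (a b : 'I_n) : mderiv b ('X_a : {mpoly R[n]}) = (a == b)%:R.
Proof.
rewrite mderivX mnm1E; case: eqVneq => [->|_]; last by rewrite scale0r.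
by rewrite scale1r -[X in (X - _)%MM]add0m addmK mpolyX0.
Qed.

Section Irreducible.
Variables (K : fieldType) (c : K).
Hypotheses (hK : GRing.closed_field_axiom K).
Hypotheses (n2 : 2%:R != 0 :> K) (c0 : c != 0).

Definition homogeneous_eval d (G : {mpoly K[3]}) := forall a v, G.@[fun u => a * v u] = a ^+ d * G.@[v].

(* Translating by the point [(0, s)] moves the point at infinity to an affine point. *)
Lemma ec_vanish_infty d G : homogeneous_eval d G ->
  (forall x y, y ^+ 2 = x ^+ 3 + c -> G.@[vec3 x y 1] = 0) ->
  G.@[ec_coords Infty] = 0.
Proof.
move=> hG h; have [s hs] := closed_sqrt hK c.
have ht : ec_T s (Affine 0 s) by constructor 2.
pose G' := mmap (@mpolyC 3 K)
  (mat2_act (mat2_map (@mpolyC 3 K) (transl (Affine 0 s))) (fun u => 'X_u)) G.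
have G'E v : G'.@[v] = G.@[mat2_act (transl (Affine 0 s)) v].
  rewrite meval_comp; congr meval; apply: boolp.funext; apply: ord3_ind;
  by rewrite /mat2_act [vec3 _ _ _]lock /= -lock /vec3 /= ?mevalD ?mevalM ?mevalC ?mevalXU.
have hs' : (- s) ^+ 2 = 0 ^+ 3 + c by rewrite sqrrN hs expr0n add0r.
have : G'.@[vec3 0 (- s) 1] = 0.
  apply: (ec_finite_exceptions hK (s := [:: 0])) hs' => x y hxy; rewrite inE => x0.
  have [a _ e] := transl_act n2 c0 hs ht (P := Affine x y) hxy.
  rewrite G'E -[vec3 x y 1]/(ec_coords (Affine x y)) e hG.
  have on := on_ec_add n2 (P := Affine x y) (Q := Affine 0 s) hxy (ec_T_on_ec hs ht).
  move: on; rewrite /ec_add (negbTE x0) /= => /h.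
  by rewrite /vec3 => ->; rewrite mulr0.
rewrite G'E -[vec3 0 (- s) 1]/(ec_coords (Affine 0 (- s))).
have [a a0 ->] := transl_act n2 c0 hs ht (P := Affine 0 (- s)) hs'.
rewrite hG /= !eqxx /= => /eqP.
by rewrite mulf_eq0 (negbTE (expf_neq0 d a0)) => /eqP.
Qed.

(** The affine part is irreducible by [ec_prime], and a form vanishing on it also vanishes at
    infinity by [ec_vanish_infty]. *)
Lemma ec_irreducible d e G H : homogeneous_eval d G -> homogeneous_eval e H ->
  (forall P, on_ec c P -> G.@[ec_coords P] * H.@[ec_coords P] = 0) ->
  (forall P, on_ec c P -> G.@[ec_coords P] = 0) \/ (forall P, on_ec c P -> H.@[ec_coords P] = 0).
Proof.
move=> hG hH h.
have [a [b eG]] := affine_fun_mpoly c G; have [a' [b' eH]] := affine_fun_mpoly c H.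
have key d' F p q : homogeneous_eval d' F -> affine_fun c (fun x y => F.@[vec3 x y 1]) p q ->
    p = 0 -> q = 0 -> forall P, on_ec c P -> F.@[ec_coords P] = 0.
  move=> hF eF p0 q0.
  have aff x y : y ^+ 2 = x ^+ 3 + c -> F.@[vec3 x y 1] = 0.
    by move=> hxy; rewrite eF // p0 q0 !horner0 mul0r addr0.
  by case=> [_|x y hxy]; [apply: ec_vanish_infty hF aff | apply: aff].
have [|[a0 b0]|[a0 b0]] := @ec_prime _ hK c a b a' b'.
- by move=> x y hxy; rewrite -eG // -eH //; apply: (h (Affine x y)).
- by left; apply: key hG eG a0 b0.
- by right; apply: key hH eH a0 b0.
Qed.

End Irreducible.

Section Smooth.
Variables (k K : fieldType) (i : {rmorphism k -> K}).
Hypotheses (n2 : 2%:R != 0 :> k) (n3 : 3%:R != 0 :> k).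
Variables A B C D : k.
Hypothesis disc0 : disc_f A B C D != 0.

(** The two quadratics are the partial derivatives of the cubic divided by 3, and their resultant is
    four times the discriminant. The identities for [ex] and [ey] write the resultant times [x ^+ 3]
    and [y ^+ 3] as combinations of the two quadratics; the local [S] is twice that of [disc_f]. *)
Lemma cubic_no_double_root (x y : K) :
  i A * x ^+ 2 + 2%:R * i B * (x * y) + i C * y ^+ 2 = 0 ->
  i B * x ^+ 2 + 2%:R * i C * (x * y) + i D * y ^+ 2 = 0 -> x = 0 /\ y = 0.
Proof.
set q1 := (X in X = 0 -> _); set q2 := (X in _ -> X = 0 -> _) => e1 e2.
have m2 : 2%:R != 0 :> K by rewrite -(rmorph_nat i) fmorph_eq0.
have res : i ((A * D - B * C) ^+ 2 - 4%:R * (A * C - B ^+ 2) * (B * D - C ^+ 2)) != 0.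
  rewrite fmorph_eq0; apply: contraNneq disc0 => e.
  rewrite /disc_f -(mulrI_eq0 _ (mulfI (mulf_neq0 n2 n2))) -e; apply/eqP.
  by field.
pose a := i A; pose b := i B; pose c := i C; pose d := i D.
pose S := a * d - b * c; pose R := a * c - b ^+ 2; pose T := b * d - c ^+ 2.
have resE : i ((A * D - B * C) ^+ 2 - 4%:R * (A * C - B ^+ 2) * (B * D - C ^+ 2))
    = S ^+ 2 - 4%:R * R * T.
  by rewrite !(rmorph_nat, rmorphXn, rmorphB, rmorphM).
rewrite resE in res.
have ex : (S ^+ 2 - 4%:R * R * T) * x ^+ 3 = 0.
  transitivity (((S * d - 4%:R * T * c) * x - 2%:R * T * d * y) * q1
    + ((4%:R * T * b - S * c) * x + 2%:R * T * c * y) * q2).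
    by rewrite /q1 /q2 /S /R /T /a /b /c /d; ring.
  by rewrite e1 e2 !mulr0 addr0.
have ey : (S ^+ 2 - 4%:R * R * T) * y ^+ 3 = 0.
  transitivity (((S * a - 4%:R * R * b) * y - 2%:R * R * a * x) * q2
    + ((4%:R * R * c - S * b) * y + 2%:R * R * b * x) * q1).
    by rewrite /q1 /q2 /S /R /T /a /b /c /d; ring.
  by rewrite e1 e2 !mulr0 addr0.
split; apply/eqP; [move/eqP: ex | move/eqP: ey];
  by rewrite mulf_eq0 (negbTE res) expf_eq0.
Qed.

Let F : {mpoly k[3]} := 'X_2%:R ^+ 3 - (A *: 'X_0 ^+ 3 + (3%:R * B) *: ('X_0 ^+ 2 * 'X_1)
  + (3%:R * C) *: ('X_0 * 'X_1 ^+ 2) + D *: 'X_1 ^+ 3).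

Lemma Cf_equation_homog : F \is 3.-homog.
Proof.
have hX (a : 'I_3) : ('X_a : {mpoly k[3]}) \is 1.-homog by rewrite dhomogX /= mdeg1.
have h3 (a b e : 'I_3) : ('X_a * ('X_b * 'X_e) : {mpoly k[3]}) \is 3.-homog.
  by apply: (dhomogM (hX a) (dhomogM (hX b) (hX e))).
rewrite /F !exprS !expr0 !mulr1 -!mulrA.
by rewrite dhomogD ?dhomogN // ?dhomogD ?dhomogZ.
Qed.

Lemma Cf_gradient (w : 'I_3 -> K) b : mmap i w (mderiv b F) =
  vec3 (- (3%:R * (i A * w 0 ^+ 2 + 2%:R * i B * (w 0 * w 1) + i C * w 1 ^+ 2)))
       (- (3%:R * (i B * w 0 ^+ 2 + 2%:R * i C * (w 0 * w 1) + i D * w 1 ^+ 2)))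
       (3%:R * w 2%:R ^+ 2) b.
Proof.
rewrite /F !exprS !expr0 !mulr1.
rewrite !(mderivB, mderivD, mderivZ, mderivM, mderivXU).
rewrite !(rmorphB, rmorphD) /= !mmapZ !(rmorphD, rmorphM) /= !mmapX !mmap1U.
by move: b; apply: ord3_ind; rewrite /vec3 /= !rmorph_nat; ring.
Qed.

Lemma Cf_jacobian (w : 'I_3 -> K) : on_pvar i (V := Cf_curve A B C D) w ->
  (\rank (\matrix_(a < 1, b < 3) mmap i w (mderiv b [:: F]`_a))).+1 = 2%N.
Proof.
move=> /on_Cf_curveP [[u nz] e]; congr S; rewrite rank_rV.
case: eqP => // /matrixP h.
have g b : vec3 (- (3%:R * (i A * w 0 ^+ 2 + 2%:R * i B * (w 0 * w 1) + i C * w 1 ^+ 2)))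
       (- (3%:R * (i B * w 0 ^+ 2 + 2%:R * i C * (w 0 * w 1) + i D * w 1 ^+ 2)))
       (3%:R * w 2%:R ^+ 2) b = 0.
  by rewrite -Cf_gradient; have := h 0 b; rewrite !mxE.
have m3 : 3%:R != 0 :> K by rewrite -(rmorph_nat i) fmorph_eq0.
have := g 2%:R; have := g 1; have := g 0; rewrite /vec3 /=.
move=> /eqP; rewrite oppr_eq0 mulf_eq0 (negbTE m3) => /eqP g0.
move=> /eqP; rewrite oppr_eq0 mulf_eq0 (negbTE m3) => /eqP g1.
move=> /eqP; rewrite mulf_eq0 (negbTE m3) expf_eq0 => /eqP g2.
have [x0 y0] := cubic_no_double_root g0 g1.
by case/eqP: nz; rewrite [w]vec3E x0 y0 g2 /vec3; case: u => -[|[|[|//]]].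
Qed.

End Smooth.

Definition ec_neg (R : nzRingType) (v : 'I_3 -> R) : 'I_3 -> R := vec3 (v 0) (- v 1) (v 2%:R).

Lemma ec_neg_coords (F : fieldType) (P : ecpoint F) :
  exists2 a, a != 0 & ec_neg (ec_coords P) = fun u => a * ec_coords (ec_opp P) u.
Proof.
case: P => [|x y].
  exists (- 1); first by rewrite oppr_eq0 oner_neq0.
  by apply: boolp.funext; apply: ord3_ind; rewrite /ec_neg /vec3 /=; ring.
exists 1; first by rewrite oner_neq0.
by apply: boolp.funext; apply: ord3_ind; rewrite /ec_neg /vec3 /=; ring.
Qed.

Lemma ec_negZ (R : comNzRingType) a (v : 'I_3 -> R) :
  ec_neg (fun u => a * v u) = fun u => a * ec_neg v u.
Proof. by apply: boolp.funext; apply: ord3_ind; rewrite /ec_neg /vec3 /=; ring. Qed.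

Lemma map_transl (F G : fieldType) (f : {rmorphism F -> G}) t :
  mat2_map f (transl t) = transl (ec_map f t).
Proof.
case: t => [|x y]; rewrite /mat2_map /=; first by rewrite rmorph0 rmorph1.
by congr Mat2; rewrite ?rmorphN ?fmorph_div ?fmorphV ?rmorphM ?rmorph_nat.
Qed.

(** * The twisted cubic and its action over the base field *)

Section TwistedCubic.
Variables (k ks K : fieldType) (i : {rmorphism k -> ks}) (j : {rmorphism ks -> K}).
Hypotheses (hks : separable_closure i) (hK : GRing.closed_field_axiom K).
Hypotheses (n2 : 2%:R != 0 :> k) (n3 : 3%:R != 0 :> k).
Variables (c : k) (c0 : c != 0) (sqrtc : ks) (hsqrtc : sqrtc ^+ 2 = i c).
Variables (A B C D : k) (N N' : mat2 ks).
Hypotheses (NN' : mat2_mul N N' = mat2_one ks) (N'N : mat2_mul N' N = mat2_one ks).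
Hypothesis htriv : cubic_trivial (i c) (i A) (i B) (i C) (i D) N.
Hypothesis twist : forall s : gal i,
  exists2 t, ec_T sqrtc t & mat2_map s N = mat2_mul N (transl t).

Let ji := rcomp j i.
Let cK := ji c.
Let M := mat2_map j N.
Let M' := mat2_map j N'.
Let V := Cf_curve A B C D.
Let E := ec_curve c.

Let m2 : 2%:R != 0 :> K. Proof. by rewrite -(rmorph_nat ji) fmorph_eq0. Qed.
Let m3 : 3%:R != 0 :> K. Proof. by rewrite -(rmorph_nat ji) fmorph_eq0. Qed.
Let cK0 : cK != 0. Proof. by rewrite fmorph_eq0. Qed.
Let MM' : mat2_mul M M' = mat2_one K.
Proof. by rewrite -mat2_map_mul NN' mat2_map_one. Qed.
Let M'M : mat2_mul M' M = mat2_one K.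
Proof. by rewrite -mat2_map_mul N'N mat2_map_one. Qed.
Let trivK : cubic_trivial cK (ji A) (ji B) (ji C) (ji D) M.
Proof. exact: (cubic_trivial_morph j htriv). Qed.
Let hsK : (j sqrtc) ^+ 2 = cK.
Proof. by rewrite -rmorphXn hsqrtc. Qed.

Lemma ec_T_map t : ec_T sqrtc t -> ec_T (j sqrtc) (ec_map j t).
Proof.
by case=> -> /=; rewrite ?rmorph0 ?rmorphN; [constructor 1 | constructor 2 | constructor 3].
Qed.

Let T_on t : ec_T sqrtc t -> on_ec cK (ec_map j t).
Proof. by move/ec_T_map; apply: ec_T_on_ec. Qed.

Lemma Cf_theta v : on_pvar ji (V := E) v <-> on_pvar ji (V := V) (theta M v).
Proof.
rewrite on_ec_curveP on_Cf_curveP -[theta M v 2%:R]/(v 0).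
rewrite -[theta M v 0]/(m11 M * v 1 + m12 M * v 2%:R) -[theta M v 1]/(m21 M * v 1 + m22 M * v 2%:R).
rewrite (cubic_trivialE _ _ trivK).
have -> : proj_nz (theta M v) <-> proj_nz v.
  split=> -[u nz]; apply: boolp.contrapT => h.
    case/eqP: nz; have -> : v = fun w => 0 * v w.
      apply: boolp.funext => w; rewrite mul0r; apply/eqP.
      by apply: contraT => nw; case: h; exists w.
    by rewrite thetaZ mul0r.
  case/eqP: nz; rewrite -[v](thetaK M'M).
  have -> : theta M v = fun w => 0 * theta M v w.
    apply: boolp.funext => w; rewrite mul0r; apply/eqP.
    by apply: contraT => nw; case: h; exists w.
  by rewrite theta_invZ mul0r.
split=> -[nz e]; split=> //.
  by move: e => ->; ring.
by apply/eqP; rewrite -subr_eq e.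
Qed.

Definition Cf_point (w : 'I_3 -> K) : ecpoint K := ec_point (theta_inv M' w).

Lemma Cf_pointP w : on_pvar ji (V := V) w ->
  on_ec cK (Cf_point w) /\ exists2 a, a != 0 & w = fun u => a * theta M (ec_coords (Cf_point w)) u.
Proof.
rewrite -{1}[w](theta_invK MM') -Cf_theta => /ec_pointP [h [a a0 e]]; split=> //.
by exists a => //; rewrite -{1}[w](theta_invK MM') e thetaZ.
Qed.

Lemma Cf_point_theta P : Cf_point (theta M (ec_coords P)) = P.
Proof. by rewrite /Cf_point (thetaK M'M) ec_point_coords. Qed.

Lemma Cf_point_eq w w' : proj_eq w w' -> Cf_point w = Cf_point w'.
Proof. by case/proj_eqE => l l0 ->; rewrite /Cf_point theta_invZ ec_pointZ. Qed.

Lemma theta_on P : on_ec cK P -> on_pvar ji (V := V) (theta M (ec_coords P)).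
Proof. by move=> hP; apply/Cf_theta; apply: ec_coords_on. Qed.

Definition Cf_mu (p : pcoords V K) (q : pcoords E K) : pcoords V K :=
  theta M (ec_coords (ec_add (Cf_point p) (ec_point q))).
Definition Cf_nu (p q : pcoords V K) : pcoords E K :=
  ec_coords (ec_add (Cf_point q) (ec_opp (Cf_point p))).

Lemma twist_inv (s : gal i) t : ec_T sqrtc t -> mat2_map s N = mat2_mul N (transl t) ->
  mat2_map s N' = mat2_mul (transl (ec_opp t)) N'.
Proof.
move=> ht e.
have e1 : mat2_mul (mat2_map s N') (mat2_mul N (transl t)) = mat2_one ks.
  by rewrite -e -mat2_map_mul N'N mat2_map_one.
rewrite -[LHS]mat2_mul1 -NN' -[in X in mat2_mul _ X](mat2_mul1 N).
have n2' : 2%:R != 0 :> ks by rewrite -(rmorph_nat i) fmorph_eq0.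
have ic0 : i c != 0 by rewrite fmorph_eq0.
rewrite -(transl_opp n2' ic0 hsqrtc ht) -!mat2_mulA.
by rewrite (mat2_mulA (mat2_map s N')) e1 mat2_1mul.
Qed.

(** The matrix is the conjugate of [M'] under an automorphism with [s(N) = N M_t]: the conjugate
    chart sends [p] to [Cf_point p - t]. *)
Let tw_theta_inv t p : ec_T sqrtc t -> on_pvar ji (V := V) p ->
  exists a, theta_inv (mat2_map j (mat2_mul (transl (ec_opp t)) N')) p =
    fun u => a * ec_coords (ec_add (Cf_point p) (ec_opp (ec_map j t))) u.
Proof.
move=> ht hp; have [hP [a a0 pE]] := Cf_pointP hp.
have e : ec_map j (ec_opp t) = ec_opp (ec_map j t) by case: (t) => //= x y; rewrite rmorphN.
rewrite mat2_map_mul map_transl e theta_inv_mul {1}pE theta_invZ (thetaK M'M) mat2_actZ.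
have [b b0 ->] := transl_act m2 cK0 hsK (ec_T_opp (ec_T_map ht)) hP.
by exists (a * b); apply: boolp.funext => u; rewrite mulrA.
Qed.

Let lawZ l a P b Q : on_ec cK P -> on_ec cK Q ->
  exists d, ec_law cK l (fun u => a * ec_coords P u) (fun u => b * ec_coords Q u)
    = fun u => d * ec_coords (ec_add P Q) u.
Proof.
move=> hP hQ; have [lam [h _]] := ec_law_ok m2 m3 cK0 hP hQ.
by exists ((a * b) ^+ 2 * lam l); apply: boolp.funext => u; rewrite ec_law_scale h mulrA.
Qed.

(** With [P] and [Q] the points of [E] attached to [p] and [q], the conjugate formula computes
    [((P - t) + Q) + t = P + Q]. *)
Lemma mu_formula l p q t : ec_T sqrtc t -> on_pvar ji (V := V) p -> on_pvar ji (V := E) q ->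
  exists a, forall u,
    theta (mat2_map j (mat2_mul N (transl t)))
      (ec_law cK l (theta_inv (mat2_map j (mat2_mul (transl (ec_opp t)) N')) p) q) u
    = a * Cf_mu p q u.
Proof.
move=> ht hp hq; have [hP _] := Cf_pointP hp; have [hQ [b b0 qE]] := ec_pointP hq.
have [a ->] := tw_theta_inv ht hp; have hT := T_on ht.
have hPT : on_ec cK (ec_add (Cf_point p) (ec_opp (ec_map j t))).
  by apply: on_ec_add => //; apply: on_ec_opp.
rewrite {1}qE; have [d ->] := lawZ l a b hPT hQ.
rewrite mat2_map_mul map_transl theta_mul mat2_actZ thetaZ.
have [e e0 ->] := transl_act m2 cK0 hsK (ec_T_map ht) (on_ec_add m2 hPT hQ).
rewrite thetaZ (ec_translate hK m2 m3 cK0 hT hP hQ).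
by exists (d * e) => u; rewrite -mulrA.
Qed.

(** Here the two shifts cancel: [(Q - t) - (P - t) = Q - P]. *)
Lemma nu_formula l p q t : ec_T sqrtc t -> on_pvar ji (V := V) p -> on_pvar ji (V := V) q ->
  exists a, forall u,
    ec_law cK l (theta_inv (mat2_map j (mat2_mul (transl (ec_opp t)) N')) q)
      (ec_neg (theta_inv (mat2_map j (mat2_mul (transl (ec_opp t)) N')) p)) u
    = a * Cf_nu p q u.
Proof.
move=> ht hp hq; have [hP _] := Cf_pointP hp; have [hQ _] := Cf_pointP hq.
have [a ->] := tw_theta_inv ht hp; have [b ->] := tw_theta_inv ht hq; have hT := T_on ht.
have hPT : on_ec cK (ec_add (Cf_point p) (ec_opp (ec_map j t))).
  by apply: on_ec_add => //; apply: on_ec_opp.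
have hQT : on_ec cK (ec_add (Cf_point q) (ec_opp (ec_map j t))).
  by apply: on_ec_add => //; apply: on_ec_opp.
rewrite ec_negZ; have [e e0 ->] := ec_neg_coords (ec_add (Cf_point p) (ec_opp (ec_map j t))).
have -> : (fun u => a * (e * ec_coords (ec_opp (ec_add (Cf_point p) (ec_opp (ec_map j t)))) u))
  = fun u => (a * e) * ec_coords (ec_opp (ec_add (Cf_point p) (ec_opp (ec_map j t)))) u.
  by apply: boolp.funext => u; rewrite mulrA.
have [d ->] := lawZ l b (a * e) hQT (on_ec_opp hPT).
by exists d => u; rewrite (ec_sub_translate hK m2 m3 cK0 hT hP hQ).
Qed.

Definition mu_form l u : {mpoly ks[3 + 3]} :=
  theta (mat2_map (@mpolyC _ ks) N)
    (ec_law (i c)%:MP l (theta_inv (mat2_map (@mpolyC _ ks) N') (fun a => 'X_(lshift 3 a)))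
       (fun a => 'X_(rshift 3 a))) u.

Definition nu_form l u : {mpoly ks[3 + 3]} :=
  ec_law (i c)%:MP l (theta_inv (mat2_map (@mpolyC _ ks) N') (fun a => 'X_(rshift 3 a)))
    (ec_neg (theta_inv (mat2_map (@mpolyC _ ks) N') (fun a => 'X_(lshift 3 a)))) u.

Let mmapXl (f : {rmorphism ks -> K}) p q :
  (fun w => mmap f (cat_coords p q) ('X_(lshift 3 w) : {mpoly ks[3 + 3]})) = p :> ('I_3 -> K).
Proof. by apply: boolp.funext => w; rewrite mmapX mmap1U cat_lshift. Qed.
Let mmapXr (f : {rmorphism ks -> K}) p q :
  (fun w => mmap f (cat_coords p q) ('X_(rshift 3 w) : {mpoly ks[3 + 3]})) = q :> ('I_3 -> K).
Proof. by apply: boolp.funext => w; rewrite mmapX mmap1U cat_rshift. Qed.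

(** The homomorphism [f] is arbitrary so as to cover both [j], for the forms themselves, and [j]
    composed with an automorphism, for their conjugates. *)
Lemma mu_form_eval (f : {rmorphism ks -> K}) l p q u :
  mmap f (cat_coords p q) (mu_form l u) =
  theta (mat2_map f N) (ec_law (f (i c)) l (theta_inv (mat2_map f N') p) q) u.
Proof.
rewrite /mu_form theta_mmap; congr (theta _ _ _); apply: boolp.funext => w.
rewrite ec_law_mmap mmapXr; congr (ec_law _ _ _ _ _); apply: boolp.funext => w'.
by rewrite theta_inv_mmap mmapXl.
Qed.

Lemma ec_neg_mmap (f : {rmorphism ks -> K}) (v : 'I_6 -> K) (F : 'I_3 -> {mpoly ks[6]}) u :
  mmap f v (ec_neg F u) = ec_neg (fun w => mmap f v (F w)) u.
Proof. by move: u; apply: ord3_ind; rewrite /ec_neg /vec3 //= rmorphN. Qed.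

Lemma nu_form_eval (f : {rmorphism ks -> K}) l p q u :
  mmap f (cat_coords p q) (nu_form l u) =
  ec_law (f (i c)) l (theta_inv (mat2_map f N') q) (ec_neg (theta_inv (mat2_map f N') p)) u.
Proof.
rewrite /nu_form ec_law_mmap; congr (ec_law _ _ _ _ _); apply: boolp.funext => w.
  by rewrite theta_inv_mmap mmapXr.
rewrite (ec_neg_mmap f (cat_coords p q)); congr (ec_neg _ _); apply: boolp.funext => w'.
by rewrite theta_inv_mmap mmapXl.
Qed.

Let theta_inv_at p : on_pvar ji (V := V) p ->
  exists2 a, a != 0 & theta_inv M' p = fun u => a * ec_coords (Cf_point p) u.
Proof.
move=> hp; have [hP [a a0 pE]] := Cf_pointP hp.
by exists a => //; rewrite {1}pE theta_invZ (thetaK M'M).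
Qed.

Let law_at a P b Q : a != 0 -> b != 0 -> on_ec cK P -> on_ec cK Q ->
  exists l d, d != 0 /\ ec_law cK l (fun u => a * ec_coords P u) (fun u => b * ec_coords Q u)
    = fun u => d * ec_coords (ec_add P Q) u.
Proof.
move=> a0 b0 hP hQ; have [lam [h [l nl]]] := ec_law_ok m2 m3 cK0 hP hQ.
exists l, ((a * b) ^+ 2 * lam l); split; first by rewrite !mulf_neq0.
by apply: boolp.funext => u; rewrite ec_law_scale h mulrA.
Qed.

Lemma Cf_mu_on p q : on_pvar ji (V := V) p -> on_pvar ji (V := E) q -> on_pvar ji (Cf_mu p q).
Proof.
move=> hp hq; apply: theta_on; apply: on_ec_add => //; first by case: (Cf_pointP hp).
by case: (ec_pointP hq).
Qed.

Lemma Cf_nu_on p q : on_pvar ji (V := V) p -> on_pvar ji (V := V) q -> on_pvar ji (Cf_nu p q).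
Proof.
move=> hp hq; apply: ec_coords_on; apply: on_ec_add => //; first by case: (Cf_pointP hq).
by apply: on_ec_opp; case: (Cf_pointP hp).
Qed.

Lemma Cf_mu_morphism : morphism2 ji Cf_mu.
Proof.
apply: (morphism2_descent hks Cf_mu_on) => p q hp hq.
have [hP _] := Cf_pointP hp; have [hQ [b b0 qE]] := ec_pointP hq.
have [a a0 pE] := theta_inv_at hp.
have [l [d [d0 lE]]] := law_at a0 b0 hP hQ.
(* Bidegree (2, 2), spelled as [ec_law_bihomog] produces it; [l] is a law that does not vanish at
   this pair. *)
exists ((1 + 0) + (1 + 0))%N, ((0 + 1) + (0 + 1))%N, (mu_form l); split.
- move=> u; apply: theta_bihomog => v; apply: ec_law_bihomog => w; last exact: bihomogXr.
  by apply: theta_inv_bihomog => w'; apply: bihomogXl.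
- have [u nz] : proj_nz (theta M (ec_coords (ec_add (Cf_point p) (ec_point q)))).
    by have [] := theta_on (on_ec_add m2 hP hQ).
  by exists u; rewrite mu_form_eval pE {1}qE lE thetaZ mulf_neq0.
- move=> s p' q' hp' hq'; have [t ht e] := twist s.
  have [a' h] := mu_formula l ht hp' hq'; exists a' => u; rewrite -h.
  rewrite (mmap_map s j) (mu_form_eval (rcomp j s)) /= gal_fix.
  by rewrite -e -(twist_inv ht e).
Qed.

Lemma Cf_nu_morphism : morphism2 ji Cf_nu.
Proof.
apply: (morphism2_descent hks Cf_nu_on) => p q hp hq.
have [hP _] := Cf_pointP hp; have [hQ _] := Cf_pointP hq.
have [a a0 pE] := theta_inv_at hp; have [b b0 qE] := theta_inv_at hq.
have [e e0 nE] := ec_neg_coords (Cf_point p).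
have [l [d [d0 lE]]] := law_at b0 (mulf_neq0 a0 e0) hQ (on_ec_opp hP).
exists ((0 + 1) + (0 + 1))%N, ((1 + 0) + (1 + 0))%N, (nu_form l); split.
- move=> u; apply: ec_law_bihomog => w.
    by apply: theta_inv_bihomog => w'; apply: bihomogXr.
  have h x : bihomog 1 0 (theta_inv (mat2_map (@mpolyC _ ks) N')
      (fun a => 'X_(lshift 3 a) : {mpoly ks[3 + 3]}) x).
    by apply: theta_inv_bihomog => w'; apply: bihomogXl.
  by move: w; apply: ord3_ind; rewrite /ec_neg /vec3 /=; [|apply: bihomogN|]; apply: h.
- have [u nz] := ec_coords_neq0 (ec_add (Cf_point q) (ec_opp (Cf_point p))).
  exists u; rewrite nu_form_eval pE qE ec_negZ nE.
  have -> : (fun u => a * (e * ec_coords (ec_opp (Cf_point p)) u))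
      = fun u => a * e * ec_coords (ec_opp (Cf_point p)) u.
    by apply: boolp.funext => v; rewrite mulrA.
  by rewrite lE mulf_neq0.
- move=> s p' q' hp' hq'; have [t ht et] := twist s.
  have [a' h] := nu_formula l ht hp' hq'; exists a' => u; rewrite -h.
  rewrite (mmap_map s j) (nu_form_eval (rcomp j s)) /= gal_fix.
  by rewrite -(twist_inv ht et).
Qed.

Hypothesis disc0 : disc_f A B C D != 0.

Lemma Cf_smooth : smooth_projective_curve ji V.
Proof.
split.
- move=> F; rewrite inE => /eqP ->; exists 3%N; exact: Cf_equation_homog.
- by move=> w hw; apply: (Cf_jacobian n2 n3 disc0).
- move=> G H d e hG hH h.
  have sc d' (F : {mpoly K[3]}) : F \is d'.-homog -> homogeneous_eval d' F.
    by move=> hF a v; apply: (mmap_scale idfun).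
  (* Forms are pulled back along [theta M] to the curve [E], whose irreducibility is known. *)
  pose comp (F : {mpoly K[3]}) := mmap (@mpolyC 3 K) (theta (mat2_map (@mpolyC 3 K) M) (fun u => 'X_u)) F.
  have compE (F : {mpoly K[3]}) v : (comp F).@[v] = F.@[theta M v].
    rewrite meval_comp; congr meval; apply: boolp.funext; apply: ord3_ind;
    by rewrite /theta [vec3 _ _ _]lock /= -lock /vec3 /= ?mevalD ?mevalM ?mevalC ?mevalXU.
  have scomp d' (F : {mpoly K[3]}) : F \is d'.-homog -> homogeneous_eval d' (comp F).
    by move=> hF a v; rewrite !compE thetaZ; apply: sc.
  have back d' (F : {mpoly K[3]}) : F \is d'.-homog -> (forall P, on_ec cK P -> (comp F).@[ec_coords P] = 0) ->
      forall x : pcoords V K, on_pvar ji x -> F.@[x] = 0.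
    move=> hF hP x /Cf_pointP [hx [a a0 ->]].
    by rewrite (sc _ _ hF) -compE hP // mulr0.
  have [|h1|h1] := ec_irreducible hK m2 cK0 (scomp _ _ hG) (scomp _ _ hH).
  + by move=> P hP; rewrite !compE; apply: h; apply: theta_on.
  + by left; apply: back hG h1.
  + by right; apply: back hH h1.
(* A point of [E] whose abscissa differs from those of the given points gives a new point of the
   cubic; the value 0 at infinity only adds one more abscissa to avoid. *)
- move=> n r; pose absc P : K := if P is Affine x y then x else 0.
  have [x hx] := closed_infinite hK [seq absc (Cf_point (r a)) | a <- enum 'I_n].
  have [y hy] := closed_sqrt hK (x ^+ 3 + cK).
  exists (theta M (ec_coords (Affine x y))); first exact: theta_on.
  move=> a /Cf_point_eq; rewrite Cf_point_theta => e; case/negP: hx.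
  by apply/mapP; exists a; rewrite ?mem_enum // e.
Qed.

Let eq_point p q : on_pvar ji (V := V) p -> on_pvar ji (V := V) q ->
  Cf_point p = Cf_point q -> proj_eq p q.
Proof.
move=> /Cf_pointP [_ [a a0 pE]] /Cf_pointP [_ [b b0 qE]] e; rewrite pE qE e.
apply: proj_eq_trans (proj_eq_scale _ b0); exact: proj_eq_sym (proj_eq_scale _ a0).
Qed.

Theorem Cf_is_phs : is_phs i j Cf_mu.
Proof.
have I p : on_pvar ji (V := V) p -> on_ec cK (Cf_point p) by case/Cf_pointP.
have muE p P : Cf_mu p (ec_coords P) = theta M (ec_coords (ec_add (Cf_point p) P)).
  by rewrite /Cf_mu ec_point_coords.
split.
- by split; [exact: Cf_smooth | exact: Cf_mu_morphism].
- move=> p hp; rewrite muE ec_add0; apply: eq_point => //; first by apply: theta_on; apply: I.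
  exact: Cf_point_theta.
- move=> p P Q hp hP hQ; rewrite !muE Cf_point_theta (ec_addA hK m2 m3 cK0 (I _ hp) hP hQ).
  exact: proj_eq_refl.
- move=> p q hp hq; exists (ec_add (Cf_point q) (ec_opp (Cf_point p))); split.
    split; first by apply: on_ec_add => //; [apply: I | apply: on_ec_opp; apply: I].
    rewrite muE (ec_addsubK hK m2 m3 cK0 (I _ hp) (I _ hq)).
    by apply: eq_point => //; [apply: theta_on; apply: I | apply: Cf_point_theta].
  move=> P [hP]; rewrite muE => /Cf_point_eq; rewrite Cf_point_theta => <-.
  by rewrite (ec_addC m2 (I _ hp) hP) (ec_addK hK m2 m3 cK0 hP (I _ hp)).
- exists Cf_nu; first exact: Cf_nu_morphism.
  move=> p q hp hq; rewrite /Cf_nu muE (ec_addsubK hK m2 m3 cK0 (I _ hp) (I _ hq)).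
  by apply: eq_point => //; [apply: theta_on; apply: I | apply: Cf_point_theta].
Qed.

(* The base point is the image of the point at infinity. *)
Lemma Cf_class (xi : H1 i (on_ec (i c))) (a : cocycle i (on_ec (i c))) :
  H1_mem xi a -> (forall s : gal i, ec_T sqrtc (a s)) ->
  (forall s : gal i, mat2_map s N = mat2_mul N (transl (a s))) ->
  phs_class j Cf_mu xi.
Proof.
move=> hxi aT aN; pose p0 : pcoords V ks := theta N (ec_coords Infty).
exists p0; split.
  apply/on_Cf_curveP; split.
    have [u] := (theta_on (P := Infty) I).1; rewrite /M => h.
    exists u; rewrite -(fmorph_eq0 j) theta_morph; move: h; congr (_ _ _ != 0).
    by apply: boolp.funext; apply: ord3_ind; rewrite !ec_coordsE /vec3 /= ?rmorph0 ?rmorph1.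
  by have [e _ _ _] := htriv; rewrite /p0 /theta /vec3 /= !(mulr1, mulr0, addr0) e expr0n.
exists a; split=> // s.
have jco (P : ecpoint ks) : (fun u => j (ec_coords P u)) = ec_coords (ec_map j P).
  apply: boolp.funext; apply: ord3_ind; case: P => [|x y]; rewrite !ec_coordsE /vec3 /=;
  by rewrite ?rmorph0 ?rmorph1.
have sco : (fun u => s (ec_coords (@Infty ks) u)) = ec_coords Infty.
  by apply: boolp.funext; apply: ord3_ind; rewrite !ec_coordsE /vec3 /= ?rmorph0 ?rmorph1.
have pE : (fun b => j (p0 b)) = theta M (ec_coords Infty).
  by apply: boolp.funext => b; rewrite /p0 theta_morph jco.
have qE : (fun b => j (s (p0 b))) = theta M (mat2_act (transl (ec_map j (a s))) (ec_coords Infty)).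
  apply: boolp.funext => b; rewrite /p0 theta_morph sco aN theta_morph jco.
  by rewrite mat2_map_mul theta_mul map_transl.
rewrite pE qE /Cf_mu Cf_point_theta ec_point_coords.
have [b b0 ->] := transl_act m2 cK0 hsK (ec_T_map (aT s)) (P := Infty) I.
by rewrite thetaZ; apply: proj_eq_scale.
Qed.

End TwistedCubic.

(** * Principal homogeneous spaces of the same class *)

(** Weighted homogeneity under substitution: weight 0 serves the coordinates of a fixed base point,
    positive weights the variable coordinates. *)
Lemma mmap_homog (R S : comNzRingType) (g : {rmorphism R -> S}) m n (F : {mpoly R[m]})
    (h : 'I_m -> {mpoly S[n]}) (w : 'I_m -> nat) d :
  (forall a, h a \is (w a).-homog) ->
  (forall u, u \in msupp F -> (\sum_a w a * u a)%N = d) ->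
  mmap (@mpolyC n S \o g) h F \is d.-homog.
Proof.
move=> hh hF; rewrite /mmap; elim: (msupp F) hF => [|u r IH] hF.
  by rewrite big_nil dhomog0.
rewrite big_cons dhomogD ?IH //; last by move=> v hv; apply: hF; rewrite inE hv orbT.
rewrite /= mul_mpolyC dhomogZ // -(hF u (mem_head _ _)) /mmap1.
elim: (index_enum 'I_m) => [|a s IHs]; first by rewrite !big_nil dhomog1.
by rewrite !big_cons; apply: dhomogM => //; apply: dhomogMn.
Qed.

Lemma cat_coords_eq (T : Type) m n (x x' : 'I_m -> T) (y y' : 'I_n -> T) :
  x =1 x' -> y =1 y' -> cat_coords x y =1 cat_coords x' y'.
Proof. by move=> ex ey a; rewrite /cat_coords; case: split. Qed.

Lemma cat_coords_map (S T : Type) (f : S -> T) m n (x : 'I_m -> S) (y : 'I_n -> S) a :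
  f (cat_coords x y a) = cat_coords (fun b => f (x b)) (fun b => f (y b)) a.
Proof. by rewrite /cat_coords; case: split. Qed.

Section WellDefined.
Variables (k K : fieldType) (i : {rmorphism k -> K}).

(** The forms chosen at [(p, q)] are bihomogeneous, so rescaling both arguments keeps them nonzero
    and represents both values by the same forms. *)
Lemma morphism2_wd (U V W : pvar k) (mu : pcoords U K -> pcoords V K -> pcoords W K) p q p' q' :
  morphism2 i mu -> on_pvar i p -> on_pvar i q -> on_pvar i p' -> on_pvar i q' ->
  proj_eq p p' -> proj_eq q q' -> proj_eq (mu p q) (mu p' q').
Proof.
move=> hmu hp hq hp' hq' /proj_eqE [a a0 ep] /proj_eqE [b b0 eq].
have [_ [d [e [F [Fh nz FE]]]]] := hmu p q hp hq.
have sc u : mmap i (cat_coords p' q') (F u) = a ^+ d * b ^+ e * mmap i (cat_coords p q) (F u).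
  by rewrite ep eq (mmap_biscale i _ _ _ _ (Fh u)).
have nz' : proj_nz (fun u => mmap i (cat_coords p' q') (F u)).
  by case: nz => u nu; exists u; rewrite sc !mulf_neq0 ?expf_neq0.
apply: proj_eq_trans (FE _ _ hp' hq' nz').
apply: proj_eq_trans (proj_eq_sym (FE _ _ hp hq nz)) _.
by exists (a ^+ d * b ^+ e); rewrite ?mulf_neq0 ?expf_neq0.
Qed.

Lemma on_pvar_proj (V : pvar k) (x y : pcoords V K) :
  (forall F, F \in peqs V -> exists d, F \is d.-homog) ->
  on_pvar i x -> proj_eq x y -> on_pvar i y.
Proof.
move=> hV [nz h] e; split; first exact: proj_nz_eq nz.
move=> F hF; have [d hd] := hV F hF; have [a a0 ->] := proj_eqE e.
by rewrite (mmap_scale i _ _ hd) h // mulr0.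
Qed.

Lemma morphism_id (V : pvar k) : @morphism k K i V V id.
Proof.
move=> p hp; split=> //; exists 1%N, (fun b => 'X_b).
have e (q : pcoords V K) : (fun b => mmap i q 'X_b) = q.
  by apply: boolp.funext => b; rewrite mmapX mmap1U.
split; first by move=> b; rewrite dhomogX /= mdeg1.
  by rewrite e; case: hp.
by move=> q hq _; rewrite e; apply: proj_eq_refl.
Qed.

Lemma isomorphic_refl (V : pvar k) : isomorphic i V V.
Proof.
exists id, id; split; try exact: morphism_id.
  by move=> p _; apply: proj_eq_refl.
by move=> p _; apply: proj_eq_refl.
Qed.

End WellDefined.

Section Phs.
Variables (k ks K : fieldType) (i : {rmorphism k -> ks}) (j : {rmorphism ks -> K}).
Hypothesis hK : GRing.closed_field_axiom K.
Hypotheses (n2 : 2%:R != 0 :> k) (n3 : 3%:R != 0 :> k).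
Variables (c : k) (c0 : c != 0).
Let ji := rcomp j i.
Let cK := ji c.
Let E := ec_curve c.
Let m2 : 2%:R != 0 :> K. Proof. by rewrite -(rmorph_nat ji) fmorph_eq0. Qed.
Let m3 : 3%:R != 0 :> K. Proof. by rewrite -(rmorph_nat ji) fmorph_eq0. Qed.
Let cK0 : cK != 0. Proof. by rewrite fmorph_eq0. Qed.

Lemma on_ec_map (P : ecpoint ks) : on_ec (i c) P -> on_ec cK (ec_map j P).
Proof. by case: P => //= x y h; rewrite -!rmorphXn h rmorphD. Qed.
Lemma on_ec_gal (s : gal i) (P : ecpoint ks) : on_ec (i c) P -> on_ec (i c) (ec_map s P).
Proof. by case: P => //= x y h; rewrite -!rmorphXn h rmorphD gal_fix. Qed.

Lemma ec_map_add (F G : fieldType) (f : {rmorphism F -> G}) P Q :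
  ec_map f (ec_add P Q) = ec_add (ec_map f P) (ec_map f Q).
Proof.
case: P Q => [|x1 y1] [|x2 y2] //=.
rewrite -rmorphN !(inj_eq (fmorph_inj f)); case: ifP => //= _.
by congr Affine; case: ifP => _;
  rewrite !(rmorph_nat, rmorphXn, rmorphM, rmorphB, fmorphV, rmorphN).
Qed.
Lemma ec_map_opp (F G : fieldType) (f : {rmorphism F -> G}) P :
  ec_map f (ec_opp P) = ec_opp (ec_map f P).
Proof. by case: P => //= x y; rewrite rmorphN. Qed.
Lemma ec_coords_map (F G : fieldType) (f : {rmorphism F -> G}) P :
  (fun u => f (ec_coords P u)) = ec_coords (ec_map f P).
Proof.
apply: boolp.funext; apply: ord3_ind; case: P => [|x y];
  by rewrite !ec_coordsE /vec3 /= ?rmorph0 ?rmorph1.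
Qed.

Lemma on_pvar_map (V : pvar k) (p : pcoords V ks) :
  on_pvar i p <-> on_pvar ji (V := V) (fun b => j (p b)).
Proof.
have e F : mmap ji (fun b => j (p b)) F = j (mmap i p F) by rewrite (rmorph_mmap i j).
split=> -[[u nu] h]; split; try by exists u; move: nu; rewrite fmorph_eq0.
  by move=> F hF; rewrite e h ?rmorph0.
by move=> F hF; apply/eqP; rewrite -(fmorph_eq0 j) -e h.
Qed.

Lemma on_pvar_gal (V : pvar k) (s : gal i) (p : pcoords V ks) :
  on_pvar i p -> on_pvar i (V := V) (fun b => s (p b)).
Proof.
move=> [[u nu] h]; split; first by exists u; rewrite fmorph_eq0.
move=> F hF; have -> : mmap i (fun b => s (p b)) F = s (mmap i p F).
  rewrite (rmorph_mmap i s) /mmap; apply: eq_bigr => v _ /=.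
  by rewrite gal_fix.
by rewrite h ?rmorph0.
Qed.

Section Action.
Variables (V : pvar k) (mu : pcoords V K -> pcoords E K -> pcoords V K).
Hypothesis hV : is_phs i j mu.

Lemma phs_homog F : F \in peqs V -> exists d, F \is d.-homog.
Proof. by move=> hF; case: hV => -[[h _ _ _] _] _ _ _ _; apply: h. Qed.

Lemma phs_on p q : on_pvar ji p -> on_pvar ji q -> on_pvar ji (mu p q).
Proof. by case: hV => -[_ h] _ _ _ _ hp hq; case: (h p q hp hq). Qed.

Lemma phs_wd p q p' q' : on_pvar ji p -> on_pvar ji q -> on_pvar ji p' -> on_pvar ji q' ->
  proj_eq p p' -> proj_eq q q' -> proj_eq (mu p q) (mu p' q').
Proof. by case: hV => -[_ h] _ _ _ _; apply: morphism2_wd. Qed.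

Lemma phs_add p P Q : on_pvar ji p -> on_ec cK P -> on_ec cK Q ->
  proj_eq (mu (mu p (ec_coords P)) (ec_coords Q)) (mu p (ec_coords (ec_add P Q))).
Proof. by case: hV => _ _ h _ _; apply: h. Qed.

Lemma phs_uniq p P Q : on_pvar ji p -> on_ec cK P -> on_ec cK Q ->
  proj_eq (mu p (ec_coords P)) (mu p (ec_coords Q)) -> P = Q.
Proof.
move=> hp hP hQ e; case: hV => _ _ _ h _.
have [R [_ u]] := h p (mu p (ec_coords Q)) hp (phs_on hp (ec_coords_on hQ)).
by rewrite -(u P (conj hP e)) -(u Q (conj hQ (proj_eq_refl _))).
Qed.

(* [p + P] is defined over [ks] if [p] and [P] are. *)
Lemma phs_shift (p : pcoords V ks) P : on_pvar i p -> on_ec (i c) P ->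
  exists2 p1 : pcoords V ks, on_pvar i p1 & forall s : gal i,
    proj_eq (fun b => j (s (p1 b)))
      (mu (fun b => j (s (p b))) (ec_coords (ec_map j (ec_map s P)))).
Proof.
move=> hp hP; have hjp : on_pvar ji (V := V) (fun b => j (p b)) by apply/on_pvar_map.
have hjP : on_pvar ji (V := E) (ec_coords (ec_map j P)) by apply: ec_coords_on; apply: on_ec_map.
case: hV => -[_ hmu] _ _ _ _; have [hon [d [e [F [Fh nz FE]]]]] := hmu _ _ hjp hjP.
pose p1 b := mmap i (cat_coords p (ec_coords P)) (F b).
have p1E (f : {rmorphism ks -> K}) b : (forall a, f (i a) = ji a) ->
    f (p1 b) = mmap ji (cat_coords (fun b => f (p b)) (ec_coords (ec_map f P))) (F b).
  move=> fi; rewrite /p1 rmorph_mmap /mmap; apply: eq_bigr => u _; rewrite /= fi.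
  congr (_ * _); apply: eq_bigr => v _; rewrite cat_coords_map; congr (_ ^+ _).
  by apply: cat_coords_eq => // w; rewrite -ec_coords_map.
have nz1 : proj_nz p1.
  by case: nz => u; rewrite -(p1E j) // fmorph_eq0 => nu; exists u.
have key (s : gal i) : proj_eq (fun b => j (s (p1 b)))
    (mu (fun b => j (s (p b))) (ec_coords (ec_map j (ec_map s P)))).
  have hs : on_pvar ji (V := V) (fun b => j (s (p b))).
    exact: (proj1 (on_pvar_map _) (on_pvar_gal s hp)).
  have hsP : on_pvar ji (V := E) (ec_coords (ec_map j (ec_map s P))).
    by apply: ec_coords_on; apply: on_ec_map; apply: on_ec_gal.
  have e1 b : j (s (p1 b)) =
      mmap ji (cat_coords (fun b => j (s (p b))) (ec_coords (ec_map j (ec_map s P)))) (F b).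
    rewrite -[LHS]/(rcomp j s (p1 b)) p1E; last by move=> a /=; rewrite gal_fix.
    by congr (mmap _ (cat_coords _ (ec_coords _)) _); case: (P).
  rewrite (boolp.funext e1); apply: FE => //.
  by case: nz1 => u nu; exists u; rewrite -e1 !fmorph_eq0.
exists p1 => //; apply/on_pvar_map.
apply: (on_pvar_proj phs_homog hon); apply: proj_eq_sym.
have -> : (fun b => j (p1 b)) = fun b => mmap ji (cat_coords (fun b => j (p b)) (ec_coords (ec_map j P))) (F b).
  by apply: boolp.funext => b; rewrite p1E.
exact: FE.
Qed.

(** If [s(p) = p + a(s)] and [a(s) = a0(s) + s(P) - P], then the base point [p - P] satisfies
    [s(p - P) = (p - P) + a0(s)]. *)
Lemma phs_base (xi : H1 i (on_ec (i c))) (a0 : cocycle i (on_ec (i c))) :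
  sval xi = cohomologous a0 -> phs_class j mu xi ->
  exists2 p : pcoords V ks, on_pvar i p & forall s : gal i,
    proj_eq (mu (fun b => j (p b)) (ec_coords (ec_map j (a0 s)))) (fun b => j (s (p b))).
Proof.
move=> xiE [p [hp [a [ha hpa]]]]; move: ha; rewrite /H1_mem xiE => -[P hP aE].
have [p1 hp1 p1E] := phs_shift hp (on_ec_opp hP).
exists p1 => // s.
have id_bij : bijective (idfun : {rmorphism ks -> ks}) by exists idfun.
(* The identity automorphism gives the relation between [p1] and [p] itself. *)
have := p1E (@Defs.Gal k ks i idfun id_bij (fun a => erefl)).
rewrite /= (_ : ec_map idfun _ = ec_opp P); last by case: (P).
move=> e1; have e2 := p1E s.
have hjp : on_pvar ji (V := V) (fun b => j (p b)) by apply/on_pvar_map.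
have hjp1 : on_pvar ji (V := V) (fun b => j (p1 b)) by apply/on_pvar_map.
have hjsp : on_pvar ji (V := V) (fun b => j (s (p b))).
  exact: (proj1 (on_pvar_map _) (on_pvar_gal s hp)).
have hjP := on_ec_map (on_ec_opp hP); have ha0 := on_ec_map (cocycle_in a0 s).
have hsP := on_ec_map (on_ec_gal s (on_ec_opp hP)).
have has := on_ec_map (cocycle_in a s).
apply: proj_eq_trans (proj_eq_sym e2).
apply: (proj_eq_trans (y := mu (mu (fun b => j (p b)) (ec_coords (ec_map j (ec_opp P))))
    (ec_coords (ec_map j (a0 s))))).
  apply: phs_wd => //; try exact: ec_coords_on; last exact: proj_eq_refl.
  by apply: phs_on => //; apply: ec_coords_on.
apply: proj_eq_trans (phs_add hjp hjP ha0) _.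
apply: (proj_eq_trans (y := mu (mu (fun b => j (p b)) (ec_coords (ec_map j (a s))))
    (ec_coords (ec_map j (ec_map s (ec_opp P)))))); last first.
  apply: phs_wd => //; try exact: ec_coords_on; last exact: proj_eq_refl.
  by apply: phs_on => //; apply: ec_coords_on.
apply: proj_eq_sym; apply: proj_eq_trans (phs_add hjp has hsP) _.
suff -> : ec_add (ec_map j (a s)) (ec_map j (ec_map s (ec_opp P)))
    = ec_add (ec_map j (ec_opp P)) (ec_map j (a0 s)) by apply: proj_eq_refl.
rewrite aE !ec_map_add !ec_map_opp in hjP hsP *.
have hP1 := on_ec_map hP; have hP2 := on_ec_map (on_ec_gal s hP).
rewrite (ec_addC m2 hP2 hjP) -(ec_addA hK m2 m3 cK0 ha0 hjP hP2).
rewrite (ec_addK hK m2 m3 cK0 (on_ec_add m2 ha0 hjP) hP2).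
exact: (ec_addC m2 ha0 hjP).
Qed.

End Action.

End Phs.

Lemma ec_equation_homog (k : fieldType) (c : k) :
  ('X_1 ^+ 2 * 'X_2%:R - 'X_0 ^+ 3 - c *: 'X_2%:R ^+ 3 : {mpoly k[3]}) \is 3.-homog.
Proof.
have hX (a : 'I_3) : ('X_a : {mpoly k[3]}) \is 1.-homog by rewrite dhomogX /= mdeg1.
have h3 (a b e : 'I_3) : ('X_a * ('X_b * 'X_e) : {mpoly k[3]}) \is 3.-homog.
  by apply: (dhomogM (hX a) (dhomogM (hX b) (hX e))).
rewrite !exprS !expr0 !mulr1 -!mulrA.
by rewrite dhomogD ?dhomogN // ?dhomogD ?dhomogN ?dhomogZ.
Qed.

(** * The isomorphism between two spaces of the same class *)

Section Transfer.
Variables (k ks K : fieldType) (i : {rmorphism k -> ks}) (j : {rmorphism ks -> K}).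
Hypotheses (hks : separable_closure i) (hK : GRing.closed_field_axiom K).
Hypotheses (n2 : 2%:R != 0 :> k) (n3 : 3%:R != 0 :> k).
Variables (c : k) (c0 : c != 0).
Let ji := rcomp j i.
Let cK := ji c.
Let E := ec_curve c.
Let m2 : 2%:R != 0 :> K. Proof. by rewrite -(rmorph_nat ji) fmorph_eq0. Qed.

Lemma phs_diff (V : pvar k) (mu : pcoords V K -> pcoords E K -> pcoords V K)
    (nu : pcoords V K -> pcoords V K -> pcoords E K) (hV : is_phs i j mu) p v :
  morphism2 ji nu ->
  (forall p q, on_pvar ji p -> on_pvar ji q -> proj_eq (mu p (nu p q)) q) ->
  on_pvar ji p -> on_pvar ji v ->
  exists2 Q, on_ec cK Q & proj_eq (ec_coords Q) (nu p v) /\ proj_eq (mu p (ec_coords Q)) v.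
Proof.
move=> hnu hmn hp hv; have [hon _] := hnu p v hp hv.
have [hQ [a a0 nE]] := ec_pointP hon; exists (ec_point (nu p v)) => //.
have e : proj_eq (ec_coords (ec_point (nu p v))) (nu p v) by rewrite {2}nE; exists a.
split=> //; apply: proj_eq_trans (hmn p v hp hv).
by apply: (phs_wd hV) => //; [apply: ec_coords_on | apply: proj_eq_refl].
Qed.

Section Morphism.
Variables (V W : pvar k).
Variables (mu : pcoords V K -> pcoords E K -> pcoords V K).
Variables (mu' : pcoords W K -> pcoords E K -> pcoords W K).
Variables (nu : pcoords V K -> pcoords V K -> pcoords E K).
Hypotheses (hV : is_phs i j mu) (hW : is_phs i j mu') (hnu : morphism2 ji nu).
Hypothesis hmn : forall p q, on_pvar ji p -> on_pvar ji q -> proj_eq (mu p (nu p q)) q.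
Variables (a : gal i -> ecpoint ks) (p : pcoords V ks) (q : pcoords W ks).
Hypotheses (ha : forall s, on_ec (i c) (a s)) (hp : on_pvar i p) (hq : on_pvar i q).
Hypothesis pE : forall s : gal i,
  proj_eq (mu (fun b => j (p b)) (ec_coords (ec_map j (a s)))) (fun b => j (s (p b))).
Hypothesis qE : forall s : gal i,
  proj_eq (mu' (fun b => j (q b)) (ec_coords (ec_map j (a s)))) (fun b => j (s (q b))).

(** The equivariant map [p + Q |-> q + Q] sending the base point [p] to [q]. *)
Definition transfer (v : pcoords V K) : pcoords W K :=
  mu' (fun b => j (q b)) (nu (fun b => j (p b)) v).

Let jp := fun b => j (p b).
Let jq := fun b => j (q b).
Let hjp : on_pvar ji (V := V) jp. Proof. exact: (proj1 (on_pvar_map i j p) hp). Qed.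
Let hjq : on_pvar ji (V := W) jq. Proof. exact: (proj1 (on_pvar_map i j q) hq). Qed.
Let hsp (s : gal i) : on_pvar ji (V := V) (fun b => j (s (p b))).
Proof. exact: (proj1 (on_pvar_map i j _) (on_pvar_gal s hp)). Qed.
Let hsq (s : gal i) : on_pvar ji (V := W) (fun b => j (s (q b))).
Proof. exact: (proj1 (on_pvar_map i j _) (on_pvar_gal s hq)). Qed.

(** If [v = s(p) + P], then [v = p + (a(s) + P)] and [s(q) + P = q + (a(s) + P)]: the common cocycle
    makes the map independent of the conjugates chosen as base points. *)
Lemma transfer_gal (s : gal i) v : on_pvar ji v ->
  proj_eq (mu' (fun b => j (s (q b))) (nu (fun b => j (s (p b))) v)) (transfer v).
Proof.
move=> hv; have has := on_ec_map j (ha s).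
have [P hP [eP mP]] := phs_diff hV hnu hmn (hsp s) hv.
have [Q hQ [eQ mQ]] := phs_diff hV hnu hmn hjp hv.
have hnP : on_pvar ji (V := E) (nu (fun b => j (s (p b))) v) by case: (hnu (hsp s) hv).
have hnQ : on_pvar ji (V := E) (nu jp v) by case: (hnu hjp hv).
have hcP := ec_coords_on hP; have hca := ec_coords_on has.
have QE : ec_add (ec_map j (a s)) P = Q.
  apply: (phs_uniq hV hjp) => //; first exact: on_ec_add.
  apply: proj_eq_trans (proj_eq_sym mQ); apply: proj_eq_trans mP.
  apply: proj_eq_trans (proj_eq_sym (phs_add hV hjp has hP)) _.
  by apply: (phs_wd hV) => //; [apply: (phs_on hV) | apply: proj_eq_refl].
apply: (proj_eq_trans (y := mu' (mu' jq (ec_coords (ec_map j (a s)))) (ec_coords P))).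
  apply: (phs_wd hW) => //; first exact: (phs_on hW).
    exact: proj_eq_sym (qE s).
  exact: proj_eq_sym.
apply: proj_eq_trans (phs_add hW hjq has hP) _; rewrite QE.
apply: (phs_wd hW) => //; last exact: proj_eq_refl.
exact: ec_coords_on.
Qed.

Lemma transfer_on v : on_pvar ji v -> on_pvar ji (transfer v).
Proof. by move=> hv; apply: (phs_on hW) => //; case: (hnu hjp hv). Qed.

Lemma transfer_morphism : morphism ji transfer.
Proof.
apply: (morphism_descent hks transfer_on) => v0 hv0.
have [hw0 [d [e [F [Fh [cc Fcc] FE]]]]] := hnu hjp hv0.
case: (hW) => -[_ hmu'] _ _ _ _; have [_ [d' [e' [G [Gh Gnz GE]]]]] := hmu' _ _ hjq hw0.
pose n := (pdim V).+1.
(* [Fp] is [F] with the coordinates of [p] inserted, and [Gq] composes [G], with those of [q]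
   inserted, with [Fp]. *)
pose Fp u : {mpoly ks[n]} := mmap (@mpolyC n ks \o i)
  (cat_coords (fun b => (p b)%:MP) (fun b => 'X_b)) (F u).
pose Gq b : {mpoly ks[n]} := mmap (@mpolyC n ks \o i)
  (cat_coords (fun b => (q b)%:MP) Fp) (G b).
have Fp_eval (f : {rmorphism ks -> K}) v u : (forall a, f (i a) = ji a) ->
    mmap f v (Fp u) = mmap ji (cat_coords (fun b => f (p b)) v) (F u).
  move=> fi; rewrite /Fp (rmorph_mmap _ (mmap f v)).
  rewrite /mmap; apply: eq_bigr => w _; rewrite /= mmapC; congr (_ * _); first exact: fi.
  apply: eq_bigr => w' _; congr (_ ^+ _); rewrite (cat_coords_map (mmap f v)).
  by apply: cat_coords_eq => b; rewrite ?mmapC // mmapX mmap1U.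
have Gq_eval (f : {rmorphism ks -> K}) v b : (forall a, f (i a) = ji a) ->
    mmap f v (Gq b) = mmap ji (cat_coords (fun b => f (q b))
      (fun u => mmap ji (cat_coords (fun b => f (p b)) v) (F u))) (G b).
  move=> fi; rewrite /Gq (rmorph_mmap _ (mmap f v)).
  rewrite /mmap; apply: eq_bigr => w _; rewrite /= mmapC; congr (_ * _); first exact: fi.
  apply: eq_bigr => w' _; congr (_ ^+ _); rewrite (cat_coords_map (mmap f v)).
  by apply: cat_coords_eq => b'; rewrite ?mmapC // Fp_eval.
have hC (x : ks) : (x%:MP : {mpoly ks[n]}) \is 0.-homog.
  by rewrite -[x%:MP]mulr1 mul_mpolyC dhomogZ ?dhomog1.
have Fp_homog u : Fp u \is e.-homog.
  apply: (mmap_homog i (w := cat_coords (fun=> 0%N) (fun=> 1%N))).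
    by move=> b; rewrite /cat_coords; case: split => b'; rewrite ?hC // dhomogX /= mdeg1.
  move=> w hw; rewrite big_split_ord /=.
  under eq_bigr do rewrite cat_lshift mul0n.
  under [X in (_ + X)%N]eq_bigr do rewrite cat_rshift mul1n.
  by rewrite big1 // add0n; case: (Fh u w hw).
have Gq_homog b : Gq b \is (e * e').-homog.
  apply: (mmap_homog i (w := cat_coords (fun=> 0%N) (fun=> e))).
    by move=> b'; rewrite /cat_coords; case: split => b''; rewrite ?hC.
  move=> w hw; rewrite big_split_ord /=.
  under eq_bigr do rewrite cat_lshift mul0n.
  under [X in (_ + X)%N]eq_bigr do rewrite cat_rshift.
  by rewrite big1 // add0n -big_distrr; case: (Gh b w hw) => _ <-.
(* A conjugate of the tuple may be evaluated where the conjugate of [F] is zero and says nothing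
   about [nu]. The extra factor [Fp cc] makes the tuple vanish at every such point. *)
exists (e + e * e')%N, (fun b => Fp cc * Gq b); split.
- by move=> b; apply: dhomogM.
- have [l l0 wE] := proj_eqE (FE _ _ hjp hv0 (ex_intro _ cc Fcc)).
  case: Gnz => b nb; exists b; rewrite rmorphM /= Fp_eval // Gq_eval // mulf_neq0 //.
  apply: contraNneq nb => G0; rewrite wE.
  have := mmap_biscale ji jq (fun u => mmap ji (cat_coords jp v0) (F u)) 1 l (Gh b).
  rewrite G0 mulr0 => <-; apply/eqP; apply: mmap_eq => w.
  by apply: cat_coords_eq => b'; rewrite ?mul1r.
move=> s v hv.
have fi x : rcomp j s (i x) = ji x by rewrite /= gal_fix.
pose w u := mmap ji (cat_coords (fun b => j (s (p b))) v) (F u).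
have evalE b : mmap j v (map_mpoly s (Fp cc * Gq b)) =
    w cc * mmap ji (cat_coords (fun b => j (s (q b))) w) (G b).
  by rewrite (mmap_map s j) (rmorphM (mmap (rcomp j s) v)) /= Fp_eval // Gq_eval.
case: (eqVneq (w cc) 0) => [w0|wnz].
  by exists 0 => b; rewrite evalE w0 !mul0r.
have hnv : on_pvar ji (V := E) (nu (fun b => j (s (p b))) v) by case: (hnu (hsp s) hv).
have ew : proj_eq w (nu (fun b => j (s (p b))) v).
  by apply: (FE _ _ (hsp s) hv); exists cc.
have hw : on_pvar ji (V := E) w.
  apply: on_pvar_proj hnv (proj_eq_sym ew).
  by move=> F'; rewrite inE => /eqP ->; exists 3%N; apply: ec_equation_homog.
case: (boolp.pselect (proj_nz (fun b => mmap ji (cat_coords (fun b => j (s (q b))) w) (G b)))); last first.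
  move=> nz; exists 0 => b; rewrite evalE mul0r; apply/eqP; rewrite mulf_eq0; apply/orP; right.
  by apply: contraT => nb; case: nz; exists b.
move=> nz; have e1 := GE _ _ (hsq s) hw nz.
have e2 : proj_eq (mu' (fun b => j (s (q b))) w) (transfer v).
  apply: proj_eq_trans (transfer_gal s hv).
  by apply: (phs_wd hW) => //; apply: proj_eq_refl.
have [l l0 tE] := proj_eqE (proj_eq_sym (proj_eq_trans e1 e2)).
exists (w cc * l) => b; rewrite evalE.
by have /(congr1 (fun h => h b)) /= -> := tE; rewrite mulrA.
Qed.

End Morphism.

Theorem phs_isomorphic (V W : pvar k)
    (mu : pcoords V K -> pcoords E K -> pcoords V K)
    (mu' : pcoords W K -> pcoords E K -> pcoords W K) (xi : H1 i (on_ec (i c))) :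
  is_phs i j mu -> is_phs i j mu' -> phs_class j mu xi -> phs_class j mu' xi ->
  isomorphic ji V W.
Proof.
move=> hV hW cV cW; have [a xiE] := svalP xi.
have [p hp pE] := phs_base hK n2 n3 c0 hV xiE cV.
have [q hq qE] := phs_base hK n2 n3 c0 hW xiE cW.
case: (hV) => _ _ _ _ [nu hnu hmn]; case: (hW) => _ _ _ _ [nu' hnu' hmn'].
have ha := cocycle_in a.
have hjp : on_pvar ji (V := V) (fun b => j (p b)) by apply: (proj1 (on_pvar_map i j _)).
have hjq : on_pvar ji (V := W) (fun b => j (q b)) by apply: (proj1 (on_pvar_map i j _)).
(* Stated for arbitrary spaces so that it yields both composites: differences from the base points
   are preserved in each direction. *)
have inv (V1 W1 : pvar k) (mu1 : pcoords V1 K -> pcoords E K -> pcoords V1 K)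
    (mu2 : pcoords W1 K -> pcoords E K -> pcoords W1 K) nu1 nu2 p1 q1 :
    is_phs i j mu1 -> is_phs i j mu2 -> morphism2 ji nu1 -> morphism2 ji nu2 ->
    (forall p q, on_pvar ji p -> on_pvar ji q -> proj_eq (mu1 p (nu1 p q)) q) ->
    (forall p q, on_pvar ji p -> on_pvar ji q -> proj_eq (mu2 p (nu2 p q)) q) ->
    on_pvar i p1 -> on_pvar i q1 -> forall v, on_pvar ji v ->
    proj_eq (transfer mu1 nu2 q1 p1 (transfer mu2 nu1 p1 q1 v)) v.
  move=> h1 h2 hn1 hn2 hm1 hm2 hp1 hq1 v hv.
  have hjp1 : on_pvar ji (V := V1) (fun b => j (p1 b)) by apply: (proj1 (on_pvar_map i j _)).
  have hjq1 : on_pvar ji (V := W1) (fun b => j (q1 b)) by apply: (proj1 (on_pvar_map i j _)).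
  have [Q hQ [eQ mQ]] := phs_diff h1 hn1 hm1 hjp1 hv.
  have ht := transfer_on h2 hn1 hp1 hq1 hv.
  have [R hR [eR mR]] := phs_diff h2 hn2 hm2 hjq1 ht.
  have hnv : on_pvar ji (V := E) (nu1 (fun b => j (p1 b)) v) by case: (hn1 _ _ hjp1 hv).
  have hnt : on_pvar ji (V := E) (nu2 (fun b => j (q1 b)) (transfer mu2 nu1 p1 q1 v)).
    by case: (hn2 _ _ hjq1 ht).
  have QR : R = Q.
    apply: (phs_uniq h2 hjq1) => //; apply: proj_eq_trans mR _.
    apply: (phs_wd h2) => //; [exact: ec_coords_on | exact: proj_eq_refl | exact: proj_eq_sym].
  subst R; apply: proj_eq_trans mQ; apply: (phs_wd h1) => //.
  - exact: ec_coords_on.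
  - exact: proj_eq_refl.
  - exact: proj_eq_sym.
exists (transfer mu' nu p q), (transfer mu nu' q p); split.
- exact: (transfer_morphism hV hW hnu hmn ha hp hq pE qE).
- exact: (transfer_morphism hW hV hnu' hmn' ha hq hp qE pE).
- by move=> v hv; apply: (inv _ _ _ _ nu nu' p q hV hW).
- by move=> v hv; apply: (inv _ _ _ _ nu' nu q p hW hV).
Qed.

End Transfer.

(** * Cocycles and cubic forms *)

(* The binary cubic form [A X^3 + 3 B X^2 Y + 3 C X Y^2 + D Y^3]. *)
Record cubic_form (R : Type) := CubicForm { cfA : R; cfB : R; cfC : R; cfD : R }.

Definition cubic_form_map (R S : Type) (f : R -> S) (q : cubic_form R) :=
  CubicForm (f (cfA q)) (f (cfB q)) (f (cfC q)) (f (cfD q)).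

Definition cubic_form_comp (R : comNzRingType) (f : cubic_form R) (M : mat2 R) : cubic_form R :=
  let: CubicForm A B C D := f in let: Mat2 p q r s := M in
  CubicForm
    (A * p ^+ 3 + 3%:R * B * (p ^+ 2 * r) + 3%:R * C * (p * r ^+ 2) + D * r ^+ 3)
    (A * p ^+ 2 * q + B * (p ^+ 2 * s + 2%:R * p * q * r)
       + C * (2%:R * p * r * s + q * r ^+ 2) + D * r ^+ 2 * s)
    (A * p * q ^+ 2 + B * (q ^+ 2 * r + 2%:R * p * q * s)
       + C * (2%:R * q * r * s + p * s ^+ 2) + D * r * s ^+ 2)
    (A * q ^+ 3 + 3%:R * B * (q ^+ 2 * s) + 3%:R * C * (q * s ^+ 2) + D * s ^+ 3).

Lemma cubic_form_compA (R : comNzRingType) (f : cubic_form R) M N :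
  cubic_form_comp (cubic_form_comp f M) N = cubic_form_comp f (mat2_mul M N).
Proof. by case: f M N => ? ? ? ? [? ? ? ?] [? ? ? ?]; rewrite /=; congr CubicForm; ring. Qed.

Lemma cubic_form_comp1 (R : comNzRingType) (f : cubic_form R) :
  cubic_form_comp f (mat2_one R) = f.
Proof. by case: f => ? ? ? ?; rewrite /=; congr CubicForm; ring. Qed.

Lemma cubic_form_comp_map (R S : comNzRingType) (h : {rmorphism R -> S}) f M :
  cubic_form_map h (cubic_form_comp f M) = cubic_form_comp (cubic_form_map h f) (mat2_map h M).
Proof.
case: f M => ? ? ? ? [? ? ? ?]; rewrite /cubic_form_map /=; congr CubicForm;
by rewrite /= !(rmorph_nat, rmorphXn, rmorphM, rmorphD).
Qed.

Definition cubic_form_disc (F : fieldType) (f : cubic_form F) :=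
  disc_f (cfA f) (cfB f) (cfC f) (cfD f).

Lemma cubic_form_disc_map (F G : fieldType) (h : {rmorphism F -> G}) f :
  cubic_form_disc (cubic_form_map h f) = h (cubic_form_disc f).
Proof.
by rewrite /cubic_form_disc /disc_f /= !(rmorph_nat, fmorphV, rmorphXn, rmorphM, rmorphB).
Qed.

(** The form [Y^2 Z - c Z^3]; the inverse of 3 compensates the factor 3 built into the middle
    coefficients. *)
Definition ec_form (F : fieldType) (c : F) : cubic_form F := CubicForm 0 3%:R^-1 0 (- c).

Section Forms.
Variables (F : fieldType) (c s : F).
Hypotheses (n2 : 2%:R != 0 :> F) (n3 : 3%:R != 0 :> F) (c0 : c != 0) (hs : s ^+ 2 = c).

(** An invariant of degree 4 of binary cubics has weight [4 * 3 / 2 = 6]; this is the source of the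
    sixth powers. *)
Lemma cubic_form_disc_comp (f : cubic_form F) M :
  cubic_form_disc (cubic_form_comp f M) = cubic_form_disc f * mat2_det M ^+ 6.
Proof.
by case: f M => ? ? ? ? [? ? ? ?]; rewrite /cubic_form_disc /disc_f /mat2_det /=; field.
Qed.

Lemma ec_form_disc : cubic_form_disc (ec_form c) = - c / 27%:R.
Proof.
have n27 : 27%:R != 0 :> F by rewrite -[27%N]/(3 ^ 3)%N natrX expf_neq0.
by rewrite /cubic_form_disc /disc_f /=; field; rewrite ?n2 ?n3 ?n27.
Qed.

Lemma cubic_trivial_comp A B C D M :
  cubic_form_comp (CubicForm A B C D) M = ec_form c -> cubic_trivial c A B C D M.
Proof.
case: M => p q r t [e1 e2 e3 e4]; split; rewrite /= /cubic //.
- by rewrite e2; field.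
- by rewrite e3 mulr0.
Qed.

Lemma ec_form_transl t : ec_T s t -> cubic_form_comp (ec_form c) (transl t) = ec_form c.
Proof.
case/(ec_TP c0 hs) => [->|[r -> [hr r0]]]; first by rewrite cubic_form_comp1.
by rewrite /=; congr CubicForm; field: hr; rewrite ?n2 ?n3 ?r0.
Qed.

Lemma transl_add t t' : ec_T s t -> ec_T s t' ->
  transl (ec_add t t') = mat2_mul (transl t) (transl t').
Proof.
case/(ec_TP c0 hs) => [->|[r -> [hr r0]]]; first by rewrite mat2_1mul.
case/(ec_TP c0 hs) => [->|[r' -> [hr' r0']]]; first by rewrite ec_add0 mat2_mul1.
have /orP[/eqP e|/eqP e] : (r' == r) || (r' == - r) by rewrite -eqf_sqr hr hr'.
  subst r'; rewrite /ec_add eqxx /=.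
  case: eqP => [e|_].
    by case/eqP: r0; apply: (mulfI n2); rewrite mulr0 mulr_natl mulr2n {1}e addNr.
  rewrite expr0n /= !(mulr0, mul0r) sub0r.
  by rewrite /mat2_mul /=; congr Mat2; field; rewrite ?n2 ?n3 ?oppr_eq0 ?r0.
subst r'; rewrite /ec_add eqxx opprK eqxx /=.
by rewrite /mat2_mul /mat2_one /=; congr Mat2; field; rewrite ?n2 ?n3 ?oppr_eq0 ?r0.
Qed.

Lemma ec_T_add t t' : ec_T s t -> ec_T s t' -> ec_T s (ec_add t t').
Proof.
have aff r : r ^+ 2 = c -> ec_T s (Affine 0 r).
  rewrite -hs => /eqP; rewrite eqf_sqr => /orP[] /eqP ->.
    by constructor 2.
  by constructor 3.
case/(ec_TP c0 hs) => [->|[r -> [hr r0]]] ht'; first by [].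
case/(ec_TP c0 hs): ht' => [->|[r' -> [hr' r0']]]; first by rewrite ec_add0; apply: aff.
have /orP[/eqP e|/eqP e] : (r' == r) || (r' == - r) by rewrite -eqf_sqr hr hr'.
  subst r'; rewrite /ec_add eqxx /=; case: eqP => [_|_]; first by constructor 1.
  rewrite !(expr0n, mulr0, mul0r, subr0, sub0r) /=.
  by apply: aff; rewrite sqrrN.
by subst r'; rewrite /ec_add eqxx opprK eqxx /=; constructor 1.
Qed.

(** The coefficients are solved by hand. The first equation gives [r = 0], which leads to the
    identity, or [p ^+ 2 = c * r ^+ 2]; in the second case the determinant and the other equations
    force [p = t = - 1 / 2]. *)
Lemma ec_form_stab M : mat2_det M = 1 -> cubic_form_comp (ec_form c) M = ec_form c ->
  exists2 t, ec_T s t & M = transl t.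
Proof.
case: M => p q r t; rewrite /mat2_det /= => hd [].
rewrite !(mul0r, mulr0, add0r, addr0) !mulfV // !mul1r => e1 e2 e3 e4.
have {}e2 : p ^+ 2 * t + 2%:R * p * q * r - 3%:R * c * r ^+ 2 * t = 1.
  by rewrite -(mulfV n3) -[in RHS]e2; field.
have {}e3 : q ^+ 2 * r + 2%:R * p * q * t - 3%:R * c * r * t ^+ 2 = 0.
  by rewrite -(mulr0 3%:R) -[in RHS]e3; field.
case: (eqVneq r 0) => [r0|r0].
  subst r; exists Infty; first by constructor 1.
  have pt : p * t = 1 by rewrite -[RHS]hd; ring.
  have p1 : p = 1.
    have : p * (p * t) = 1 by rewrite -[RHS]e2; ring.
    by rewrite pt mulr1.
  have t1 : t = 1 by rewrite -pt p1 mul1r.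
  have q0 : q = 0.
    by apply: (mulfI n2); rewrite mulr0 -e3 p1 t1; ring.
  by rewrite /mat2_one p1 t1 q0.
have hp : p ^+ 2 = c * r ^+ 2.
  apply: (mulIf r0); apply/eqP; rewrite -subr_eq0; apply/eqP; rewrite -[RHS]e1.
  by ring.
have p1 : 2%:R * p = - 1.
  have : - (2%:R * p) * (p * t - q * r) = 1 by rewrite -[RHS]e2; ring: hp.
  by rewrite hd mulr1 => e; rewrite -[LHS]opprK e.
have hqr : 2%:R * (q * r) = - t - 2%:R.
  have -> : q * r = p * t - 1 by rewrite -[X in _ - X]hd; ring.
  by rewrite mulrBr mulrA p1; ring.
have hr : 4%:R * (c * r ^+ 2) = 1.
  rewrite -hp; transitivity ((2%:R * p) ^+ 2); first by ring.
  by rewrite p1 sqrrN expr1n.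
have ht : 2%:R * t = - 1.
  (* After multiplication by [4 r] everything is expressed through [2 q r], [2 p] and [4 c r^2], all
     known in terms of [t]; the quadratic terms cancel and [8 t + 4 = 0] remains. *)
  have : 4%:R * r * (q ^+ 2 * r + 2%:R * p * q * t - 3%:R * c * r * t ^+ 2) = 0.
    by rewrite e3 mulr0.
  have -> : 4%:R * r * (q ^+ 2 * r + 2%:R * p * q * t - 3%:R * c * r * t ^+ 2)
    = (2%:R * (q * r)) ^+ 2 + 2%:R * (2%:R * p) * (2%:R * (q * r)) * t
      - 3%:R * (4%:R * (c * r ^+ 2)) * t ^+ 2 by ring.
  rewrite hqr p1 hr => h; apply: (mulfI (mulf_neq0 n2 n2)); apply/eqP; rewrite -subr_eq0; apply/eqP.
  by rewrite -[RHS]h; ring.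
have hq : 4%:R * (q * r) = - 3%:R.
  have -> : 4%:R * (q * r) = 2%:R * (2%:R * (q * r)) by ring.
  by rewrite hqr mulrBr mulrN ht; ring.
have n4 : 4%:R != 0 :> F by rewrite -[4%N]/(2 ^ 2)%N natrX expf_neq0.
(* The ordinate is found by equating [r] with the lower left entry of [transl]. *)
exists (Affine 0 (- (2%:R * r)^-1)).
  have /orP[/eqP ->|/eqP ->] : (- (2%:R * r)^-1 == s) || (- (2%:R * r)^-1 == - s).
    rewrite -eqf_sqr hs; apply/eqP; apply: (mulIf (mulf_neq0 n4 (expf_neq0 2 r0))).
    have -> : c * (4%:R * r ^+ 2) = 1 by rewrite -[RHS]hr; ring.
    by field; rewrite ?n2 ?r0.
  - by constructor 2.
  - by constructor 3.
rewrite /=; congr Mat2.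
- by apply: (mulfI n2); rewrite p1; field.
- by apply: (mulIf (mulf_neq0 n4 r0)); transitivity (4%:R * (q * r)); [ring | rewrite hq; field; rewrite ?n2 ?r0].
- by rewrite mulrN invrN opprK invfM invrK mulKf.
- by apply: (mulfI n2); rewrite ht; field.
Qed.

End Forms.

(** * Interpolation on conjugates and Hilbert 90 *)

Lemma mpoly_interpolation (F : fieldType) n (L : seq F) (h : ('I_n -> F) -> F) : uniq L ->
  exists P : {mpoly F[n]}, forall v, (forall u, v u \in L) -> P.@[v] = h v.
Proof.
move=> uL; pose m := size L; pose x (a : 'I_m) := L`_a.
have xinj : injective x.
  by move=> a b /eqP; rewrite nth_uniq // => /eqP /val_inj.
pose pt (f : {ffun 'I_n -> 'I_m}) (u : 'I_n) : F := x (f u).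
(* Lagrange basis of the grid of vectors with entries in [L]: 1 at the grid point of [f] and 0 at
   all others. *)
pose P (f : {ffun 'I_n -> 'I_m}) : {mpoly F[n]} :=
  \prod_u \prod_(a | a != f u) ((pt f u - x a)^-1 *: ('X_u - (x a)%:MP)).
have PE f g : (P f).@[pt g] = (f == g)%:R.
  rewrite /P (rmorph_prod (meval (pt g))) /=.
  have E u : (\prod_(a | a != f u) ((pt f u - x a)^-1 *: ('X_u - (x a)%:MP))).@[pt g]
      = (f u == g u)%:R.
    rewrite (rmorph_prod (meval (pt g))) /=; case: eqP => [e|/eqP ne].
      apply: big1 => a na; rewrite mevalZ mevalB mevalXU mevalC /pt -e mulVf //.
      by rewrite subr_eq0 (inj_eq xinj) eq_sym.
    rewrite (bigD1 (g u)) 1?eq_sym //= mevalZ mevalB mevalXU mevalC /pt subrr mulr0.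
    by rewrite mul0r.
  under eq_bigr do rewrite E.
  case: eqP => [->|ne]; first by apply: big1 => u _; rewrite eqxx.
  have [u nu] : exists u, f u != g u.
    apply: boolp.contrapT => hh; apply: ne; apply/ffunP => u; apply/eqP.
    by apply: contraT => nu; case: hh; exists u.
  by rewrite (bigD1 u) //= (negbTE nu) mul0r.
exists (\sum_f h (pt f) *: P f) => v hv.
have hi u : (index (v u) L < m)%N by rewrite index_mem.
pose g : {ffun 'I_n -> 'I_m} := [ffun u => Ordinal (hi u)].
have vE : v = pt g.
  by apply: boolp.funext => u; rewrite /pt ffunE /x /= nth_index.
rewrite vE (rmorph_sum (meval (pt g))) (bigD1 g) //= mevalZ PE eqxx mulr1 big1 ?addr0 //.
by move=> f nf; rewrite mevalZ PE (negbTE nf) mulr0.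
Qed.

Section Gal.
Variables (k ks : fieldType) (i : {rmorphism k -> ks}).
Hypothesis hks : separable_closure i.

Lemma gal_inv (s : gal i) : exists t : gal i, cancel s t /\ cancel t s.
Proof.
have [g sg gs] := gal_bij s.
have gB : {morph g : x y / x - y}.
  by move=> x y; apply: (can_inj sg); rewrite rmorphB /= !gs.
have gM : {morph g : x y / x * y}.
  by move=> x y; apply: (can_inj sg); rewrite rmorphM /= !gs.
have g1 : g 1 = 1 by apply: (can_inj sg); rewrite gs rmorph1.
have [t tE] := gal_of_endo hks (f := mk_rmorphism gB gM g1) (fun a => etrans (congr1 g (esym (gal_fix s a))) (sg _)).
by exists t; split=> x; rewrite tE /= ?sg ?gs.
Qed.

(** All conjugates of the given elements are roots of one polynomial over [k], the product of
    polynomials vanishing at each of them. *)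
Lemma conjugates_list n (r : 'I_n -> ks) :
  exists L : seq ks, uniq L /\ forall (s : gal i) u, s (r u) \in L.
Proof.
have h u : exists2 p : {poly k}, p != 0 & root (map_poly i p) (r u).
  by have [p sp rp] := hks.1 (r u); exists p => //; apply: separable_poly_neq0.
pose p u := s2val (boolp.cid2 (h u)).
have p0 u : p u != 0 := s2valP (boolp.cid2 (h u)).
have pr u : root (map_poly i (p u)) (r u) := s2valP' (boolp.cid2 (h u)).
pose P := \prod_u p u.
have P0 : map_poly i P != 0 by rewrite map_poly_eq0; apply/prodf_neq0.
have [L [_ uL rL]] := poly_roots P0; exists L; split=> // s u; apply: rL.
have -> : map_poly i P = map_poly s (map_poly i P).
  by apply/polyP => v; rewrite !coef_map /= gal_fix.
rewrite rmorph_root // /P rmorph_prod /= (bigD1 u) //= rootM pr //.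
Qed.

End Gal.

Section Hilbert90.
Variables (k ks : fieldType) (i : {rmorphism k -> ks}).
Hypothesis hks : separable_closure i.
Hypothesis n2 : 2%:R != 0 :> ks.
Variables (c : k) (c0 : i c != 0) (sqrtc : ks) (hs : sqrtc ^+ 2 = i c).

Lemma ec_T_gal (s : gal i) t : ec_T sqrtc t -> ec_T sqrtc (ec_map s t).
Proof.
have /orP[/eqP e|/eqP e] : (s sqrtc == sqrtc) || (s sqrtc == - sqrtc).
- by rewrite -eqf_sqr -rmorphXn hs gal_fix.
- by case=> -> /=; rewrite ?rmorph0 ?rmorphN ?e;
    [constructor 1 | constructor 2 | constructor 3].
- by case=> -> /=; rewrite ?rmorph0 ?rmorphN ?e ?opprK;
    [constructor 1 | constructor 3 | constructor 2].
Qed.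

Variable a : cocycle i (ec_T sqrtc).
Let M (s : gal i) := transl (a s).

Lemma transl_cocycle s t : M (gal_mul s t) = mat2_mul (M s) (mat2_map s (M t)).
Proof.
rewrite /M cocycleM (transl_add n2 c0 hs) ?map_transl //; first exact: cocycle_in.
by apply: ec_T_gal; apply: cocycle_in.
Qed.

Lemma cochain_ext (s t : gal i) : s =1 t -> a s = a t.
Proof. by move=> e; have [r hr] := cocycle_cont a t; apply: hr => x _; rewrite e. Qed.

Lemma id_bij : bijective (idfun : {rmorphism ks -> ks}).
Proof. by exists idfun. Qed.
Let one : gal i := @Defs.Gal k ks i idfun id_bij (fun a => erefl).

Lemma mat2_map_id N : mat2_map one N = N. Proof. by case: N. Qed.

Lemma transl_cocycle1 : M one = mat2_one ks.
Proof.
have e : M one = mat2_mul (M one) (M one).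
  by rewrite -[in X in mat2_mul _ X](mat2_map_id (M one)) -transl_cocycle /M; congr transl; apply: cochain_ext.
have h := transl_opp' n2 c0 hs (cocycle_in a one).
by rewrite -[LHS]mat2_1mul -[X in mat2_mul X _]h mat2_mulA -/(M one) -e.
Qed.

(** Continuity at the identity is enough: if [s] and [t] agree on [r], then [s^-1 t] fixes [r], and
    the cocycle relation for [t = s (s^-1 t)] gives [M t = M s]. *)
Lemma cocycle_uniform : exists r : seq ks,
  forall s t : gal i, {in r, s =1 t} -> M s = M t.
Proof.
have [r hr] := cocycle_cont a one; exists r => s t st.
have [s' [ss' s's]] := gal_inv hks s.
have h : M (gal_mul s' t) = mat2_one ks.
  rewrite -transl_cocycle1 /M; congr transl; apply: hr => x hx.
  by rewrite /= -st // ss'.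
have -> : M t = M (gal_mul s (gal_mul s' t)).
  by rewrite /M; congr transl; apply: cochain_ext => x; rewrite /= s's.
by rewrite transl_cocycle h mat2_map_one mat2_mul1.
Qed.

Definition row_act (v : ks * ks) (N : mat2 ks) : ks * ks :=
  (v.1 * m11 N + v.2 * m21 N, v.1 * m12 N + v.2 * m22 N).

Lemma row_act_mul v N P : row_act (row_act v N) P = row_act v (mat2_mul N P).
Proof. by rewrite /row_act /mat2_mul /=; congr pair; ring. Qed.

Definition pair_coord (v : ks * ks) (b : 'I_2) := if b == 0 then v.1 else v.2.

(* The rows [g(r)] of interpolation polynomials [g] with [g(s r) = l * M s] for all [s] form
   a space with a semilinear Galois action; its rational points give the rows sought. *)
Lemma hilbert90_row (l u : ks * ks) : u.1 * l.1 + u.2 * l.2 != 0 ->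
  exists v : ks * ks, (forall s : gal i, (s v.1, s v.2) = row_act v (M s)) /\
    u.1 * v.1 + u.2 * v.2 != 0.
Proof.
move=> ul; have [r hr] := cocycle_uniform.
pose n := size r; pose x (w : 'I_n) := r`_w.
have [L [uL hL]] := conjugates_list hks x.
pose pt (s : gal i) (w : 'I_n) := s (x w).
have ptM s t : pt s = pt t -> M s = M t.
  move=> e; apply: hr => y /(nthP 0) [w hw <-].
  by have /(congr1 (fun f => f (Ordinal hw))) := e.
(* [M s] depends only on the conjugate vector [pt s], so the value is well defined on conjugates;
   the default 0 elsewhere is never looked at. *)
pose h b (v : 'I_n -> ks) : ks :=
  if boolp.pselect (exists s, v = pt s) is left ex
  then pair_coord (row_act l (M (projT1 (boolp.cid ex)))) b else 0.
have hE b s : h b (pt s) = pair_coord (row_act l (M s)) b.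
  rewrite /h; case: boolp.pselect => [ex|nex]; last by case: nex; exists s.
  by rewrite (ptM _ _ (projT2 (boolp.cid ex))).
pose F0 b := projT1 (boolp.cid (mpoly_interpolation (h b) uL)).
have F0E b s : (F0 b).@[pt s] = pair_coord (row_act l (M s)) b.
  by rewrite -hE; apply: (projT2 (boolp.cid (mpoly_interpolation (h b) uL))) => w; apply: hL.
pose S (F : 'I_2 -> {mpoly ks[n]}) :=
  exists l', forall s b, (F b).@[pt s] = pair_coord (row_act l' (M s)) b.
(* At the identity the tuple takes the row [l'] itself as value; the functional [u], nonzero on [l],
   detects that the descended row is not degenerate. *)
pose Q (F : 'I_2 -> {mpoly ks[n]}) :=
  u.1 * (F 0).@[pt one] + u.2 * (F 1).@[pt one] = 0.
have [|||| G [[v vE] nQ]] := @galois_descent _ _ i hks 2 n S Q F0.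
- split.
    by exists (0, 0) => s b; rewrite meval0 /row_act /pair_coord /=; case: ifP => _; ring.
  move=> d F G [v vE] [w wE]; exists (d * v.1 + w.1, d * v.2 + w.2) => s b.
  by rewrite mevalD mevalZ vE wE /pair_coord /row_act /=; case: ifP => _; ring.
- split; first by rewrite /Q !meval0 !mulr0 addr0.
  move=> d F G; rewrite /Q => hF hG; rewrite !mevalD !mevalZ.
  transitivity (d * (u.1 * (F 0).@[pt one] + u.2 * (F 1).@[pt one])
    + (u.1 * (G 0).@[pt one] + u.2 * (G 1).@[pt one])); first by ring.
  by rewrite hF hG mulr0 addr0.
(* Conjugating by [t] replaces [l] by [t(l) M_t^-1], because [M s = M t * t(M (t^-1 s))]. *)
- move=> t; exists (row_act (t l.1, t l.2) (transl (ec_opp (a t)))) => s b.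
  have [t' [tt' t't]] := gal_inv hks t.
  have -> : pt s = fun w => t (pt (gal_mul t' s) w).
    by apply: boolp.funext => w; rewrite /pt /= t't.
  have mapE (F : {mpoly ks[n]}) v : (map_mpoly t F).@[fun w => t (v w)] = t F.@[v].
    by rewrite /meval mmap_map (rmorph_mmap idfun t).
  rewrite /map_tup mapE F0E.
  have -> : M s = mat2_mul (M t) (mat2_map t (M (gal_mul t' s))).
    by rewrite -transl_cocycle /M; congr transl; apply: cochain_ext => y; rewrite /= t't.
  rewrite row_act_mul -mat2_mulA (transl_opp' n2 c0 hs (cocycle_in a t)) mat2_1mul.
  by rewrite /pair_coord /row_act /=; case: ifP => _; rewrite rmorphD !rmorphM.
- rewrite /Q !F0E transl_cocycle1 /pair_coord /row_act /= !(mulr0, mulr1, addr0, add0r).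
  exact/eqP.
have vE1 b : (map_tup i G b).@[pt one] = pair_coord v b.
  rewrite vE transl_cocycle1; case: (v) => v1 v2.
  by rewrite /pair_coord /row_act /= !(mulr0, mulr1, addr0, add0r).
exists v; split; last by apply/eqP; move: nQ; rewrite /Q !vE1.
move=> s; have sE b : s (pair_coord v b) = pair_coord (row_act v (M s)) b.
  rewrite -vE1 -vE /map_tup /meval (rmorph_mmap idfun s) !mmap_map /mmap.
  apply: eq_bigr => w _ /=; rewrite gal_fix; congr (_ * _).
have e0 : s v.1 = (row_act v (M s)).1 := sE 0.
have e1 : s v.2 = (row_act v (M s)).2 := sE 1.
by rewrite e0 e1.
Qed.

Theorem hilbert90 : exists N : mat2 ks, mat2_det N != 0 /\
  forall s : gal i, mat2_map s N = mat2_mul N (transl (a s)).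
Proof.
have [|v [vE v1]] := @hilbert90_row (1, 0) (1, 0); first by rewrite /= mulr1 mulr0 addr0 oner_neq0.
rewrite /= mul1r mul0r addr0 in v1.
(* Evaluated on [w], this functional is the determinant of the matrix with rows [v] and [w]. *)
have [|w [wE w1]] := @hilbert90_row (0, 1) (- v.2, v.1).
  by rewrite /= mulr0 mulr1 add0r.
exists (Mat2 v.1 v.2 w.1 w.2); split.
  by move: w1; rewrite /mat2_det /= mulNr addrC [v.2 * _]mulrC mulrC.
move=> s; have [e1 e2] := vE s; have [e3 e4] := wE s.
by rewrite /mat2_map /mat2_mul /= e1 e2 e3 e4.
Qed.

End Hilbert90.

(** * Reduction of a binary cubic form to [Y^2 Z - c Z^3] *)

Section Normalization.
Variables (k ks K : fieldType) (i : {rmorphism k -> ks}) (j : {rmorphism ks -> K}).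
Hypotheses (hks : separable_closure i) (hK : GRing.closed_field_axiom K).
Hypotheses (n2 : 2%:R != 0 :> k) (n3 : 3%:R != 0 :> k).
Variable c : k.
Variables A B C D : k.
Hypothesis disc0 : disc_f A B C D != 0.

Let m2 : 2%:R != 0 :> ks. Proof. by rewrite -(rmorph_nat i) fmorph_eq0. Qed.
Let m3 : 3%:R != 0 :> ks. Proof. by rewrite -(rmorph_nat i) fmorph_eq0. Qed.

Definition dehomog : {poly k} :=
  A *: 'X^3 + (3%:R * B) *: 'X^2 + (3%:R * C) *: 'X + D%:P.

Lemma dehomog_eval (F : fieldType) (f : {rmorphism k -> F}) x :
  (map_poly f dehomog).[x] = cubic (f A) (f B) (f C) (f D) x 1.
Proof.
rewrite /dehomog !rmorphD /= !map_polyZ /= !map_polyXn map_polyX map_polyC.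
by rewrite /cubic !(hornerD, hornerZ, hornerXn, hornerX, hornerC) !rmorphM !rmorph_nat; ring.
Qed.

Lemma deriv_dehomog_eval (F : fieldType) (f : {rmorphism k -> F}) x :
  (map_poly f dehomog^`()).[x] =
  3%:R * (f A * x ^+ 2 + 2%:R * f B * (x * 1) + f C * 1 ^+ 2).
Proof.
rewrite /dehomog !derivD !derivZ !derivXn derivX derivC !rmorphD /= !map_polyZ /= !rmorphMn /=.
rewrite !map_polyXn rmorph1 rmorph0 !(hornerD, hornerZ, hornerMn, hornerXn, hornerC).
by rewrite !rmorphM !rmorph_nat; ring.
Qed.

(** In [ks] only separable polynomials are known to have roots. A common root in [K] of the
    polynomial and its derivative would be a double root of the form, which the discriminant
    excludes. *)
Lemma dehomog_separable : separable_poly (map_poly i dehomog).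
Proof.
rewrite separable_map separable_poly.unlock -(coprimep_map (rcomp j i)) /coprimep.
set g := gcdp _ _.
have gdvd : (g %| map_poly (rcomp j i) dehomog) && (g %| map_poly (rcomp j i) dehomog^`()).
  by rewrite dvdp_gcdl dvdp_gcdr.
have m3K : 3%:R != 0 :> K by rewrite -(rmorph_nat (rcomp j i)) fmorph_eq0.
have noroot x : root g x -> False.
  case/andP: gdvd => /dvdpP [h1 E1] /dvdpP [h2 E2] rx.
  have : root (map_poly (rcomp j i) dehomog) x by rewrite E1 rootM rx orbT.
  have : root (map_poly (rcomp j i) dehomog^`()) x by rewrite E2 rootM rx orbT.
  rewrite /root dehomog_eval deriv_dehomog_eval mulf_eq0 (negbTE m3K) => /eqP e1 /eqP e2.
  have [|_ /eqP] := cubic_no_double_root n2 disc0 e1; last by rewrite oner_eq0.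
  (* Euler's relation at [y = 1]: with both partial derivatives divided by 3, the form is [x] times
     the first plus the second. *)
  transitivity (cubic (rcomp j i A) (rcomp j i B) (rcomp j i C) (rcomp j i D) x 1
    - x * ((rcomp j i) A * x ^+ 2 + 2%:R * (rcomp j i) B * (x * 1) + (rcomp j i) C * 1 ^+ 2)).
    by rewrite /cubic; ring.
  by rewrite e1 e2 mulr0 subr0.
case: ltngtP => // sg; last first.
  by have [x /noroot] := closed_root hK sg.
move: sg; rewrite ltnS leqn0 size_poly_eq0 => /eqP g0.
by case: (noroot 0); rewrite g0 root0.
Qed.

Lemma cubic_root : A != 0 -> exists x : ks, cubic (i A) (i B) (i C) (i D) x 1 = 0.
Proof.
move=> A0; have [|x /eqP] := hks.2 _ dehomog_separable; last by rewrite dehomog_eval; exists x.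
rewrite size_map_poly /dehomog -!addrA size_polyDl size_scale ?size_polyXn //.
have h (a : k) n : (size (a *: 'X^n) <= n.+1)%N.
  by apply: leq_trans (size_scale_leq _ _) _; rewrite size_polyXn.
rewrite ltnS; apply: leq_trans (size_polyD _ _) _; rewrite geq_max h /=.
apply: leq_trans (size_polyD _ _) _; rewrite geq_max -['X]expr1 (leq_trans (h _ _)) //=.
by rewrite (leq_trans (size_polyC_leq1 _)).
Qed.

Let f : cubic_form ks := CubicForm (i A) (i B) (i C) (i D).

Lemma disc_f0 : cubic_form_disc f != 0.
Proof.
have -> : f = cubic_form_map i (CubicForm A B C D) by [].
by rewrite cubic_form_disc_map fmorph_eq0.
Qed.

Lemma cubic_move_root : exists U, mat2_det U = 1 /\ cfA (cubic_form_comp f U) = 0.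
Proof.
case: (eqVneq A 0) => [A0|/cubic_root [x xE]].
  exists (mat2_one ks); rewrite cubic_form_comp1 /= A0 rmorph0; split=> //.
  by rewrite /mat2_det /=; ring.
(* The first column sends [(1, 0)] to the root [(x, 1)]; the second column makes the determinant
   1. *)
exists (Mat2 x (-1) 1 0); split; first by rewrite /mat2_det /=; ring.
by rewrite /= -[RHS]xE /cubic; ring.
Qed.

Lemma cubic_depress : exists U b d,
  [/\ mat2_det U = 1, b != 0 & cubic_form_comp f U = CubicForm 0 b 0 d].
Proof.
have [U [dU]] := cubic_move_root.
have : cubic_form_disc (cubic_form_comp f U) != 0.
  by rewrite cubic_form_disc_comp // dU expr1n mulr1 disc_f0.
case e : (cubic_form_comp f U) => [a b c' d] /= hd a0; subst a.
have b0 : b != 0.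
  apply: contraNneq hd => b0; rewrite /cubic_form_disc /disc_f /= b0; apply/eqP; field.
  by [].
(* With a root at infinity the form is [Y] times a quadratic in [X]; completing its square removes
   the coefficient [c']. Here [b] is nonzero since otherwise [Y ^+ 2] would divide the form. *)
pose H := Mat2 1 (- c' / (2%:R * b)) 0 1; pose d' := cfD (cubic_form_comp (CubicForm 0 b c' d) H).
have E : cubic_form_comp f (mat2_mul U H) = CubicForm 0 b 0 d'.
  rewrite -cubic_form_compA e /H /d' /=; congr CubicForm; try ring.
  by field; rewrite ?m2 ?b0.
exists (mat2_mul U H), b, d'; split=> //.
by rewrite -[RHS]dU /mat2_det /=; ring.
Qed.

Lemma cubic_normalize (u : k) : u != 0 -> disc_f A B C D = (- c / 27%:R) * u ^+ 6 ->
  exists N, mat2_det N = i u^-1 /\ cubic_form_comp f N = ec_form (i c).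
Proof.
move=> u0 hu; have [U [b [d [dU b0 eU]]]] := cubic_depress.
have w0 : i u != 0 by rewrite fmorph_eq0.
have n27 : 27%:R != 0 :> ks by rewrite -[27%N]/(3 ^ 3)%N natrX expf_neq0.
have bd : 27%:R * (b ^+ 3 * d) = - i c * i u ^+ 6.
  have : cubic_form_disc (cubic_form_comp f U) = i (- c / 27%:R * u ^+ 6).
    rewrite cubic_form_disc_comp // dU expr1n mulr1 -hu -[RHS]/(i (cubic_form_disc (CubicForm A B C D))).
    by rewrite -cubic_form_disc_map.
  rewrite eU rmorphM rmorphXn fmorph_div rmorphN rmorph_nat.
  have -> : cubic_form_disc (CubicForm 0 b 0 d) = b ^+ 3 * d.
    by rewrite /cubic_form_disc /disc_f /=; field; rewrite ?m2.
  by move=> ->; field; rewrite ?n27.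
(* The diagonal entries are determined by the determinant [u^-1] and the requirement that [b] become
   the inverse of 3; the last coefficient is then right by the discriminant, which is
   [b ^+ 3 * d]. *)
exists (mat2_mul U (Mat2 (i u / (3%:R * b)) 0 0 (3%:R * b / i u ^+ 2))); split.
  rewrite fmorphV; transitivity (mat2_det U * (i u)^-1); last by rewrite dU mul1r.
  by rewrite /mat2_det /=; field; rewrite ?m3 ?b0 ?w0.
rewrite -cubic_form_compA eU /= /ec_form; congr CubicForm; try ring.
  by field; rewrite ?m3 ?b0 ?w0.
transitivity (27%:R * (b ^+ 3 * d) / i u ^+ 6); first by field; rewrite ?w0.
by rewrite bd mulfK // expf_neq0.
Qed.

End Normalization.

Lemma mat2_inverse (F : fieldType) (N : mat2 F) : mat2_det N != 0 -> exists N',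
  [/\ mat2_mul N N' = mat2_one F, mat2_mul N' N = mat2_one F & mat2_det N' = (mat2_det N)^-1].
Proof.
case: N => p q r s; rewrite /mat2_det /= => d0; pose d := p * s - q * r.
exists (Mat2 (s / d) (- q / d) (- r / d) (p / d)); split.
- by rewrite /mat2_mul /mat2_one /d /=; congr Mat2; field.
- by rewrite /mat2_mul /mat2_one /d /=; congr Mat2; field.
- by rewrite /d /=; field.
Qed.

Lemma mat2_det_mul (R : comNzRingType) (M N : mat2 R) :
  mat2_det (mat2_mul M N) = mat2_det M * mat2_det N.
Proof. by rewrite /mat2_det /=; ring. Qed.

Lemma mat2_det_map (R S : comNzRingType) (f : {rmorphism R -> S}) M :
  mat2_det (mat2_map f M) = f (mat2_det M).
Proof. by rewrite /mat2_det /= rmorphB !rmorphM. Qed.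

(** * The correspondence between cocycles and cubic forms *)

Section Classes.
Variables (k ks K : fieldType) (i : {rmorphism k -> ks}) (j : {rmorphism ks -> K}).
Hypotheses (hks : separable_closure i) (hK : GRing.closed_field_axiom K).
Hypotheses (n2 : 2%:R != 0 :> k) (n3 : 3%:R != 0 :> k).
Variables (c : k) (c0 : c != 0) (sqrtc : ks) (hs : sqrtc ^+ 2 = i c).

Let m2 : 2%:R != 0 :> ks. Proof. by rewrite -(rmorph_nat i) fmorph_eq0. Qed.
Let m3 : 3%:R != 0 :> ks. Proof. by rewrite -(rmorph_nat i) fmorph_eq0. Qed.
Let ic0 : i c != 0. Proof. by rewrite fmorph_eq0. Qed.

Lemma cohomologous_refl (S : ecpoint ks -> Prop) (a : cocycle i S) :
  S Infty -> cohomologous a a.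
Proof. by exists Infty => // s; rewrite ec_add0. Qed.

Lemma H1_reprE (S : ecpoint ks -> Prop) (xi : H1 i S) : sval xi = cohomologous (H1_repr xi).
Proof.
by rewrite /H1_repr; case: ClassicalEpsilon.constructive_indefinite_description.
Qed.

(** [Psi] is computed on a chosen representative; another cocycle of the same class has its image in
    the same class, by the coboundary of the same point [P]. *)
Lemma Psi_mem (a : cocycle i (ec_T sqrtc)) (eta : H1 i (ec_T sqrtc)) :
  sval eta a -> H1_mem (Psi hs eta) (cocycle_incl (ec_T_on_ec hs) a).
Proof.
rewrite H1_reprE => -[P hP h]; exists P; first exact: ec_T_on_ec hP.
exact: h.
Qed.

Lemma Cf_underlying A B C D (N : mat2 ks) (a : cocycle i (ec_T sqrtc)) eta :
  disc_f A B C D != 0 -> mat2_det N != 0 ->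
  cubic_form_comp (CubicForm (i A) (i B) (i C) (i D)) N = ec_form (i c) ->
  (forall s : gal i, mat2_map s N = mat2_mul N (transl (a s))) -> sval eta a ->
  underlying_curve j (Psi hs eta) (Cf_curve A B C D).
Proof.
move=> d0 dN tN aN ha; have [N' [NN' N'N _]] := mat2_inverse dN.
have triv := cubic_trivial_comp m3 tN.
have tw (s : gal i) : exists2 t, ec_T sqrtc t & mat2_map s N = mat2_mul N (transl t).
  by exists (a s); [apply: cocycle_in | apply: aN].
exists (Cf_mu j N N').
  exact: (Cf_is_phs j hks hK n2 n3 c0 hs NN' N'N triv tw d0).
apply: (Cf_class j n2 c0 hs N'N triv (Psi_mem ha)).
- by move=> s; exact: (cocycle_in a s).
- exact: aN.
Qed.

(** Characteristic different from 3 enters twice: [- 1 / 2 = 1] is impossible, and the upper right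
    entry [3 y / 2] determines the ordinate. *)
Lemma transl_inj t t' : ec_T sqrtc t -> ec_T sqrtc t' -> transl t = transl t' -> t = t'.
Proof.
have h : - 2%:R^-1 = 1 :> ks -> False.
  move=> e; case/eqP: m3; have : 2%:R * - 2%:R^-1 = 2%:R * 1 :> ks by rewrite e.
  rewrite mulrN mulfV // mulr1 => e'; transitivity (2%:R + 1 : ks); first by ring.
  by rewrite -e' addNr.
case/(ec_TP ic0 hs) => [->|[r -> _]]; case/(ec_TP ic0 hs) => [->|[r' -> _]] //= [].
- by move/esym/h.
- by move/h.
- move=> /(mulIf (invr_neq0 m2)) /(mulfI m3) -> //.
Qed.

Lemma class_of_form A B C D (N : mat2 ks) d :
  mat2_det N = i d -> d != 0 ->
  cubic_form_comp (CubicForm (i A) (i B) (i C) (i D)) N = ec_form (i c) ->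
  exists a : cocycle i (ec_T sqrtc),
    forall s : gal i, mat2_map s N = mat2_mul N (transl (a s)).
Proof.
move=> dN d0 tN; have dN0 : mat2_det N != 0 by rewrite dN fmorph_eq0.
have [N' [NN' N'N dN']] := mat2_inverse dN0.
have ex (s : gal i) : exists2 t, ec_T sqrtc t & mat2_mul N' (mat2_map s N) = transl t.
  have [||t ht e] := ec_form_stab m2 m3 hs (M := mat2_mul N' (mat2_map s N)).
  - by rewrite mat2_det_mul mat2_det_map dN' dN gal_fix mulVf // fmorph_eq0.
  - rewrite -cubic_form_compA -{1}tN (cubic_form_compA _ N) NN' cubic_form_comp1.
    have -> : CubicForm (i A) (i B) (i C) (i D)
        = cubic_form_map s (CubicForm (i A) (i B) (i C) (i D)).
      by rewrite /cubic_form_map /= !gal_fix.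
    rewrite -cubic_form_comp_map tN /cubic_form_map /=.
    by rewrite rmorph0 fmorphV rmorph_nat rmorphN ?gal_fix.
  - by exists t.
pose a (s : gal i) := s2val (boolp.cid2 (ex s)).
have aT (s : gal i) : ec_T sqrtc (a s) := s2valP (boolp.cid2 (ex s)).
have aE (s : gal i) : mat2_mul N' (mat2_map s N) = transl (a s) := s2valP' (boolp.cid2 (ex s)).
have aN (s : gal i) : mat2_map s N = mat2_mul N (transl (a s)).
  by rewrite -aE -mat2_mulA NN' mat2_1mul.
(* The matrices [N^-1 s(N)] satisfy the cocycle relation formally; injectivity of [transl] carries
   it over to [T]. *)
have aM (s t : gal i) : a (gal_mul s t) = ec_add (a s) (ec_map s (a t)).
  have hst : ec_T sqrtc (ec_map s (a t)) by exact: (ec_T_gal hs s (aT t)).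
  apply: transl_inj => //; first exact: (ec_T_add ic0 hs).
  rewrite (transl_add m2 ic0 hs) // -map_transl -!aE mat2_map_mul mat2_mulA.
  by rewrite -(mat2_mulA (mat2_map s N)) -mat2_map_mul NN' mat2_map_one mat2_1mul.
have aC : gal_continuous a.
  (* The value at [s] depends only on the action of [s] on the four entries of [N]. *)
  move=> s; exists [:: m11 N; m12 N; m21 N; m22 N] => t st.
  apply: transl_inj => //; rewrite -!aE; congr mat2_mul.
  by rewrite /mat2_map !st // !inE eqxx ?orbT.
by exists (Cocycle aT aM aC).
Qed.

Lemma form_of_class (a : cocycle i (ec_T sqrtc)) : exists A B C D (N : mat2 ks) u,
  [/\ u != 0, disc_f A B C D = (- c / 27%:R) * u ^+ 6, mat2_det N != 0,
      cubic_form_comp (CubicForm (i A) (i B) (i C) (i D)) N = ec_form (i c)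
    & forall s : gal i, mat2_map s N = mat2_mul N (transl (a s))].
Proof.
have [N [dN aN]] := hilbert90 hks m2 ic0 hs a.
have [N' [NN' N'N dN']] := mat2_inverse dN.
have fixN' (s : gal i) : mat2_map s N' = mat2_mul (transl (ec_opp (a s))) N'.
  have e1 : mat2_mul (mat2_map s N') (mat2_mul N (transl (a s))) = mat2_one ks.
    by rewrite -aN -mat2_map_mul N'N mat2_map_one.
  rewrite -[LHS]mat2_mul1 -NN' -[in X in mat2_mul _ X](mat2_mul1 N).
  rewrite -(transl_opp m2 ic0 hs (cocycle_in a s)) -!mat2_mulA.
  by rewrite (mat2_mulA (mat2_map s N')) e1 mat2_1mul.
pose f := cubic_form_comp (ec_form (i c)) N'.
have fixf (s : gal i) : cubic_form_map s f = f.
  rewrite /f cubic_form_comp_map fixN' -cubic_form_compA.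
  have -> : cubic_form_map s (ec_form (i c)) = ec_form (i c).
    by rewrite /cubic_form_map /ec_form /= rmorph0 fmorphV rmorph_nat rmorphN gal_fix.
  by rewrite (ec_form_transl m2 m3 ic0 hs) //; apply: ec_T_opp; apply: cocycle_in.
have rat (g : cubic_form ks -> ks) : (forall (s : gal i) q, g (cubic_form_map s q) = s (g q)) ->
    exists x, g f = i x.
  by move=> h; apply: (fixed_field hks) => s; rewrite -h fixf.
have [A eA] := rat (@cfA ks) (fun s q => erefl); have [B eB] := rat (@cfB ks) (fun s q => erefl).
have [C eC] := rat (@cfC ks) (fun s q => erefl); have [D eD] := rat (@cfD ks) (fun s q => erefl).
have fE : CubicForm (i A) (i B) (i C) (i D) = f by rewrite -eA -eB -eC -eD; case: (f).
(* The matrices of translations have determinant 1, so the determinant of [N'] is Galois invariant;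
   it is the [u] whose sixth power relates the discriminants. *)
have [u uE] : exists u, mat2_det N' = i u.
  apply: (fixed_field hks) => s; rewrite -mat2_det_map fixN' mat2_det_mul.
  by rewrite (transl_det m2 ic0 hs) ?mul1r //; apply: ec_T_opp; apply: cocycle_in.
exists A, B, C, D, N, u; split=> //.
- by rewrite -(fmorph_eq0 i) -uE dN' invr_eq0.
- apply: (fmorph_inj i).
  rewrite -[LHS]/(i (cubic_form_disc (CubicForm A B C D))) -cubic_form_disc_map.
  rewrite [cubic_form_map _ _]fE /f cubic_form_disc_comp // (ec_form_disc _ m2 m3).
  by rewrite uE rmorphM rmorphXn fmorph_div rmorphN rmorph_nat.
- by rewrite fE /f cubic_form_compA N'N cubic_form_comp1.
Qed.

End Classes.

Theorem theorem6p1 (k ks K : fieldType)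
    (i : {rmorphism k -> ks}) (j : {rmorphism ks -> K})
    (hks : separable_closure i)
    (hK : algebraic_closure (rcomp j i))
    (hchar2 : 2%N \notin [pchar k]) (hchar3 : 3%N \notin [pchar k])
    (c : k) (hc : c != 0)
    (sqrtc : ks) (hsqrtc : sqrtc ^+ 2 = i c) :
  let Delta := - c / 27%:R in
  (forall xi : H1 i (on_ec (i c)), (exists eta, Psi hsqrtc eta = xi) ->
     (exists V : pvar k, underlying_curve j xi V) /\
     (forall V : pvar k, underlying_curve j xi V ->
        exists A B C D : k,
          [/\ disc_f A B C D != 0,
              eq_mod_sixth_powers (disc_f A B C D) Delta
            & isomorphic (rcomp j i) V (Cf_curve A B C D)])) /\
  (forall A B C D : k,
     disc_f A B C D != 0 ->
     eq_mod_sixth_powers (disc_f A B C D) Delta ->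
     exists xi : H1 i (on_ec (i c)), (exists eta, Psi hsqrtc eta = xi) /\
       exists2 V : pvar k, underlying_curve j xi V
         & isomorphic (rcomp j i) (Cf_curve A B C D) V).
Proof.
move=> Delta; have [_ hKc] := hK.
have n2 : 2%:R != 0 :> k by move: hchar2; rewrite inE.
have n3 : 3%:R != 0 :> k by move: hchar3; rewrite inE.
have n27 : 27%:R != 0 :> k by rewrite -[27%N]/(3 ^ 3)%N natrX expf_neq0.
have Delta0 : Delta != 0 by rewrite mulf_neq0 ?oppr_eq0 ?invr_eq0.
split=> [xi [eta <-]|A B C D d0 [u u0 hu]].
  have [A [B [C [D [N [u [u0 hu dN tN aN]]]]]]] :=
    form_of_class hks n2 n3 hc hsqrtc (H1_repr eta).
  have d0 : disc_f A B C D != 0 by rewrite hu mulf_neq0 ?expf_neq0.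
  have mem : sval eta (H1_repr eta).
    by rewrite H1_reprE; apply: cohomologous_refl; constructor 1.
  have hC := Cf_underlying j hks hKc n2 n3 hc hsqrtc d0 dN tN aN mem.
  split; first by exists (Cf_curve A B C D).
  (* The coefficients found for one curve serve every [V] of the same class, all of these being
     isomorphic. *)
  move=> V [mu hmu cmu]; exists A, B, C, D; split=> //.
    by exists u => //; rewrite hu mulrAC mulfV // mul1r.
  by case: hC => mu' hmu' cmu'; apply: (phs_isomorphic hks hKc n2 n3 hc hmu hmu' cmu cmu').
have hu' : disc_f A B C D = Delta * u ^+ 6 by rewrite -hu mulrC divfK.
have [N [dN tN]] := cubic_normalize j hks hKc n2 n3 d0 u0 hu'.
have u0' : u^-1 != 0 by rewrite invr_eq0.
have [a aN] := class_of_form n2 n3 hc hsqrtc dN u0' tN.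
have dN0 : mat2_det N != 0 by rewrite dN fmorph_eq0.
exists (Psi hsqrtc (H1_class a)); split; first by exists (H1_class a).
exists (Cf_curve A B C D); last exact: isomorphic_refl.
apply: (Cf_underlying j hks hKc n2 n3 hc hsqrtc d0 dN0 tN aN).
by apply: cohomologous_refl; constructor 1.
Qed.
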